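(* Let $\mu$ be a positive Borel measure on $\mathbb{D}$ with $\int_{\mathbb{D}}(1-|z|^2)\,d\mu(z)<\infty$. The following conditions are equivalent: (i) The Hilbert matrix operator $\mathcal{H}$ sends $H^\infty$ into $M(\mathcal{D}_\mu)$, i.e. $\mathcal{H}(f)\in M(\mathcal{D}_\mu)$ for every $f\in H^\infty$. (ii) The function $z\mapsto\log(1-z)$ belongs to $M(\mathcal{D}_\mu)$. (iii) $\displaystyle\sup_{\lambda\in\mathbb{T}}\int_{\mathbb{D}}\frac{V_\mu(z)}{|1-\lambda z|^2}\,dA(z)<\infty.$ (iv) $\displaystyle\sup_{a\in\mathbb{D}}\int_{\mathbb{D}}\frac{V_\mu(z)}{|1-az|^2}\,dA(z)<\infty.$
   Context: $\mathbb{D}$ is the open unit disc in $\mathbb{C}$, $\mathbb{T}=\partial\mathbb{D}$, $dA(z)=\pi^{-1}\,dx\,dy$ for $z=x+iy$, $\mathrm{Hol}(\mathbb{D})$ is the space of analytic functions on $\mathbb{D}$, and $\mathrm{Aut}(\mathbb{D})$ is the group of one-to-one analytic maps of $\mathbb{D}$ onto itself. $H^\infty$ is the space of bounded analytic functions on $\mathbb{D}$. The logarithm is the principal branch. For $f(z)=\sum_{k\ge 0}a_kz^k$ in the Hardy space $H^1$, the Hilbert matrix operator is $$\mathcal{H}(f)(z)=\sum_{n=0}^{\infty}\left(\sum_{k=0}^{\infty}\frac{a_k}{k+n+1}\right)z^n=\int_0^1\frac{f(t)}{1-tz}\,dt,\qquad z\in\mathbb{D}.$$ For a positive Borel measure $\mu$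 on $\mathbb{D}$ put $$U_\mu(z)=\int_{\mathbb{D}}\log\left|\frac{1-\overline{w}z}{z-w}\right|^2d\mu(w),\qquad V_\mu(z)=\int_{\mathbb{D}}\left(1-|\sigma_z(w)|^2\right)d\mu(w),\qquad \sigma_z(w)=\frac{z-w}{1-\overline{z}w}.$$ The conformally invariant Dirichlet space $M(\mathcal{D}_\mu)$ consists of all $f\in\mathrm{Hol}(\mathbb{D})$ such that $$\|f\|_{M(\mathcal{D}_\mu)}=|f(0)|+\sup_{\phi\in\mathrm{Aut}(\mathbb{D})}\left(\int_{\mathbb{D}}|f'(w)|^2U_\mu(\phi(w))\,dA(w)\right)^{1/2}<\infty.$$ *)

(* Defs.v *)
From HB Require Import structures.
From mathcomp Require Import all_boot all_order all_algebra.
From mathcomp Require Import all_classical all_reals all_analysis.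
From mathcomp Require Import complex.

Set Implicit Arguments.
Unset Strict Implicit.
Unset Printing Implicit Defensive.

Import Order.TTheory GRing.Theory Num.Theory.
Import numFieldNormedType.Exports.

Local Open Scope classical_set_scope.
Local Open Scope ring_scope.

(* The complex numbers R[i], declared as a numFieldType so that R[i] inherits
   the topology and the normed module structure (over itself) with which
   [derivable] and [derive1] are the complex derivative.  The norm `|z| of this
   structure lives in R[i]; [cabs z : R] is the real-valued modulus. *)
Definition Cx (R : realType) : numFieldType := R[i].

Definition cabs (R : realType) (z : Cx R) : R := Normc.normc z.

Definition cconj (R : realType) (z : Cx R) : Cx R := (z^*)%C.

(* Measures live on R^2 with its product (= Borel) sigma-algebra; R^2 is
   identified with C by [toC].  A Borel measure on the disc is the restriction
   to [discP] of a measure on the plane, the only part that is ever used. *)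
Notation plane R := (measurableTypeR R * measurableTypeR R)%type.

Definition toC (R : realType) (p : plane R) : Cx R := (p.1 +i* p.2)%C.

Definition disc (R : realType) : set (Cx R) := [set z | cabs z < 1].

Definition circle (R : realType) : set (Cx R) := [set z | cabs z = 1].

Definition discP (R : realType) : set (plane R) := @toC R @^-1` @disc R.

Lemma pi_inv_ge0 (R : realType) : 0 <= (pi : R)^-1.
Proof. by rewrite invr_ge0 pi_ge0. Qed.

Definition dA (R : realType) : {measure set (plane R) -> \bar R} :=
  mscale (NngNum (pi_inv_ge0 R)) (lebesgue_measure \x lebesgue_measure)%E.

Definition holomorphic (R : realType) (f : Cx R -> Cx R) : Prop :=
  forall z, disc z -> derivable f z 1.

Definition Aut (R : realType) : set (Cx R -> Cx R) :=
  [set phi | holomorphic phi /\ set_bij (@disc R) (@disc R) phi].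

Definition Hinf (R : realType) : set (Cx R -> Cx R) :=
  [set f | holomorphic f /\
           exists M : R, forall z, disc z -> cabs (f z) <= M].

Definition Arg (R : realType) (z : Cx R) : R :=
  if 0 <= complex.Im z then acos (complex.Re z / cabs z)
  else - acos (complex.Re z / cabs z).

Definition Log (R : realType) (z : Cx R) : Cx R :=
  (ln (cabs z) +i* Arg z)%C.

(* The sequence a such that f(z) = sum_k a_k z^k on the disc (unique when f is
   holomorphic there; the default 0 is for functions without an expansion). *)
Definition taylor (R : realType) (f : Cx R -> Cx R) : (Cx R)^nat :=
  xget (fun=> 0) [set a : (Cx R)^nat | forall z, disc z ->
    series (fun k => a k * z ^+ k) @ \oo --> f z].

(* The series definition of the Hilbert matrix operator; both series converge
   for f in H^1, in particular for bounded f, and |z| < 1. *)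
Definition hilbert (R : realType) (f : Cx R -> Cx R) (z : Cx R) : Cx R :=
  limn (series (fun n =>
    limn (series (fun k => taylor f k / (k + n + 1)%:R)) * z ^+ n)).

Definition sigma (R : realType) (z w : Cx R) : Cx R :=
  (z - w) / (1 - cconj z * w).

(* The value +oo on the diagonal is the convention log (c / 0) = +oo. *)
Definition green (R : realType) (z w : Cx R) : \bar R :=
  if z == w then +oo%E
  else (ln (cabs ((1 - cconj w * z) / (z - w)) ^+ 2))%:E.

Definition U (R : realType) (mu : {measure set (plane R) -> \bar R})
    (z : Cx R) : \bar R :=
  (\int[mu]_(w in @discP R) green z (toC w))%E.

Definition V (R : realType) (mu : {measure set (plane R) -> \bar R})
    (z : Cx R) : \bar R :=
  (\int[mu]_(w in @discP R) (1 - cabs (sigma z (toC w)) ^+ 2)%:E)%E.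

Definition normMD (R : realType) (mu : {measure set (plane R) -> \bar R})
    (f : Cx R -> Cx R) : \bar R :=
  ((cabs (f 0))%:E +
   ereal_sup [set (\int[@dA R]_(w in @discP R)
                    ((cabs (f^`()%classic (toC w)) ^+ 2)%:E *
                     U mu (phi (toC w)))) `^ 2^-1 | phi in @Aut R])%E.

Definition MD (R : realType) (mu : {measure set (plane R) -> \bar R}) :
    set (Cx R -> Cx R) :=
  [set f | holomorphic f /\ (normMD mu f < +oo)%E].

(* Main.v *)
(* All four conditions are equivalent to the Carleson-type bound
     J:  sup over |l| = 1 of the integral of (1 - |w|^2) / |1 - l w| dmu(w),
   because the derivatives of log (1 - z) and of H(1) are comparable to
   1 / |1 - z| on the disc, and |H(f)'| <= K / |1 - z| for every bounded f.

   From J to membership: an automorphism phi is c * (Moebius map), so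
   U_mu (phi z) is the mu-integral over w of a Green function with pole
   b = phi^-1 w, and that function is at most
   2 (1 - |b|^2) (1 - |z|^2) / (|1 - b* z| |z - b|).  Divided by |1 - z|^2 its
   dA-integral is at most C (1 - |b|^2) / |1 - b|: the only singularities are 1
   and b, at mutual distance |1 - b|, and near each of them the kernel is
   dominated by a dyadic sum of indicators of squares.  Then Tonelli applies,
   and (1 - |b|^2) / |1 - b| is dominated by two integrands of the form in J.
   Conversely, the integrand of (iii) and (iv) is bounded below on a square of
   side comparable to |1 - a w| close to w, which gives J by Tonelli (and Fatou
   when |a| -> 1).

   H(f)' is estimated on partial sums, by a mean value inequality in place of
   the integral representation of H; the double series converges because the
   Taylor coefficients of f are square summable (Parseval for roots of unity).
   Automorphisms are Moebius maps by the maximum principle, itself obtained from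
   Goursat's bisection with trapezoidal sums in place of contour integrals. *)
Require Import Defs.
From HB Require Import structures.
From mathcomp Require Import all_boot all_order all_algebra.
From mathcomp Require Import all_classical all_reals all_analysis.
From mathcomp Require Import complex.
From mathcomp Require Import measurable_realfun.
From mathcomp Require Import ring lra.
Set Implicit Arguments.
Unset Strict Implicit.
Unset Printing Implicit Defensive.
Import Order.TTheory GRing.Theory Num.Theory.
Import numFieldNormedType.Exports.
Local Open Scope classical_set_scope.
Local Open Scope ring_scope.

(** The obstacle behind the estimates is measurability: [U mu], [V mu] and the derivative of f stand
    under integral signs without being shown measurable. Integrals are therefore compared only by
    monotonicity and by positive factors, and Tonelli is applied only to explicit kernels that bound
    these functions from above or below. Sums of indicators of squares serve here, as their joint
    measurability and their integrals are elementary. The sigma-finiteness that Tonelli requires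
    comes from the hypothesis on [mu]: inside the disc, the set where 1 - |w|^2 is at least 1/n has
    finite measure. One function with its singularity at 1 controls J at every point of the circle
    because the norm is a supremum over automorphisms: rotations carry the singularity around the
    circle. The inequality 1 - s <= log (1/s) with s = |sigma|^2 gives V <= U, so one lower bound
    serves all four conditions. From above, log x <= x - 1/x for x >= 1 is used with x = |1 - conj b
    z| / |z - b|, since x - 1/x then has the numerator (1 - |b|^2) (1 - |z|^2). *)

Lemma le_of_eq d (T : porderType d) (x y : T) : x = y -> (x <= y)%O.
Proof. by move->. Qed.

(** * Modulus, conjugation and coordinates of complex numbers *)

Section ComplexBasics.
Context {R : realType}.
Implicit Types (x y z w : Cx R) (r s t : R).

Definition RC (r : R) : Cx R := (r%:C)%C.
Definition Rez (z : Cx R) : R := complex.Re z.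
Definition Imz (z : Cx R) : R := complex.Im z.

Lemma cabs_ge0 z : 0 <= cabs z.
Proof. by case: z => a b; exact: sqrtr_ge0. Qed.
Lemma cabsM z w : cabs (z * w) = cabs z * cabs w.
Proof. exact: Normc.normcM. Qed.
Lemma cabsV z : cabs z^-1 = (cabs z)^-1. Proof. exact: Normc.normcV. Qed.
Lemma cabs_div z w : cabs (z / w) = cabs z / cabs w.
Proof. by rewrite cabsM cabsV. Qed.
Lemma cabs0 : cabs (0 : Cx R) = 0. Proof. exact: Normc.normc0. Qed.
Lemma cabs1 : cabs (1 : Cx R) = 1. Proof. exact: Normc.normc1. Qed.
Lemma cabsN z : cabs (- z) = cabs z. Proof. exact: normcN. Qed.
Lemma cabsD z w : cabs (z + w) <= cabs z + cabs w. Proof. exact: le_normcD. Qed.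
Lemma cabsB z w : cabs (z - w) <= cabs z + cabs w.
Proof. by rewrite (le_trans (cabsD _ _))// cabsN. Qed.
Lemma cabsBC z w : cabs (z - w) = cabs (w - z).
Proof. by rewrite -cabsN opprB. Qed.
Lemma cabs_ge_sub z w : cabs z - cabs w <= cabs (z - w).
Proof. by have := cabsD (z - w) w; rewrite subrK; lra. Qed.
Lemma cabs_eq0 z : (cabs z == 0) = (z == 0).
Proof. by apply/eqP/eqP => [/Normc.eq0_normc//|->]; exact: cabs0. Qed.
Lemma cabs_gt0 z : (0 < cabs z) = (z != 0).
Proof. by rewrite lt_neqAle cabs_ge0 andbT eq_sym cabs_eq0. Qed.
Lemma cabsX z n : cabs (z ^+ n) = cabs z ^+ n.
Proof. by elim: n => [|n ih]; rewrite ?expr0 ?cabs1// !exprS cabsM ih. Qed.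
Lemma cabs_RC r : cabs (RC r) = `|r|.
Proof. by rewrite /cabs /RC /= expr0n addr0 sqrtr_sqr. Qed.
Lemma cabs_sum (I : Type) (s : seq I) (P : pred I) (F : I -> Cx R) :
  cabs (\sum_(i <- s | P i) F i) <= \sum_(i <- s | P i) cabs (F i).
Proof.
elim/big_rec2: _ => [|i r w _ h]; first by rewrite cabs0.
by rewrite (le_trans (cabsD _ _))// lerD2l.
Qed.
Lemma cabs_sqr z : cabs z ^+ 2 = Rez z ^+ 2 + Imz z ^+ 2.
Proof. by case: z => a b; rewrite /cabs /= sqr_sqrtr// addr_ge0// sqr_ge0. Qed.
Lemma normE z : `|z| = RC (cabs z).
Proof. by case: z. Qed.

Lemma cabs_cconj z : cabs (cconj z) = cabs z.
Proof. by case: z => a b; rewrite /cabs /= sqrrN. Qed.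
Lemma cconjM z w : cconj (z * w) = cconj z * cconj w. Proof. exact: rmorphM. Qed.
Lemma cconjB z w : cconj (z - w) = cconj z - cconj w. Proof. exact: rmorphB. Qed.
Lemma cconjN z : cconj (- z) = - cconj z. Proof. exact: rmorphN. Qed.
Lemma cconj1 : cconj (1 : Cx R) = 1. Proof. exact: rmorph1. Qed.
Lemma cconj0 : cconj (0 : Cx R) = 0. Proof. exact: rmorph0. Qed.
Lemma cconjK z : cconj (cconj z) = z. Proof. exact: conjcK. Qed.
Lemma cconj_inv z : cconj z^-1 = (cconj z)^-1. Proof. exact: conjc_inv. Qed.
Lemma mul_cconj z : z * cconj z = RC (cabs z ^+ 2).
Proof.
rewrite cabs_sqr; case: z => a b; rewrite /cconj /RC /Rez /Imz /=; simpc.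
by congr Complex; ring.
Qed.

Lemma RezD z w : Rez (z + w) = Rez z + Rez w. Proof. by case: z w => [? ?] []. Qed.
Lemma ImzD z w : Imz (z + w) = Imz z + Imz w. Proof. by case: z w => [? ?] []. Qed.
Lemma RezN z : Rez (- z) = - Rez z. Proof. by case: z. Qed.
Lemma ImzN z : Imz (- z) = - Imz z. Proof. by case: z. Qed.
Lemma RezB z w : Rez (z - w) = Rez z - Rez w. Proof. by rewrite RezD RezN. Qed.
Lemma ImzB z w : Imz (z - w) = Imz z - Imz w. Proof. by rewrite ImzD ImzN. Qed.
Lemma RezM z w : Rez (z * w) = Rez z * Rez w - Imz z * Imz w.
Proof. by case: z w => [? ?] []. Qed.
Lemma ImzM z w : Imz (z * w) = Rez z * Imz w + Imz z * Rez w.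
Proof. by case: z w => [? ?] [? ?]; rewrite /Imz /=. Qed.
Lemma Rez_RC r : Rez (RC r) = r. Proof. by []. Qed.
Lemma Imz_RC r : Imz (RC r) = 0. Proof. by []. Qed.
Lemma RezC z : Rez (cconj z) = Rez z. Proof. by case: z. Qed.
Lemma ImzC z : Imz (cconj z) = - Imz z. Proof. by case: z. Qed.
Lemma Rez1 : Rez 1 = 1. Proof. by []. Qed.
Lemma Rez0 : Rez 0 = 0. Proof. by []. Qed.
Lemma Imz1 : Imz 1 = 0. Proof. by []. Qed.
Lemma Imz0 : Imz 0 = 0. Proof. by []. Qed.
Lemma cplx_eq z w : Rez z = Rez w -> Imz z = Imz w -> z = w.
Proof. by case: z w => [? ?] [? ?]; rewrite /Rez /Imz /= => -> ->. Qed.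
Lemma Rez_le z : `|Rez z| <= cabs z.
Proof.
rewrite -(@ler_pXn2r _ 2) ?nnegrE ?cabs_ge0// cabs_sqr real_normK ?num_real//.
by rewrite lerDl sqr_ge0.
Qed.
Lemma Imz_le z : `|Imz z| <= cabs z.
Proof.
rewrite -(@ler_pXn2r _ 2) ?nnegrE ?cabs_ge0// cabs_sqr real_normK ?num_real//.
by rewrite lerDr sqr_ge0.
Qed.
Lemma cabs_le_ReIm z : cabs z <= `|Rez z| + `|Imz z|.
Proof.
rewrite -(@ler_pXn2r _ 2) ?nnegrE ?cabs_ge0 ?addr_ge0// cabs_sqr.
rewrite -(real_normK (num_real (Rez z))) -(real_normK (num_real (Imz z))).
have := normr_ge0 (Rez z); have := normr_ge0 (Imz z); nra.
Qed.
Lemma RCD r s : RC (r + s) = RC r + RC s. Proof. exact: rmorphD. Qed.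
Lemma RCB r s : RC (r - s) = RC r - RC s. Proof. exact: rmorphB. Qed.
Lemma RCM r s : RC (r * s) = RC r * RC s. Proof. exact: rmorphM. Qed.
Lemma RCV r : RC r^-1 = (RC r)^-1. Proof. exact: fmorphV. Qed.
Lemma RC0 : RC 0 = 0. Proof. by []. Qed.
Lemma RC1 : RC 1 = 1. Proof. by []. Qed.
Lemma RC_nat n : RC n%:R = n%:R. Proof. exact: rmorph_nat. Qed.
Lemma RCX r n : RC (r ^+ n) = RC r ^+ n. Proof. exact: rmorphXn. Qed.
Lemma RC_eq0 r : (RC r == 0) = (r == 0). Proof. exact: fmorph_eq0. Qed.
Lemma ltRC r s : (RC r < RC s) = (r < s). Proof. exact: ltcR. Qed.
Lemma leRC r s : (RC r <= RC s) = (r <= s). Proof. exact: lecR. Qed.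
End ComplexBasics.

(** * Limits and complex derivatives with real epsilons *)

Section Bridge.
Context {R : realType}.
Implicit Types (x y z w : Cx R) (r s t : R).
Lemma gt0_RC z : 0 < z -> exists2 r, 0 < r & z = RC r.
Proof.
move=> z0; exists (Rez z); last first.
  by apply: cplx_eq => //; rewrite Imz_RC /Imz; exact: (ger0_Im (ltW z0)).
have := z0; rewrite /Rez; case: z {z0} => a b; rewrite ltcE /= => /andP[_ //].
Qed.

Lemma ccvgP (u : (Cx R)^nat) (l : Cx R) :
  (u @ \oo --> l) <-> (forall e : R, 0 < e ->
     exists N, forall n, (N <= n)%N -> cabs (u n - l) <= e).
Proof.
split.
  move=> /cvgrPdist_le h e e0.
  have := h (RC e); rewrite -RC0 ltRC => /(_ e0) [N _ hN].
  exists N => n Nn; have := hN n Nn.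
  by rewrite /= normE leRC cabsBC.
move=> h; apply/cvgrPdist_le => _/gt0_RC[e e0 ->].
have [N hN] := h e e0; exists N => // n Nn.
by rewrite /= normE leRC cabsBC; exact: hN.
Qed.

(** The difference quotient is multiplied out and all bounds are real: nothing is divided, [h = 0]
    is no exception, and estimates become real inequalities. *)
Definition cderiv (f : Cx R -> Cx R) z d := forall e : R, 0 < e ->
  exists2 t : R, 0 < t & forall h, cabs h < t ->
    cabs (f (z + h) - f z - d * h) <= e * cabs h.

Lemma cderiv_cvg f z d : cderiv f z d <->
  (fun h : Cx R => h^-1 *: (f (h *: 1 + z) - f z)) @ 0^' --> d.
Proof.
split.
  move=> h; apply/cvgrPdist_le => _/gt0_RC[e e0 ->].
  have [t t0 ht] := h e e0; exists (RC t) => /=; first by rewrite -RC0 ltRC.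
  move=> k /=; rewrite sub0r normrN normE ltRC => kt k0.
  rewrite normE leRC scaler1 (addrC k) -(ler_pM2r (_ : 0 < cabs k)) ?cabs_gt0//.
  rewrite -cabsM mulrBl /GRing.scale /= mulrAC mulVf// mul1r cabsBC; exact: ht.
move=> /cvgrPdist_le h e e0.
have := h (RC e); rewrite -{1}RC0 ltRC => /(_ e0) [_ /= /gt0_RC[t t0 ->]] ht.
exists t => // k kt.
have [->|k0] := eqVneq k 0; first by rewrite addr0 subrr mulr0 subrr cabs0 mulr0.
have := ht k; rewrite /= sub0r normrN normE ltRC => /(_ kt k0).
rewrite normE leRC scaler1 (addrC k) -(ler_pM2r (_ : 0 < cabs k)) ?cabs_gt0//.
by rewrite -cabsM mulrBl /GRing.scale /= mulrAC mulVf// mul1r cabsBC.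
Qed.

Lemma cderiv_derivable f z d : cderiv f z d -> derivable f z 1.
Proof. by move=> /cderiv_cvg h; apply/cvg_ex; exists d. Qed.

Lemma cderiv_derive1 f z d : cderiv f z d -> f^`()%classic z = d.
Proof.
move=> /cderiv_cvg h; rewrite derive1E /derive; exact: cvg_lim.
Qed.

Lemma derivable_cderiv f z : derivable f z 1 -> cderiv f z (f^`()%classic z).
Proof. by move=> h; apply/cderiv_cvg; rewrite derive1E. Qed.
End Bridge.

(** * Rules of complex differentiation *)

Section DerivRules.
Context {R : realType}.
Implicit Types (x y z w d : Cx R) (r s t e : R) (f g : Cx R -> Cx R).

Lemma cderiv_unique f z d d' : cderiv f z d -> cderiv f z d' -> d = d'.
Proof. by move=> /cderiv_derive1 <- /cderiv_derive1 <-. Qed.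

Lemma cderiv_lip f z d : cderiv f z d -> exists2 t, 0 < t & forall h,
  cabs h < t -> cabs (f (z + h) - f z) <= (cabs d + 1) * cabs h.
Proof.
move=> /(_ _ ltr01)[t t0 ht]; exists t => // h /ht; rewrite mul1r => hh.
rewrite (_ : f (z + h) - f z = f (z + h) - f z - d * h + d * h); last by rewrite subrK.
by rewrite (le_trans (cabsD _ _))// cabsM; lra.
Qed.

Lemma cderiv_cont f z d : cderiv f z d -> forall e, 0 < e ->
  exists2 t, 0 < t & forall h, cabs h < t -> cabs (f (z + h) - f z) <= e.
Proof.
move=> /cderiv_lip[t t0 ht] e e0.
have D0 : 0 < cabs d + 1 by have := cabs_ge0 d; lra.
exists (Num.min t (e / (cabs d + 1))); first by rewrite lt_min t0 divr_gt0.
move=> h; rewrite lt_min => /andP[/ht hh]; rewrite ltr_pdivlMr// => he.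
by rewrite (le_trans hh)// mulrC ltW.
Qed.

Lemma cderiv_cst c z : cderiv (fun=> c) z 0.
Proof.
move=> e e0; exists 1 => // h _.
by rewrite subrr mul0r subrr cabs0 mulr_ge0 ?cabs_ge0// ltW.
Qed.

Lemma cderiv_id z : cderiv id z 1.
Proof.
move=> e e0; exists 1 => // h _.
rewrite (_ : _ - _ = 0); last by rewrite /=; ring.
by rewrite cabs0 mulr_ge0 ?cabs_ge0// ltW.
Qed.

Lemma cderiv_eq f z d d' : cderiv f z d -> d = d' -> cderiv f z d'.
Proof. by move=> h <-. Qed.

Lemma cderiv_ext f g z d t : 0 < t ->
  (forall h, cabs h < t -> f (z + h) = g (z + h)) -> cderiv f z d -> cderiv g z d.
Proof.
move=> t0 fg fd e e0; have [s s0 hs] := fd e e0.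
exists (Num.min t s); first by rewrite lt_min t0.
move=> h; rewrite lt_min => /andP[ht /hs].
by rewrite fg// -(addr0 z) -fg ?cabs0// addr0.
Qed.

Lemma cderivD f g z d d' : cderiv f z d -> cderiv g z d' ->
  cderiv (fun w => f w + g w) z (d + d').
Proof.
move=> fd gd e e0; have e2 : 0 < e / 2 by rewrite divr_gt0.
have [s s0 hs] := fd _ e2; have [t t0 ht] := gd _ e2.
exists (Num.min t s); first by rewrite lt_min t0.
move=> h; rewrite lt_min => /andP[/ht h1 /hs h2].
rewrite (_ : _ - _ = (f (z + h) - f z - d * h) + (g (z + h) - g z - d' * h)); last by ring.
by rewrite (le_trans (cabsD _ _))//; lra.
Qed.

Lemma cderivM f g z d d' : cderiv f z d -> cderiv g z d' ->
  cderiv (fun w => f w * g w) z (d * g z + f z * d').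
Proof.
move=> fd gd e e0.
pose K := cabs (g z) + 1 + cabs d + cabs (f z).
have K0 : 0 < K by rewrite /K; have := cabs_ge0 (g z); have := cabs_ge0 d; have := cabs_ge0 (f z); lra.
pose e1 := Num.min 1 (e / K).
have e10 : 0 < e1 by rewrite lt_min ltr01 divr_gt0.
have e1K : e1 * K <= e.
  by rewrite -ler_pdivlMr// ge_min lexx orbT.
have e11 : e1 <= 1 by rewrite ge_min lexx.
have [s s0 hs] := fd _ e10; have [t t0 ht] := gd _ e10.
have [u u0 hu] := cderiv_cont gd e10.
exists (Num.min u (Num.min t s)); first by rewrite !lt_min t0 u0.
move=> h; rewrite !lt_min => /and3P[/hu h3 /ht h1 /hs h2].
rewrite (_ : _ - _ = (f (z + h) - f z - d * h) * (g z + (g (z + h) - g z))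
  + d * h * (g (z + h) - g z) + f z * (g (z + h) - g z - d' * h)); last by ring.
rewrite (le_trans (cabsD _ _))// (le_trans (lerD (cabsD _ _) (lexx _)))// !cabsM.
have h4 : cabs (g z + (g (z + h) - g z)) <= cabs (g z) + 1.
  by rewrite (le_trans (cabsD _ _))//; lra.
have h0 := cabs_ge0 h.
apply: (@le_trans _ _ (e1 * K * cabs h)); last by rewrite ler_wpM2r.
rewrite (_ : e1 * K * cabs h = e1 * cabs h * (cabs (g z) + 1) + cabs d * cabs h * e1 +
  cabs (f z) * (e1 * cabs h)); last by rewrite /K; ring.
rewrite !lerD// ?ler_pM ?mulr_ge0 ?cabs_ge0//.
Qed.

Lemma cderiv_comp f g z d d' : cderiv f (g z) d -> cderiv g z d' ->
  cderiv (fun w => f (g w)) z (d * d').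
Proof.
move=> fd gd e e0.
pose K := cabs d' + 1 + cabs d.
have K0 : 0 < K by rewrite /K; have := cabs_ge0 d'; have := cabs_ge0 d; lra.
pose e1 := e / K; have e10 : 0 < e1 by rewrite divr_gt0.
have [s s0 hs] := fd _ e10; have [t t0 ht] := gd _ e10.
have [u u0 hu] := cderiv_lip gd.
have s20 : 0 < s / 2 by rewrite divr_gt0.
have [v v0 hv] := cderiv_cont gd s20.
exists (Num.min v (Num.min u t)); first by rewrite !lt_min t0 u0 v0.
move=> h; rewrite !lt_min => /and3P[/hv h3 /hu h1 /ht h2].
have h4 : cabs (g (z + h) - g z) < s by lra.
have := hs _ h4; rewrite (addrC (g z)) subrK => h5.
rewrite (_ : _ - _ = (f (g (z + h)) - f (g z) - d * (g (z + h) - g z))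
  + d * (g (z + h) - g z - d' * h)); last by ring.
rewrite (le_trans (cabsD _ _))// cabsM.
apply: (@le_trans _ _ (e1 * ((cabs d' + 1) * cabs h) + cabs d * (e1 * cabs h))).
  rewrite lerD//; last by rewrite ler_wpM2l// cabs_ge0.
  by rewrite (le_trans h5)// ler_wpM2l// ltW.
rewrite (_ : _ + _ = e1 * K * cabs h); last by rewrite /K; ring.
by rewrite /e1 divfK ?gt_eqF.
Qed.

Lemma cderiv_inv z : z != 0 -> cderiv (fun w => w^-1) z (- z ^- 2).
Proof.
move=> z0 e e0; have Z0 : 0 < cabs z by rewrite cabs_gt0.
exists (Num.min (cabs z / 2) (e * cabs z ^+ 3 / 2)).
  by rewrite lt_min !divr_gt0// mulr_gt0// exprn_gt0.
move=> h; rewrite lt_min => /andP[h1 h2].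
have h3 : cabs z / 2 <= cabs (z + h).
  by have := cabs_ge_sub z (- h); rewrite opprK cabsN; lra.
have zh0 : z + h != 0 by rewrite -cabs_gt0; lra.
rewrite (_ : _ - _ = h ^+ 2 * (z ^- 2 * (z + h)^-1)); last first.

  by field; rewrite zh0 z0.
have -> : cabs (h ^+ 2 * (z ^- 2 * (z + h)^-1)) =
    cabs h * (cabs z ^- 2 / cabs (z + h)) * cabs h.
  by rewrite !cabsM !cabsV !cabsX; ring.
rewrite ler_wpM2r ?cabs_ge0//.
have Z20 : 0 < cabs z ^+ 2 by rewrite exprn_gt0.
rewrite mulrA ler_pdivrMr ?(lt_le_trans _ h3) ?divr_gt0// ler_pdivrMr//.
apply: (le_trans (ltW h2)).
rewrite (_ : _ / 2 = e * (cabs z / 2) * cabs z ^+ 2); last by ring.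
apply: ler_wpM2r; first exact: ltW.
by apply: ler_wpM2l => //; exact: ltW.
Qed.

Lemma cderivV g z d : g z != 0 -> cderiv g z d ->
  cderiv (fun w => (g w)^-1) z (- g z ^- 2 * d).
Proof. by move=> gz; exact/cderiv_comp/cderiv_inv. Qed.

Lemma cderivN f z d : cderiv f z d -> cderiv (fun w => - f w) z (- d).
Proof.
move=> fd; have := cderivM (cderiv_cst (-1) z) fd.
by rewrite mul0r add0r mulN1r; apply: (cderiv_ext ltr01) => h _; rewrite mulN1r.
Qed.

Lemma cderivB f g z d d' : cderiv f z d -> cderiv g z d' ->
  cderiv (fun w => f w - g w) z (d - d').
Proof. by move=> fd /cderivN; exact: cderivD. Qed.

Lemma cderivZ c f z d : cderiv f z d -> cderiv (fun w => c * f w) z (c * d).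
Proof.
by move=> /(cderivM (cderiv_cst c z)); rewrite mul0r add0r.
Qed.

Lemma cderivX n z : cderiv (fun w => w ^+ n) z (n%:R * z ^+ n.-1).
Proof.
elim: n => [|n ih].
  by rewrite mul0r; apply: (cderiv_ext ltr01) (cderiv_cst 1 z) => h _; rewrite expr0.
have h := cderivM (cderiv_id z) ih.
apply: (cderiv_eq (cderiv_ext ltr01 _ h)) => [k _|]; first by rewrite /= exprS.
rewrite /=.
case: n {ih h} => [|n]; first by rewrite /= !mul1r mul0r mulr0 addr0.
by rewrite /= -natr1 (exprS z n); ring.
Qed.

Lemma cderivXf n g z d : cderiv g z d ->
  cderiv (fun w => g w ^+ n) z (n%:R * g z ^+ n.-1 * d).
Proof. exact: (cderiv_comp (cderivX n (g z))). Qed.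

Lemma cderiv_div f g z d d' : g z != 0 -> cderiv f z d -> cderiv g z d' ->
  cderiv (fun w => f w / g w) z ((d * g z - f z * d') / g z ^+ 2).
Proof.
move=> g0 fd gd; apply: cderiv_eq (cderivM fd (cderivV g0 gd)) _.
by field.
Qed.

End DerivRules.

(** * The complex exponential from the real exponential, sine and cosine *)

Section RealDeriv.
Context {R : realType}.
Implicit Types (x d e t : R) (f : R -> R).

Lemma rderivP f x d : is_derive x 1 f d -> forall e, 0 < e ->
  exists2 t, 0 < t & forall h, `|h| < t -> `|f (x + h) - f x - d * h| <= e * `|h|.
Proof.
move=> fd e e0; have /cvgrPdist_le/(_ e e0)[t /= t0 ht] : (fun h : R => h^-1 *: (f (h *: 1 + x) - f x)) @ 0^' --> d.
  have <- : 'D_1 f x = d by apply: derive_val.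
  exact: (@ex_derive _ _ _ _ _ _ _ fd).
exists t => // k kt.
have [->|k0] := eqVneq k 0; first by rewrite addr0 subrr mulr0 subrr normr0 mulr0.
have := ht k; rewrite /= sub0r normrN => /(_ kt k0).
rewrite (_ : k *: 1 = k); last exact: mulr1.
rewrite (addrC k) -(ler_pM2r (_ : 0 < `|k|)) ?normr_gt0//.
by rewrite -normrM mulrBl /GRing.scale /= mulrAC mulVf// mul1r distrC.
Qed.
End RealDeriv.

Section ComplexExp.
Context {R : realType}.
Implicit Types (x y z w d : Cx R) (r s t e : R).

Definition cexp (z : Cx R) : Cx R :=
  RC (expR (Rez z)) * (cos (Imz z) +i* sin (Imz z))%C.

Lemma Rez_cexp z : Rez (cexp z) = expR (Rez z) * cos (Imz z).
Proof. by rewrite /cexp RezM Rez_RC Imz_RC mul0r subr0. Qed.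

Lemma Imz_cexp z : Imz (cexp z) = expR (Rez z) * sin (Imz z).
Proof. by rewrite /cexp ImzM Rez_RC Imz_RC mul0r addr0. Qed.

Lemma cexpD z w : cexp (z + w) = cexp z * cexp w.
Proof.
apply: cplx_eq.
  by rewrite RezM !(Rez_cexp, Imz_cexp) RezD ImzD expRD cosD; ring.
by rewrite ImzM !(Rez_cexp, Imz_cexp) RezD ImzD expRD sinD; ring.
Qed.

Lemma cabs_cexp z : cabs (cexp z) = expR (Rez z).
Proof.
apply/eqP; rewrite -(@eqrXn2 _ 2) ?cabs_ge0 ?expR_ge0// cabs_sqr.
by rewrite Rez_cexp Imz_cexp !exprMn -mulrDr cos2Dsin2 mulr1.
Qed.

Lemma cexp0 : cexp 0 = 1.
Proof. by apply: cplx_eq; rewrite !(Rez_cexp, Imz_cexp) Rez0 Imz0 expR0 ?cos0 ?sin0 ?mulr1 ?mulr0. Qed.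

(** The addition formula moves the point to 0, where the linear approximations of the real
    exponential, sine and cosine are combined. *)
Lemma cderiv_cexp z : cderiv cexp z (cexp z).
Proof.
suff h : cderiv cexp 0 1.
  have h1 : cderiv (fun w => w - z) z (1 - 0) by apply: cderivB (cderiv_id z) (cderiv_cst z z).
  have h2 : cderiv cexp (z - z) 1 by rewrite subrr.
  have h3 := cderivZ (cexp z) (@cderiv_comp _ cexp (fun w => w - z) z _ _ h2 h1).
  apply: (cderiv_eq (cderiv_ext ltr01 _ h3)) => [k _|].
    by rewrite /= -cexpD; congr cexp; ring.
  by ring.
move=> e e0.
(* The error will be at most [3 * e1 * cabs h] in each coordinate, hence the 6. *)
pose e1 := Num.min 1 (e / 6).
have e10 : 0 < e1 by rewrite lt_min ltr01 divr_gt0.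
have e11 : e1 <= 1 by rewrite ge_min lexx.
have e1e : e1 <= e / 6 by rewrite ge_min lexx orbT.
have [t1 t10 ht1] := rderivP (is_derive_expR (0:R)) e10.
have [t2 t20 ht2] := rderivP (is_derive_sin (0:R)) e10.
have [t3 t30 ht3] := rderivP (is_derive_cos (0:R)) e10.
exists (Num.min (e1 / 2) (Num.min t1 (Num.min t2 t3))).
  by rewrite !lt_min t10 t20 t30 divr_gt0.
move=> h; rewrite !lt_min => /and4P[h0 h1 h2 h3].
have hs := Rez_le h; have hi := Imz_le h.
have H0 := cabs_ge0 h.
have := ht1 _ (le_lt_trans hs h1); have := ht2 _ (le_lt_trans hi h2).
have := ht3 _ (le_lt_trans hi h3).
rewrite !add0r expR0 sin0 cos0 !(oppr0, mul0r, subr0, addr0, mul1r).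
set s := Rez h in hs *; set i := Imz h in hi *.
move=> H3 H2 H1.
rewrite (le_trans (cabs_le_ReIm _))//.
rewrite cexp0 !RezB !ImzB Rez_cexp Imz_cexp Rez1 Imz1.
rewrite -/s -/i !subr0.
have es : `|expR s - 1| <= e1.
  rewrite (_ : expR s - 1 = expR s - 1 - s + s); last by ring.
  rewrite (le_trans (ler_normD _ _))//.
  by have := normr_ge0 s; nra.
have es2 : `|expR s| <= 2.
  rewrite (_ : expR s = expR s - 1 + 1); last by ring.
  by rewrite (le_trans (ler_normD _ _))// normr1; lra.
have A : `|expR s * cos i - 1 - s| <= 2 * (e1 * cabs h) + e1 * cabs h.
  rewrite (_ : _ - s = expR s * (cos i - 1) + (expR s - 1 - s)); last by ring.
  rewrite (le_trans (ler_normD _ _))// lerD//.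
    by rewrite normrM ler_pM// (le_trans H3)// ler_wpM2l// ltW.
  by rewrite (le_trans H1)// ler_wpM2l// ltW.
have B : `|expR s * sin i - i| <= 2 * (e1 * cabs h) + e1 * cabs h.
  rewrite (_ : _ - i = expR s * (sin i - i) + (expR s - 1) * i); last by ring.
  rewrite (le_trans (ler_normD _ _))// lerD//.
    by rewrite normrM ler_pM// (le_trans H2)// ler_wpM2l// ltW.
  by rewrite normrM ler_pM.
rewrite (le_trans (lerD A B))//.
nra.
Qed.

Lemma cexp_period z : cexp (z + (0 +i* (2 * pi))%C) = cexp z.
Proof.
rewrite cexpD (_ : cexp (0 +i* (2 * pi))%C = 1) ?mulr1//.
apply: cplx_eq; rewrite !(Rez_cexp, Imz_cexp) /Rez /Imz /= expR0 mul1r mulr_natl.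
  by rewrite -[X in cos X]add0r cosD2pi cos0.
by rewrite -[X in sin X]add0r sinD2pi sin0.
Qed.

End ComplexExp.

(** * Trapezoidal sums along the boundary of a parallelogram *)

Section Trapezoid.
Context {R : realType}.
Variable F : Cx R -> Cx R.
Implicit Types (p s t u v z d : Cx R).

(* The trapezoidal sum over [n] steps [s] starting from [p]; unlike a Riemann
   sum it is exact on affine functions, hence vanishes on closed polygons. *)
Definition trap n p s : Cx R :=
  \sum_(0 <= j < n) (F (p + j%:R * s) + F (p + j.+1%:R * s)) / 2%:R * s.

(** A discrete contour integral, once around the parallelogram at [p] with sides [n%:R * s] and
    [n%:R * t]. *)
Definition trapbox n p s t : Cx R :=
  trap n p s + trap n (p + n%:R * s) t - trap n (p + n%:R * t) s - trap n p t.

Lemma trapD m n p s : trap (m + n) p s = trap m p s + trap n (p + m%:R * s) s.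
Proof.
rewrite /trap (big_cat_nat (n:=m)) ?leq_addr//=; congr (_ + _).
rewrite -{1}(add0n m) big_addn addKn; apply: eq_bigr => j _.
by congr ((F _ + F _) / 2%:R * s); rewrite -?addSn natrD; ring.
Qed.

(** Each inner edge is shared by two of the four boxes, which run along it in opposite
    directions. *)
Lemma trapboxD n p s t : trapbox (n + n) p s t =
  trapbox n p s t + trapbox n (p + n%:R * s) s t
  + trapbox n (p + n%:R * t) s t + trapbox n (p + n%:R * s + n%:R * t) s t.
Proof.
rewrite /trapbox !trapD !natrD !mulrDl.
set a := n%:R * s; set b := n%:R * t.
rewrite !addrA [p + b + a]addrAC.
rewrite [p + a + b + a]addrAC [p + b + b + a](_ : _ = p + a + b + b); last by ring.
by ring.
Qed.

Lemma cabs_trap n p s (M : R) : (forall j, (j <= n)%N -> cabs (F (p + j%:R * s)) <= M) ->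
  cabs (trap n p s) <= n%:R * cabs s * M.
Proof.
move=> h; rewrite /trap (le_trans (cabs_sum _ _ _))//.
rewrite (_ : n%:R * cabs s * M = \sum_(0 <= j < n) cabs s * M); last first.
  by rewrite sumr_const_nat subn0 -mulrA mulr_natl.
rewrite !big_mkord; apply: ler_sum => j _.
rewrite !cabsM mulrC ler_wpM2l ?cabs_ge0// cabsV.
have -> : cabs (2%:R : Cx R) = 2 by rewrite -RC_nat cabs_RC ger0_norm.
rewrite ler_pdivrMr// (le_trans (cabsD _ _))// mulr_natr mulr2n lerD// h//.
exact: ltnW.
Qed.
End Trapezoid.

Section TrapezoidBoxes.
Context {R : realType}.
Implicit Types (F G : Cx R -> Cx R) (p s t u v z d : Cx R).

Lemma trap_affine (a b : Cx R) n p s :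
  trap (fun z => a + b * z) n p s = n%:R * s * (a + b * p) + b * s ^+ 2 * n%:R ^+ 2 / 2%:R.
Proof.
rewrite /trap; elim: n => [|n ih]; first by rewrite big_nil; ring.
rewrite big_nat_recr//= ih -natr1.
have n2 : (2%:R : Cx R) != 0 by rewrite pnatr_eq0.
by field.
Qed.

Lemma trapB F G n p s : trap (fun z => F z - G z) n p s = trap F n p s - trap G n p s.
Proof.
rewrite /trap -sumrB; apply: eq_bigr => j _.
have n2 : (2%:R : Cx R) != 0 by rewrite pnatr_eq0.
by field.
Qed.

(** By exactness, the sum for the affine part is the integral of an affine function over a closed
    path, which is 0. *)
Lemma trapbox_sub_affine F (a b : Cx R) n p s t :
  trapbox (fun z => F z - (a + b * z)) n p s t = trapbox F n p s t.
Proof.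
rewrite /trapbox !trapB !trap_affine.
have n2 : (2%:R : Cx R) != 0 by rewrite pnatr_eq0.
by field.
Qed.

Lemma cabs_trapbox F n p s t (M : R) :
  (forall i j, (i <= n)%N -> (j <= n)%N -> cabs (F (p + i%:R * s + j%:R * t)) <= M) ->
  cabs (trapbox F n p s t) <= 2 * n%:R * (cabs s + cabs t) * M.
Proof.
move=> h; rewrite /trapbox.
have h1 : cabs (trap F n p s) <= n%:R * cabs s * M.
  by apply: cabs_trap => j jn; have := h j 0%N jn (leq0n _); rewrite mul0r addr0.
have h2 : cabs (trap F n p t) <= n%:R * cabs t * M.
  by apply: cabs_trap => j jn; have := h 0%N j (leq0n _) jn; rewrite mul0r addr0.
have h3 : cabs (trap F n (p + n%:R * s) t) <= n%:R * cabs t * M.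
  by apply: cabs_trap => j jn; exact: h.
have h4 : cabs (trap F n (p + n%:R * t) s) <= n%:R * cabs s * M.
  by apply: cabs_trap => j jn; rewrite addrAC; exact: h.
rewrite (le_trans (cabsB _ _))// (le_trans (lerD (cabsB _ _) (lexx _)))//.
rewrite (le_trans (lerD (lerD (cabsD _ _) (lexx _)) (lexx _)))//.
by lra.
Qed.

(** The number of steps is a power of 2, so that bisecting the box lowers [m] by one and leaves the
    step vectors unchanged. *)
Definition dybox F m p u v :=
  trapbox F (2 ^ m) p (u / (2 ^ m)%:R) (v / (2 ^ m)%:R).

Lemma dyboxS F m p u v (u' := u / 2%:R) (v' := v / 2%:R) : dybox F m.+1 p u v =
  dybox F m p u' v' + dybox F m (p + u') u' v'
  + dybox F m (p + v') u' v' + dybox F m (p + u' + v') u' v'.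
Proof.
have n2 : (2%:R : Cx R) != 0 by rewrite pnatr_eq0.
have m2 : ((2 ^ m)%:R : Cx R) != 0 by rewrite pnatr_eq0 expn_eq0.
have e (w : Cx R) : w / (2 ^ m.+1)%:R = w / 2%:R / (2 ^ m)%:R.
  by rewrite expnS natrM invfM mulrA.
have e' (w : Cx R) : (2 ^ m)%:R * (w / (2 ^ m)%:R) = w by rewrite mulrC divfK.
rewrite /dybox !e expnS mul2n -addnn trapboxD.
by rewrite -/u' -/v' !e'.
Qed.

End TrapezoidBoxes.

(** * Goursat's theorem by bisection *)

Section Goursat.
Context {R : realType}.
Implicit Types (F G : Cx R -> Cx R) (p s t u v z d : Cx R).

Local Notation q n := ((2^-1 : R) ^+ n).

(** The intervals from [a n] to [a n + q n] are nested, each of half the length of the one before;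
    the supremum of the left ends lies in all of them. *)
Lemma nested_limit (a : nat -> R) :
  (forall n, a n <= a n.+1 <= a n + q n.+1) ->
  exists A, forall n, a n <= A <= a n + q n.
Proof.
move=> h.
have q0 n : 0 <= q n by rewrite exprn_ge0.
have up n k : a n <= a (n + k)%N.
  elim: k => [|k ih]; first by rewrite addn0.
  by rewrite addnS (le_trans ih)//; case/andP: (h (n + k)%N).
have dn n k : a (n + k)%N + q (n + k)%N <= a n + q n.
  elim: k => [|k ih]; first by rewrite addn0.
  rewrite addnS (le_trans _ ih)//.
  have /andP[_] := h (n + k)%N; rewrite exprS; lra.
have cross n m : a n <= a m + q m.
  case: (leqP n m) => nm.
    by rewrite -(subnKC nm) (le_trans (up n (m - n)%N))// lerDl.
  by rewrite -(subnKC (ltnW nm)) (le_trans _ (dn m (n - m)%N))// lerDl.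
exists (sup (range a)) => n; apply/andP; split.
  apply: ub_le_sup; last by exists n.
  by exists (a 0%N + q 0%N) => _ [k _ <-]; exact: cross.
apply: ge_sup; first by exists (a 0%N), 0%N.
by move=> _ [k _ <-]; exact: cross.
Qed.

(** After subtraction of the affine approximation at [z] the function is at most
    [e * (cabs u + cabs v)] on the box, whose perimeter is [2 * (cabs u + cabs v)]. *)
Lemma dybox_local F z d u v p (a b e t : R) m :
  0 <= e ->
  (forall h, cabs h < t -> cabs (F (z + h) - F z - d * h) <= e * cabs h) ->
  cabs u + cabs v < t -> 0 <= a <= 1 -> 0 <= b <= 1 ->
  z = p + RC a * u + RC b * v ->
  cabs (dybox F m p u v) <= 2 * (cabs u + cabs v) * (e * (cabs u + cabs v)).
Proof.
move=> e0 he uvt a01 b01 zE.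
rewrite /dybox -(trapbox_sub_affine F (F z - d * z) d).
set N := (2 ^ m)%N.
have N0 : (0 : R) < N%:R by rewrite ltr0n expn_gt0.
have Nc : cabs (N%:R : Cx R) = N%:R by rewrite -RC_nat cabs_RC ger0_norm// ltW.
have NC0 : (N%:R : Cx R) != 0 by rewrite pnatr_eq0 expn_eq0.
apply: (@le_trans _ _ (2 * N%:R * (cabs (u / N%:R) + cabs (v / N%:R)) * (e * (cabs u + cabs v)))).
  apply: cabs_trapbox => i j iN jN.
  have I01 : 0 <= (i%:R / N%:R : R) <= 1 by rewrite divr_ge0//= ler_pdivrMr// mul1r ler_nat.
  have J01 : 0 <= (j%:R / N%:R : R) <= 1 by rewrite divr_ge0//= ler_pdivrMr// mul1r ler_nat.
  set w := _ + j%:R * _.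
  set h := RC (i%:R / N%:R - a) * u + RC (j%:R / N%:R - b) * v.
  have wE : w = z + h.
    by rewrite /w /h zE !RCB !RCM !RCV !RC_nat; field.
  have hB : cabs h <= cabs u + cabs v.
    rewrite (le_trans (cabsD _ _))// !cabsM !cabs_RC lerD// ler_piMl ?cabs_ge0//.
      by rewrite ler_norml; lra.
    by rewrite ler_norml; lra.
  rewrite wE (_ : _ - _ = F (z + h) - F z - d * h); last by ring.
  by rewrite (le_trans (he _ (le_lt_trans hB uvt)))// ler_wpM2l.
rewrite !cabs_div !Nc; apply: le_of_eq; field; exact: lt0r_neq0.
Qed.

(** For fixed [m] the box sum only approximates a contour integral, so the conclusion is smallness
    for all large [m]. If it fails, it fails on a quarter of the box as well, and bisection leads to
    a point where differentiability is contradicted. *)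
Lemma goursat F p u v :
  (forall a b : R, 0 <= a <= 1 -> 0 <= b <= 1 ->
     exists d, cderiv F (p + RC a * u + RC b * v) d) ->
  forall c : R, 0 < c -> exists M, forall m, (M <= m)%N -> cabs (dybox F m p u v) <= c.
Proof.
move=> hF c c0; apply: contrapT => H.
pose pos (s : R * R) := p + RC s.1 * u + RC s.2 * v.
pose U n := RC (q n) * u; pose V n := RC (q n) * v.
(* Failure is required for arbitrarily large [m], which survives the loss of one from [m] in each
   bisection; the threshold shrinks by the factor 4, like the area. *)
pose Bad n (s : R * R) := forall M, exists2 m, (M <= m)%N &
  c * q n ^+ 2 < cabs (dybox F m (pos s) (U n) (V n)).
have Bad0 : Bad 0%N (0, 0).
  move=> M; apply: contrapT => H1; apply: H; exists M => m Mm.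
  rewrite leNgt; apply/negP => H2; apply: H1; exists m => //.
  by rewrite /pos /U /V /= !RC0 !RC1 !mul0r !addr0 !mul1r expr1n mulr1.
have step (x : nat * (R * R)) : exists s' : R * R, Bad x.1 x.2 -> Bad x.1.+1 s' /\
    ((x.2.1 <= s'.1 <= x.2.1 + q x.1.+1) /\ (x.2.2 <= s'.2 <= x.2.2 + q x.1.+1)).
  case: x => n [a b] /=.
  case: (pselect (Bad n (a, b))) => [B|nB]; last by exists (0, 0) => B; case: (nB B).
  set e := q n.+1; have e0 : 0 <= e by rewrite /e exprn_ge0.
  have UE : U n / 2%:R = U n.+1.
    by rewrite /U exprS RCM RCV RC_nat; ring.
  have VE : V n / 2%:R = V n.+1.
    by rewrite /V exprS RCM RCV RC_nat; ring.
  have P1 : pos (a, b) + U n.+1 = pos (a + e, b) by rewrite /pos /U /= RCD; ring.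
  have P2 : pos (a, b) + V n.+1 = pos (a, b + e) by rewrite /pos /V /= RCD; ring.
  have P3 : pos (a + e, b) + V n.+1 = pos (a + e, b + e).
    by rewrite /pos /V /U /= !RCD; ring.
  have [B1|/existsNP[M1 N1]] := pselect (Bad n.+1 (a, b)).
    by exists (a, b) => _; split => //=; lra.
  have [B2|/existsNP[M2 N2]] := pselect (Bad n.+1 (a + e, b)).
    by exists (a + e, b) => _; split => //=; lra.
  have [B3|/existsNP[M3 N3]] := pselect (Bad n.+1 (a, b + e)).
    by exists (a, b + e) => _; split => //=; lra.
  have [B4|/existsNP[M4 N4]] := pselect (Bad n.+1 (a + e, b + e)).
    by exists (a + e, b + e) => _; split => //=; lra.
  exfalso; have [[//|m] Mm] := B (maxn M1 (maxn M2 (maxn M3 M4))).+1.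
  move: Mm; rewrite ltnS !geq_max => /and4P[m1 m2 m3 m4].
  rewrite dyboxS UE VE P1 P2 P3 ltNge => /negP; apply.
  have k M x : ~ (exists2 m, (M <= m)%N & c * q n.+1 ^+ 2 < cabs (dybox F m (pos x) (U n.+1) (V n.+1))) ->
      (M <= m)%N -> cabs (dybox F m (pos x) (U n.+1) (V n.+1)) <= c * q n.+1 ^+ 2.
    by move=> N Mm; rewrite leNgt; apply/negP => ?; apply: N; exists m.
  rewrite (le_trans (cabsD _ _))// (le_trans (lerD (cabsD _ _) (lexx _)))//.
  rewrite (le_trans (lerD (lerD (cabsD _ _) (lexx _)) (lexx _)))//.
  apply: (le_trans (lerD (lerD (lerD (k _ _ N1 m1) (k _ _ N2 m2)) (k _ _ N3 m3)) (k _ _ N4 m4))).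
  have -> : q n.+1 = q n / 2 by rewrite exprS mulrC.
  by apply: le_of_eq; field.
have [f hf] := choice step.
pose S := fix S n := if n is k.+1 then f (k, S k) else (0, 0).
have hS n : Bad n (S n).
  by elim: n => [//|n ih]; have [] := hf (n, S n) ih.
have hS2 n := (hf (n, S n) (hS n)).2.
have [A hA] := @nested_limit (fun n => (S n).1) (fun n => (hS2 n).1).
have [B hB] := @nested_limit (fun n => (S n).2) (fun n => (hS2 n).2).
have A01 : 0 <= A <= 1 by have := hA 0%N; rewrite /= expr0 add0r.
have B01 : 0 <= B <= 1 by have := hB 0%N; rewrite /= expr0 add0r.
have [d hd] := hF A B A01 B01.
pose L := cabs u + cabs v + 1.
have L0 : 1 <= L by rewrite /L; have := cabs_ge0 u; have := cabs_ge0 v; lra.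
(* Perimeter times error is at most [2 * (q n * L) * (e * (q n * L))], which for this [e] is exactly
   the threshold [c * q n ^+ 2]. *)
pose e := c / (2 * L ^+ 2).
have e0 : 0 < e by rewrite divr_gt0// mulr_gt0// exprn_gt0; lra.
have [t t0 ht] := hd e e0.
have [n hn] : exists n, q n * L < t.
  have tL : 0 < t / L by rewrite divr_gt0//; lra.
  have := @cvg_expr R 2^-1; rewrite ger0_norm// => /(_ _)/cvgrPdist_lt.
  have h21 : 2^-1 < 1 :> R by lra.
  move=> /(_ h21 _ tL)[n _ hn]; exists n.
  have := hn n (leqnn n); rewrite sub0r normrN ger0_norm ?exprn_ge0//.
  by rewrite ltr_pdivlMr//; lra.
have qn0 : 0 < q n by rewrite exprn_gt0.
have [m _] := hS n 0%N; rewrite ltNge => /negP; apply.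
have UVn : cabs (U n) + cabs (V n) <= q n * L.
  by rewrite !cabsM cabs_RC ger0_norm ?ltW// /L; lra.
apply: (@le_trans _ _ (2 * (cabs (U n) + cabs (V n)) * (e * (cabs (U n) + cabs (V n))))).
  apply: (@dybox_local F (pos (A, B)) d _ _ _ ((A - (S n).1) / q n) ((B - (S n).2) / q n) e t) => //.
  - exact: ltW.
  - by rewrite (le_lt_trans UVn).
  - have := hA n; rewrite ler_pdivlMr// ler_pdivrMr//; lra.
  - have := hB n; rewrite ler_pdivlMr// ler_pdivrMr//; lra.
  - have qc : RC (q n) != 0 by rewrite RC_eq0 gt_eqF.
    by rewrite /pos /U /V /= !RCM !RCV !RCB; field.
have uv0 : 0 <= cabs (U n) + cabs (V n) by rewrite addr_ge0 ?cabs_ge0.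
apply: (@le_trans _ _ (2 * (q n * L) * (e * (q n * L)))).
  have sq (x : R) : 2 * x * (e * x) = 2 * e * (x * x) by ring.
  by rewrite !sq ler_wpM2l ?ler_pM// mulr_ge0// ltW.
rewrite /e; apply: le_of_eq; field; lra.
Qed.

End Goursat.

(** * The maximum principle *)

Section MaxMod.
Context {R : realType}.
Implicit Types (f : Cx R -> Cx R) (z w d : Cx R) (r M e : R).

(** Goursat's theorem for [f \o cexp] on the rectangle over the real interval from [s] to 0, of
    height [2 * pi]: the horizontal edges cancel by periodicity, the right edge samples [f] on the
    unit circle, and the left edge samples it on a circle so small that [f] is within [e1] of
    [f 0]. *)
Lemma max_center f M :
  (forall z, cabs z <= 1 -> exists d, cderiv f z d) ->
  (forall z, cabs z = 1 -> cabs (f z) <= M) -> cabs (f 0) <= M.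
Proof.
move=> hf hM; apply/ler_addgt0Pr => e e0.
pose e1 := e / 2; have e10 : 0 < e1 by rewrite divr_gt0.
have [d0 hd0] : exists d, cderiv f 0 d by apply: hf; rewrite cabs0.
have [t t0 ht] := cderiv_cont hd0 e10.
pose s := Num.min 0 (ln (t / 2)).
have s0 : s <= 0 by rewrite ge_min lexx.
have st : expR s < t.
  rewrite (@le_lt_trans _ _ (expR (ln (t / 2))))//; last by rewrite lnK ?posrE; lra.
  by rewrite ler_expR ge_min lexx orbT.
pose F z := f (cexp z).
pose p := RC s; pose u := RC (- s); pose v : Cx R := (0 +i* (2 * pi))%C.
have pi0 : 0 < 2 * pi :> R by rewrite mulr_gt0// pi_gt0.
have vE : cabs v = 2 * pi.
  by rewrite /cabs /v /= expr0n add0r sqrtr_sqr ger0_norm// ltW.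
have hF (a b : R) : 0 <= a <= 1 -> 0 <= b <= 1 ->
     exists d, cderiv F (p + RC a * u + RC b * v) d.
  move=> a01 b01; set z := p + _ + _.
  have Rz : Rez z <= 0.
    have vR : Rez v = 0 by [].
    rewrite /z !RezD !RezM vR /u !Rez_RC !Imz_RC.
    by nra.
  have [d hd] : exists d, cderiv f (cexp z) d.
    by apply: hf; rewrite cabs_cexp -expR0 ler_expR.
  by exists (d * cexp z); apply: cderiv_comp hd (cderiv_cexp z).
have c0 : 0 < e1 * (2 * pi) by rewrite mulr_gt0.
have [m0 hm] := goursat hF c0.
have := hm m0 (leqnn m0); rewrite /dybox /trapbox.
set N := (2 ^ m0)%N.
have N0 : (0 : R) < N%:R by rewrite ltr0n expn_gt0.
have Nc : cabs (N%:R : Cx R) = N%:R by rewrite -RC_nat cabs_RC ger0_norm// ltW.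
have NC0 : (N%:R : Cx R) != 0 by rewrite pnatr_eq0 expn_eq0.
have e' (w : Cx R) : N%:R * (w / N%:R) = w by rewrite mulrC divfK.
rewrite !e'.
have -> : trap F N (p + v) (u / N%:R) = trap F N p (u / N%:R).
  apply: eq_bigr => j _; rewrite /F.
  rewrite (_ : p + v + j%:R * (u / N%:R) = p + j%:R * (u / N%:R) + v); last by ring.
  rewrite (_ : p + v + j.+1%:R * (u / N%:R) = p + j.+1%:R * (u / N%:R) + v); last by ring.
  by rewrite !cexp_period.
set T1 := trap F N (p + u) _; set T2 := trap F N p (v / _); set T0 := trap F N p _.
rewrite (_ : T0 + T1 - T0 - T2 = T1 - T2); last by ring.
move=> T12.
have Rj (a : R) j : Rez (RC a + j%:R * (v / N%:R)) = a.
  have vR : Rez v = 0 by [].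
  rewrite RezD Rez_RC -!RC_nat -RCV mulrCA -RCM RezM Imz_RC vR.
  by rewrite mul0r mulr0 subr0 addr0.
have T1b : cabs T1 <= N%:R * cabs (v / N%:R) * M.
  apply: cabs_trap => j _; apply: hM.
  rewrite cabs_cexp (_ : p + u = RC 0) ?Rj ?expR0//.
  by rewrite /p /u -RCD subrr.
have T2b : cabs (T2 - f 0 * v) <= N%:R * cabs (v / N%:R) * e1.
  have -> : T2 - f 0 * v = trap (fun z => F z - (f 0 + 0 * z)) N p (v / N%:R).
    by rewrite trapB trap_affine; congr (_ - _); field.
  apply: cabs_trap => j _; rewrite mul0r addr0.
  rewrite /F -(add0r (cexp _)); apply: ht.
  by rewrite cabs_cexp Rj.
have kk : N%:R * (cabs (v / N%:R)) = 2 * pi.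
  by rewrite cabs_div Nc vE mulrC divfK// gt_eqF.
move: T1b T2b; rewrite kk.
move=> T1b T2b.
have : cabs (f 0 * v) <= e1 * (2 * pi) + 2 * pi * M + 2 * pi * e1.
  rewrite (_ : f 0 * v = T1 - (T1 - T2) - (T2 - f 0 * v)); last by ring.
  rewrite (le_trans (cabsB _ _))// (le_trans (lerD (cabsB _ _) (lexx _)))//.
  lra.
rewrite cabsM vE (_ : _ + _ = (M + e) * (2 * pi)); last by rewrite /e1; field.
by rewrite ler_pM2r.
Qed.

Lemma moebius_norm (a z : Cx R) :
  cabs (1 - cconj a * z) ^+ 2 - cabs (z - a) ^+ 2 =
  (1 - cabs a ^+ 2) * (1 - cabs z ^+ 2).
Proof.
rewrite !cabs_sqr !(RezB, ImzB, RezM, ImzM, RezC, ImzC, Rez1, Imz1).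
by ring.
Qed.

Lemma one_sub_neq0 (a z : Cx R) : cabs a < 1 -> cabs z <= 1 -> 1 - cconj a * z != 0.
Proof.
move=> a1 z1; rewrite subr_eq0; apply/eqP => h.
have := cabs1 (R:=R); rewrite h cabsM cabs_cconj.
have := cabs_ge0 a; have := cabs_ge0 z; nra.
Qed.

(** [tau] maps the unit disc into the disc of radius [r], the unit circle into the circle of radius
    [r], and 0 to [z], which reduces the claim to the centre. *)
Lemma maxmod f r M z : 0 < r ->
  (forall z, cabs z <= r -> exists d, cderiv f z d) ->
  (forall z, cabs z = r -> cabs (f z) <= M) -> cabs z < r -> cabs (f z) <= M.
Proof.
move=> r0 hf hM zr.
have r0C : RC r != 0 by rewrite RC_eq0 gt_eqF.
pose a := - (z / RC r).
have a1 : cabs a < 1 by rewrite cabsN cabs_div cabs_RC gtr0_norm// ltr_pdivrMr// mul1r.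
pose tau w := RC r * ((w - a) / (1 - cconj a * w)).
have tau0 : tau 0 = z.
  by rewrite /tau sub0r mulr0 subr0 divr1 /a opprK mulrC divfK.
rewrite -tau0; apply: (@max_center (f \o tau)) => w w1 /=.
  have n0 := one_sub_neq0 a1 w1.
  have tw : cabs (tau w) <= r.
    rewrite cabsM cabs_RC gtr0_norm//; apply: ler_piMr; first exact: ltW.
    rewrite cabs_div ler_pdivrMr ?cabs_gt0//.
    rewrite mul1r -(@ler_pXn2r _ 2) ?nnegrE ?cabs_ge0// -subr_ge0 moebius_norm.
    by rewrite mulr_ge0// subr_ge0 expr_le1// ?cabs_ge0// ltW.
  have [d hd] := hf _ tw; eexists; apply: cderiv_comp hd _.
  apply: cderivZ; apply: cderiv_div => //.
    by apply: cderivB (cderiv_id _) (cderiv_cst _ _).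
  by apply: cderivB (cderiv_cst _ _) (cderivZ _ (cderiv_id _)).
have n0 : 1 - cconj a * w != 0 by apply: one_sub_neq0 => //; rewrite w1.
apply: hM; rewrite cabsM cabs_RC gtr0_norm// cabs_div.
suff -> : cabs (w - a) = cabs (1 - cconj a * w) by rewrite divff ?mulr1// gt_eqF// cabs_gt0.
apply/eqP; rewrite -(@eqrXn2 _ 2) ?cabs_ge0// eq_sym -subr_eq0 moebius_norm w1.
by rewrite expr1n subrr mulr0.
Qed.

End MaxMod.

(** * Compactness of squares, mean values on segments, the open mapping theorem *)

Section Compactness.
Context {R : realType}.
Implicit Types (z h : Cx R) (r t M L : R).

(** Local boundedness is the hypothesis because the functions to which this is applied are defined
    by cases and may jump. A cluster point of points where [g] exceeds [n] gives the
    contradiction. *)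
Lemma square_bounded (g : Cx R -> R) L :
  (forall z, `|Rez z| <= L -> `|Imz z| <= L ->
     exists t M, 0 < t /\ forall h, cabs h < t -> g (z + h) <= M) ->
  exists M, forall z, `|Rez z| <= L -> `|Imz z| <= L -> g z <= M.
Proof.
move=> hg; apply: contrapT => H.
have nb (n : nat) : exists p : R * R, [/\ `|p.1| <= L, `|p.2| <= L & n%:R < g (p.1 +i* p.2)%C].
  apply: contrapT => H1; apply: H; exists n%:R => z zx zy; rewrite leNgt; apply/negP => gz.
  by apply: H1; exists (Rez z, Imz z); split => //; case: z gz {zx zy}.
have [p hp] := choice nb.
have cK : compact (`[-L, L]%classic `*` `[-L, L]%classic : set (R * R)).
  by apply: compact_setX; exact: segment_compact.
have FK : (p @ \oo) (`[-L, L]%classic `*` `[-L, L]%classic : set (R * R)).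
  exists 0%N => // n _; have [h1 h2 _] := hp n.
  by split; rewrite /= in_itv/= -ler_norml.
have [[a b] [[/= ha hb] hc]] := cK _ _ FK.
move: ha hb; rewrite !in_itv/= -!ler_norml => ha hb.
have [t [M [t0 ht]]] := hg (a +i* b)%C ha hb.
have [n nM] : exists n : nat, M < n%:R.
  exists (Num.bound `|M|); apply: le_lt_trans (ler_norm _) _.
  exact: (archi_boundP (normr_ge0 M)).
have F1 : (p @ \oo) [set x | M < g (x.1 +i* x.2)%C].
  exists n => // k /= nk; have [_ _ hk] := hp k.
  by rewrite (lt_trans nM)// (le_lt_trans _ hk)// ler_nat.
have t20 : 0 < t / 2 by rewrite divr_gt0.
have nbh : nbhs (a, b) (ball (a, b) (t / 2)) by exact: nbhsx_ballx.
have [[x y] [/= Mg [/= bx by_]]] := hc _ _ F1 nbh.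
move: Mg; rewrite ltNge => /negP; apply.
have -> : (x +i* y)%C = (a +i* b)%C + ((x - a) +i* (y - b))%C.
  by apply: cplx_eq; rewrite ?RezD ?ImzD /Rez /Imz /=; ring.
apply: ht; rewrite (le_lt_trans (cabs_le_ReIm _))// /Rez /Imz /=.
by rewrite (distrC x) (distrC y) (_ : t = t / 2 + t / 2) ?ltrD//; field.
Qed.
End Compactness.

Section Segment.
Context {R : realType}.
Implicit Types (z h d : Cx R) (r t M L : R) (f : Cx R -> Cx R).

Lemma rderiv_is_derive (f : R -> R) (x d : R) : (forall e : R, 0 < e ->
  exists2 t : R, 0 < t & forall h : R, `|h| < t -> `|f (x + h) - f x - d * h| <= e * `|h|) ->
  is_derive x 1 f d.
Proof.
move=> hf.
have H : (fun h : R => h^-1 *: (f (h *: 1 + x) - f x)) @ 0^' --> d.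
  apply/cvgrPdist_le => e e0; have [t t0 ht] := hf e e0.
  exists t => // k /=; rewrite sub0r normrN => kt k0.
  rewrite (_ : k *: 1 = k); last exact: mulr1.
  rewrite (addrC k) -(ler_pM2r (_ : 0 < `|k|)) ?normr_gt0//.
  by rewrite -normrM mulrBl /GRing.scale /= mulrAC mulVf// mul1r distrC; exact: ht.
apply: DeriveDef; first by apply/cvg_ex; exists d.
exact: cvg_lim.
Qed.

Lemma is_derive_line f (c z d : Cx R) (t : R) : cderiv f (RC t * z) d ->
  is_derive t 1 (fun s : R => Rez (c * f (RC s * z))) (Rez (c * d * z)).
Proof.
move=> fd; apply: rderiv_is_derive => e e0.
have K0 : 0 < (cabs c + 1) * (cabs z + 1).
  by rewrite mulr_gt0//; have := cabs_ge0 c; have := cabs_ge0 z; lra.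
have e1 : 0 < e / ((cabs c + 1) * (cabs z + 1)) by rewrite divr_gt0.
have [s s0 hs] := fd _ e1.
have z1 : 0 < cabs z + 1 by have := cabs_ge0 z; lra.
exists (s / (cabs z + 1)); first by rewrite divr_gt0.
move=> h; rewrite ltr_pdivlMr// => hl.
have := hs (RC h * z); rewrite cabsM cabs_RC => /(_ _) H.
rewrite (_ : _ - _ = Rez (c * (f (RC t * z + RC h * z) - f (RC t * z) - d * (RC h * z)))).
  rewrite (le_trans (Rez_le _))// cabsM.
  apply: (@le_trans _ _ (cabs c * (e / ((cabs c + 1) * (cabs z + 1)) * (`|h| * cabs z)))).
    rewrite ler_wpM2l ?cabs_ge0//; apply: H.
    have := normr_ge0 h; have := cabs_ge0 z; nra.
  rewrite (_ : _ * _ = e * `|h| * ((cabs c * cabs z) / ((cabs c + 1) * (cabs z + 1)))); last by ring.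
  rewrite ler_piMr ?mulr_ge0// ?ltW// ltr_pdivrMr// mul1r.
  by have := cabs_ge0 c; have := cabs_ge0 z; nra.
rewrite RCD mulrDl mulrBr RezB; congr (_ - _); first by rewrite mulrBr RezB.
by rewrite (_ : c * (d * (RC h * z)) = RC h * (c * d * z)) ?RezM ?Rez_RC ?Imz_RC; ring.
Qed.

(** The mean value theorem fails for complex values; [c] selects one real direction, and taking for
    [c] the conjugate of the increment recovers its squared modulus. *)
Lemma line_MVT f (c z : Cx R) (df : R -> Cx R) (a b : R) : a <= b ->
  (forall t, a <= t <= b -> cderiv f (RC t * z) (df t)) ->
  exists2 t, a <= t <= b &
    Rez (c * (f (RC b * z) - f (RC a * z))) = Rez (c * df t * z) * (b - a).
Proof.
move=> ab hd.
have hd1 t : a <= t <= b -> is_derive t 1 (fun s : R => Rez (c * f (RC s * z))) (Rez (c * df t * z)).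
  by move=> /hd/is_derive_line.
have [||t tab h] := @MVT_segment R (fun s => Rez (c * f (RC s * z))) (fun t => Rez (c * df t * z)) a b ab.
- move=> x; rewrite in_itv/= => xab; apply: hd1.
  by case/andP: xab => /ltW -> /ltW ->.
- apply: derivable_within_continuous => x; rewrite in_itv/= => xab.
  exact: (@ex_derive _ _ _ _ _ _ _ (hd1 _ xab)).
exists t; first by move: tab; rewrite in_itv.
by rewrite -h mulrBr RezB.
Qed.

Lemma cderiv0_segment f z (a : R) : a <= 1 ->
  (forall t, a <= t <= 1 -> cderiv f (RC t * z) 0) -> f z = f (RC a * z).
Proof.
move=> a1 hd; set w := f z - f (RC a * z).
have [t _] := line_MVT (cconj w) a1 hd.
rewrite RC1 mul1r -/w mulr0 mul0r Rez0 mul0r mulrC mul_cconj Rez_RC => /eqP.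
by rewrite sqrf_eq0 cabs_eq0 subr_eq0 => /eqP.
Qed.

End Segment.

Section OpenMap.
Context {R : realType}.
Implicit Types (z w h d : Cx R) (r t M L : R) (f phi : Cx R -> Cx R).

(** If [w] is omitted, the reciprocal of [phi - w] is differentiable on the closed disc and at most
    [3 * K / 2] on the circle, yet larger than [3 * K] at the centre, against the maximum
    principle. *)
Lemma open_map phi z0 r : 0 < r ->
  (forall z, cabs (z - z0) <= r -> exists d, cderiv phi z d) ->
  (forall z, cabs (z - z0) = r -> phi z != phi z0) ->
  exists2 e : R, 0 < e & forall w, cabs (w - phi z0) < e ->
    exists2 z, cabs (z - z0) <= r & phi z = w.
Proof.
move=> r0 hd hne.
(* Being 0 off the circle, [g] is locally bounded on a whole square; its bound there gives a
   positive lower bound for [phi - phi z0] on the circle. *)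
pose g z := if cabs (z - z0) == r then (cabs (phi z - phi z0))^-1 else 0.
have [M hM] : exists M, forall z, `|Rez z| <= cabs z0 + r -> `|Imz z| <= cabs z0 + r -> g z <= M.
  apply: square_bounded => z _ _.
  have [zr|zr] := eqVneq (cabs (z - z0)) r.
    have m0 : 0 < cabs (phi z - phi z0) by rewrite cabs_gt0 subr_eq0 hne.
    set m := cabs _ in m0.
    have [d hdz] := hd z (le_of_eq zr).
    have m20 : 0 < m / 2 by rewrite divr_gt0.
    have [t t0 ht] := cderiv_cont hdz m20.
    exists t, (m / 2)^-1; split => // h /ht h1; rewrite /g.
    case: ifP => _; last by rewrite invr_ge0 ltW.
    have h2 : m / 2 <= cabs (phi (z + h) - phi z0).
      have := cabsB (phi (z + h) - phi z0) (phi (z + h) - phi z).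
      by rewrite opprB addrC addrA subrK -/m; lra.
    by rewrite lef_pV2// posrE (lt_le_trans m20).
  exists `|cabs (z - z0) - r|, 0; split; first by rewrite normr_gt0 subr_eq0.
  move=> h hh; rewrite /g ifF//; apply/negP => /eqP E; move: hh; rewrite ltNge => /negP; apply.
  rewrite -E ler_norml; apply/andP; split.
    have := cabs_ge_sub (z + h - z0) h.
    by rewrite (_ : z + h - z0 - h = z - z0); last ring; lra.
  have := cabs_ge_sub (z - z0) (- h).
  by rewrite cabsN (_ : z - z0 - - h = z + h - z0); last ring; lra.
pose K := Num.max M 1.
have K0 : 0 < K by rewrite lt_max ltr01 orbT.
have hK z : cabs (z - z0) = r -> K^-1 <= cabs (phi z - phi z0).
  move=> zr; have p0 : 0 < cabs (phi z - phi z0) by rewrite cabs_gt0 subr_eq0 hne.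
  have zL : cabs z <= cabs z0 + r by have := cabsD (z - z0) z0; rewrite subrK zr; lra.
  have := hM z (le_trans (Rez_le _) zL) (le_trans (Imz_le _) zL).
  rewrite /g zr eqxx => gM.
  by rewrite -[leRHS]invrK lef_pV2 ?posrE ?invr_gt0// (le_trans gM)// le_max lexx.
exists ((3 * K)^-1); first by rewrite invr_gt0 mulr_gt0.
move=> w hw; apply: contrapT => H.
have nw z : cabs (z - z0) <= r -> phi z - w != 0.
  by move=> zr; rewrite subr_eq0; apply/eqP => E; apply: H; exists z.
pose f z := (phi (z0 + RC r * z) - w)^-1.
have rz z : cabs (z0 + RC r * z - z0) = r * cabs z.
  by rewrite addrAC subrr add0r cabsM cabs_RC gtr0_norm.
have fh z : cabs z <= 1 -> exists d, cderiv f z d.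
  move=> z1.
  have zr : cabs (z0 + RC r * z - z0) <= r by rewrite rz ger_pMr.
  have [d hdz] := hd _ zr; eexists; apply: cderivV; first exact: nw.
  apply: cderivB; last exact: cderiv_cst.
  apply: (@cderiv_comp _ phi (fun w => z0 + RC r * w) _ _ _ hdz); apply: cderivD; first exact: cderiv_cst.
  by apply: cderivZ; exact: cderiv_id.
have fM z : cabs z = 1 -> cabs (f z) <= 3 * K / 2.
  move=> z1; have zr : cabs (z0 + RC r * z - z0) = r by rewrite rz z1 mulr1.
  rewrite cabsV.
  have h1 : (3 * K / 2)^-1 <= cabs (phi (z0 + RC r * z) - w).
    have := hK _ zr; have := cabsB (phi (z0 + RC r * z) - w) (phi z0 - w).
    rewrite (_ : _ - w - _ = phi (z0 + RC r * z) - phi z0); last by ring.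
    rewrite (cabsBC (phi z0)).
    move: hw; rewrite !invfM invrK; have : 0 < K^-1 by rewrite invr_gt0.
    by lra.
  rewrite -[leRHS]invrK lef_pV2 ?posrE//.
    by rewrite cabs_gt0 nw// zr.
  by rewrite invr_gt0 divr_gt0// mulr_gt0.
have := max_center fh fM; rewrite /f mulr0 addr0 cabsV.
have c0 : 0 < cabs (phi z0 - w) by rewrite cabs_gt0 nw// subrr cabs0 ltW.
rewrite cabsBC in c0 *.
move: hw; rewrite -ltf_pV2 ?posrE ?invr_gt0 ?mulr_gt0// invrK => h1 h2.
lra.
Qed.
End OpenMap.

(** * Automorphisms of the disc are Moebius maps *)

Section Autom.
Context {R : realType}.
Implicit Types (z w h d a b : Cx R) (r t M L : R) (f g phi psi : Cx R -> Cx R).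

Definition autom phi := [/\ forall z, cabs z < 1 -> exists d, cderiv phi z d,
  forall z, cabs z < 1 -> cabs (phi z) < 1,
  forall z w, cabs z < 1 -> cabs w < 1 -> phi z = phi w -> z = w &
  forall w, cabs w < 1 -> exists2 z, cabs z < 1 & phi z = w].

Lemma autom_comp phi psi : autom phi -> autom psi -> autom (fun z => phi (psi z)).
Proof.
move=> [d1 m1 i1 s1] [d2 m2 i2 s2]; split.
- move=> z z1; have [d hd] := d2 z z1; have [d' hd'] := d1 _ (m2 z z1).
  by exists (d' * d); apply: cderiv_comp hd' hd.
- by move=> z z1; apply: m1; exact: m2.
- by move=> z w z1 w1 /i1 h; apply: i2 => //; apply: h; exact: m2.
- move=> w /s1[u /s2[z z1 <-] <-]; by exists z.
Qed.

(** This is [- sigma a z]; with this sign [mob 0] is the identity and [mob (- a)] inverts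
    [mob a]. *)
Definition mob a z := (z - a) / (1 - cconj a * z).

Lemma mob_disc a z : cabs a < 1 -> cabs z < 1 -> cabs (mob a z) < 1.
Proof.
move=> a1 z1; have n0 := one_sub_neq0 a1 (ltW z1).
rewrite cabs_div ltr_pdivrMr ?cabs_gt0// mul1r -(@ltr_pXn2r _ 2) ?nnegrE ?cabs_ge0//.
rewrite -subr_gt0 moebius_norm mulr_gt0// subr_gt0 expr_lt1// ?cabs_ge0//.
Qed.

Lemma mobK a z : cabs a < 1 -> cabs z < 1 -> mob (- a) (mob a z) = z.
Proof.
move=> a1 z1; have n0 := one_sub_neq0 a1 (ltW z1).
have n1 := one_sub_neq0 a1 (ltW a1).
rewrite /mob cconjN opprK.
rewrite (_ : 1 - - cconj a * _ = (1 - cconj a * a) / (1 - cconj a * z)); last by field.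
rewrite (_ : _ + a = z * ((1 - cconj a * a) / (1 - cconj a * z))); last by field.
by rewrite mulfK// mulf_neq0// invr_neq0.
Qed.

(** The derivative is nonzero by the chain rule for [mob (- a) \o mob a], which is the identity near
    [z]. *)
Lemma cderiv_mob a z : cabs a < 1 -> cabs z < 1 -> exists2 d, cderiv (mob a) z d & d != 0.
Proof.
have dmob b w : cabs b < 1 -> cabs w < 1 -> exists d, cderiv (mob b) w d.
  move=> b1 w1; have n0 := one_sub_neq0 b1 (ltW w1).
  eexists; apply: cderiv_div => //.
    by apply: cderivB (cderiv_id _) (cderiv_cst _ _).
  by apply: cderivB (cderiv_cst _ _) (cderivZ _ (cderiv_id _)).
move=> a1 z1; have a1' : cabs (- a) < 1 by rewrite cabsN.
have [d hd] := dmob a z a1 z1; have [k hk] := dmob _ _ a1' (mob_disc a1 z1).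
exists d => //; have z10 : 0 < 1 - cabs z by lra.
have h2 : cderiv id z (k * d).
  apply: cderiv_ext z10 _ (cderiv_comp hk hd) => h hh; rewrite mobK//.
  by rewrite (le_lt_trans (cabsD _ _))//; lra.
apply/eqP => d0; have := cderiv_unique (cderiv_id z) h2.
by rewrite d0 mulr0 => /eqP; rewrite oner_eq0.
Qed.

Lemma autom_mob a : cabs a < 1 -> autom (mob a).
Proof.
move=> a1; have a1' : cabs (- a) < 1 by rewrite cabsN.
split.
- by move=> z z1; have [d hd _] := cderiv_mob a1 z1; exists d.
- by move=> z z1; exact: mob_disc.
- by move=> z w z1 w1 E; rewrite -(mobK a1 z1) E mobK.
- move=> w w1; exists (mob (- a) w); first exact: mob_disc.
  by have := mobK a1' w1; rewrite opprK.
Qed.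

(** By the open mapping theorem the preimages of points near [w] stay in a closed disc about
    [psi w], so [(1 - cabs (psi w))^-1] is locally bounded; compactness then bounds it for
    [cabs w <= rho]. *)
Lemma autom_proper phi rho : autom phi -> rho < 1 ->
  exists2 r, r < 1 & forall z, cabs z < 1 -> cabs (phi z) <= rho -> cabs z <= r.
Proof.
move=> [hd hm hi hs] rho1.
have /choice[psi hpsi] : forall w, exists z, cabs w < 1 -> cabs z < 1 /\ phi z = w.
  move=> w; case: (ltP (cabs w) 1) => [/hs[z z1 zw]|_]; first by exists z.
  by exists 0.
have psiK z : cabs z < 1 -> psi (phi z) = z.
  by move=> z1; have [h1 h2] := hpsi _ (hm z z1); apply: hi.
pose g w := if cabs w <= rho then (1 - cabs (psi w))^-1 else 0.
have [M hM] : exists M, forall z, `|Rez z| <= 1 -> `|Imz z| <= 1 -> g z <= M.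
  apply: square_bounded => w _ _.
  have [wr|wr] := leP (cabs w) rho; last first.
    exists (cabs w - rho), 0; split; first by rewrite subr_gt0.
    move=> h hh; rewrite /g ifF//; apply/negbTE; rewrite -ltNge.
    by have := cabs_ge_sub w (- h); rewrite cabsN opprK; lra.
  have w1 : cabs w < 1 by lra.
  have [z1 zw] := hpsi w w1; set z := psi w in z1 zw.
  pose r := (1 - cabs z) / 2.
  have r0 : 0 < r by rewrite /r; lra.
  have rd u : cabs (u - z) <= r -> cabs u < 1.
    by have := cabsD (u - z) z; rewrite subrK /r; lra.
  have [||e e0 he] := @open_map R phi z r r0.
  - by move=> u /rd; exact: hd.
  - move=> u uz; apply/eqP => E; have := hi u z (rd _ (le_of_eq uz)) z1 E => uzE.
    by move: uz r0; rewrite uzE subrr cabs0 => <-; rewrite ltxx.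
  exists e, r^-1; split => // h he1; rewrite /g; case: ifP => _; last by rewrite invr_ge0 ltW.
  have [|u uz uw] := he (w + h); first by rewrite zw addrAC subrr add0r.
  rewrite -uw psiK ?rd// lef_pV2 ?posrE//; last by rewrite subr_gt0 rd.
  have rE : r = (1 - cabs z) / 2 by [].
  by have := cabsD (u - z) z; rewrite subrK; lra.
pose K := Num.max M 1.
have K0 : 0 < K by rewrite lt_max ltr01 orbT.
exists (1 - K^-1); first by rewrite ltrBlDr ltrDl invr_gt0.
move=> z z1 zr.
have := hM (phi z) (le_trans (Rez_le _) (ltW (hm _ z1))) (le_trans (Imz_le _) (ltW (hm _ z1))).
rewrite /g zr psiK// => gM.
have z0 : 0 < 1 - cabs z by rewrite subr_gt0.
have : (1 - cabs z)^-1 <= K by rewrite (le_trans gM)// le_max lexx.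
rewrite -lef_pV2 ?posrE ?invr_gt0// invrK; lra.
Qed.

Lemma pow_bounded_le1 (x C : R) : 0 <= x -> (forall n : nat, x ^+ n <= C) -> x <= 1.
Proof.
move=> x0 hC; rewrite leNgt; apply/negP => x1.
have B n : 1 + n%:R * (x - 1) <= x ^+ n.
  elim: n => [|n ih]; first by rewrite mul0r addr0 expr0.
  rewrite exprS -natr1.
  have n0 : 0 <= n%:R :> R by [].
  apply: (@le_trans _ _ (x * (1 + n%:R * (x - 1)))); last by rewrite ler_wpM2l.
  have : 0 <= n%:R * (x - 1) ^+ 2 by rewrite mulr_ge0 ?sqr_ge0.
  lra.
have C1 := hC 0%N; rewrite expr0 in C1.
pose n := Num.bound (C / (x - 1)).
have xm : 0 < x - 1 by lra.
have := archi_boundP (divr_ge0 (le_trans ler01 C1) (ltW xm)).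
rewrite -/n ltr_pdivrMr// => h.
by have := hC n; have := B n; lra.
Qed.

(* [z ^+ 2 * g z ^+ n] is differentiable at the singularity [0]; letting [n]
   grow removes the constant lost by the extra factor. *)
Lemma maxmod_punctured g r M : 0 < r -> 0 < M ->
  (forall e : R, 0 < e -> exists2 t : R, 0 < t & forall h, cabs h < t -> cabs (g h - g 0) <= e) ->
  (forall z, z != 0 -> cabs z <= r -> exists d, cderiv g z d) ->
  (forall z, cabs z = r -> cabs (g z) <= M) ->
  forall z, z != 0 -> cabs z < r -> cabs (g z) <= M.
Proof.
move=> r0 M0 gc gd gM z z0 zr.
have H n : cabs z ^+ 2 * cabs (g z) ^+ n <= r ^+ 2 * M ^+ n.
  rewrite -!cabsX -cabsM; apply: (@maxmod R (fun z => z ^+ 2 * g z ^+ n) r) => //.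
    move=> w wr; have [->|w0] := eqVneq w 0.
      exists 0 => e e0; have [t t0 ht] := gc 1 ltr01.
      pose G := (cabs (g 0) + 1) ^+ n.
      have G0 : 0 < G by apply: exprn_gt0; have := cabs_ge0 (g 0); lra.
      exists (Num.min t (e / G)); first by rewrite lt_min t0 divr_gt0.
      move=> h; rewrite lt_min => /andP[/ht h1 h2].
      rewrite add0r expr0n !mul0r !subr0 cabsM !cabsX expr2 -mulrA mulrC.
      apply: ler_wpM2r; first exact: cabs_ge0.
      rewrite ltr_pdivlMr// in h2; apply: le_trans (ltW h2).
      apply: ler_wpM2l; first exact: cabs_ge0.
      apply: lerXn2r; rewrite ?nnegrE ?addr_ge0 ?cabs_ge0//.
      by have := cabsD (g h - g 0) (g 0); rewrite subrK; lra.
    have [d hd] := gd w w0 wr; eexists; apply: cderivM (cderivXf _ (cderiv_id _)) _.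
    by apply: cderivXf hd.
  by move=> w wr; rewrite cabsM !cabsX wr ler_wpM2l ?exprn_ge0 ?(ltW r0)// lerXn2r ?nnegrE ?cabs_ge0 ?(ltW M0)// gM.
rewrite -[leRHS]mul1r -ler_pdivrMr//.
have zp : 0 < cabs z ^+ 2 by rewrite exprn_gt0// cabs_gt0.
apply: (@pow_bounded_le1 _ (r ^+ 2 / cabs z ^+ 2)); first by rewrite divr_ge0 ?cabs_ge0 ?ltW.
move=> n; rewrite expr_div_n ler_pdivrMr ?exprn_gt0// mulrAC ler_pdivlMr//.
by rewrite mulrC.
Qed.

(** Schwarz's lemma for [g z = phi z / z] and for its reciprocal: on circles close to the unit
    circle both are bounded by constants close to 1, the reciprocal by [autom_proper]. Hence [g] has
    modulus 1 off 0; constant modulus forces derivative 0, so [g] is constant along rays. *)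
Lemma autom_rotation phi d : autom phi -> phi 0 = 0 -> cderiv phi 0 d -> d != 0 ->
  cabs d = 1 /\ forall z, cabs z < 1 -> phi z = d * z.
Proof.
move=> aphi p0 hd0 d0; have [hd hm hi hs] := aphi.
pose g z := if z == 0 then d else phi z / z.
have g0 : g 0 = d by rewrite /g eqxx.
have gE z : z != 0 -> g z = phi z / z by rewrite /g => /negbTE ->.
have gc : forall e : R, 0 < e -> exists2 t : R, 0 < t & forall h, cabs h < t -> cabs (g h - g 0) <= e.
  move=> e e0; have [t t0 ht] := hd0 e e0; exists t => // h /ht.
  rewrite add0r p0 subr0 g0 => hh.
  have [->|h0] := eqVneq h 0; first by rewrite g0 subrr cabs0 ltW.
  rewrite gE// -(ler_pM2r (_ : 0 < cabs h)) ?cabs_gt0// -cabsM mulrBl divfK//.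
have gd z : z != 0 -> cabs z < 1 -> exists d, cderiv g z d.
  move=> z0 z1; have [e he] := hd z z1; eexists.
  have zp : 0 < cabs z by rewrite cabs_gt0.
  apply: cderiv_ext zp _ (cderiv_div z0 he (cderiv_id z)) => h hz.
  rewrite gE//; apply/eqP => E; move: hz; rewrite (_ : h = - z) ?cabsN ?ltxx//.
  by rewrite -[h]add0r -(subrr z) addrAC E sub0r.
have pn0 z : z != 0 -> cabs z < 1 -> phi z != 0.
  move=> z0 z1; apply: contra z0 => /eqP E; apply/eqP; apply: hi => //.
    by rewrite cabs0.
  by rewrite p0.
have gn0 z : cabs z < 1 -> g z != 0.
  move=> z1; have [->|z0] := eqVneq z 0; first by rewrite g0.
  by rewrite gE// mulf_neq0 ?invr_neq0// pn0.
have g1 z : z != 0 -> cabs z < 1 -> cabs (g z) = 1.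
  move=> z0 z1; apply/eqP; rewrite eq_le; apply/andP; split.
    suff H r : cabs z < r -> r < 1 -> cabs (g z) <= r^-1.
      rewrite leNgt; apply/negP => G1.
      have z0' : 0 < cabs z by rewrite cabs_gt0.
      pose r := Num.max ((1 + cabs z) / 2) ((1 + (cabs (g z))^-1) / 2).
      have gi : (cabs (g z))^-1 < 1 by rewrite invf_lt1//; lra.
      have r1 : r < 1 by rewrite gt_max; apply/andP; split; lra.
      have zr : cabs z < r by rewrite lt_max; apply/orP; left; lra.
      have gr : (cabs (g z))^-1 < r by rewrite lt_max; apply/orP; right; lra.
      have := H r zr r1; rewrite leNgt => /negP; apply.
      by rewrite invf_plt ?posrE//; lra.
    move=> zr r1; have r0 : 0 < r by rewrite (le_lt_trans _ zr)// cabs_ge0.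
    apply: (@maxmod_punctured g r) => //; first by rewrite invr_gt0.
      by move=> w w0 wr; apply: gd => //; lra.
    move=> w wr; have w0 : w != 0 by rewrite -cabs_gt0 wr.
    rewrite gE// cabs_div wr -[leRHS]mul1r ler_wpM2r ?invr_ge0 ?ltW//.
    by rewrite hm// wr.
  suff H rho : 0 < rho -> rho < 1 -> (cabs (g z))^-1 <= rho^-1.
    have G0 : 0 < cabs (g z) by rewrite cabs_gt0 gn0.
    rewrite leNgt; apply/negP => G1.
    pose rho := (1 + cabs (g z)) / 2.
    have r0 : 0 < rho by rewrite /rho; lra.
    have := H rho r0; rewrite lef_pV2 ?posrE// /rho; lra.
  move=> rho0 rho1; have [r' r1 hr] := autom_proper aphi rho1.
  (* Beyond [r'] the image has modulus above [rho], so the reciprocal of [g] is at most [rho^-1] on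
     the circle of radius [r]. *)
  pose r := Num.max ((1 + cabs z) / 2) ((1 + r') / 2).
  have r11 : r < 1 by rewrite gt_max; apply/andP; split; lra.
  have zr : cabs z < r by rewrite lt_max; apply/orP; left; lra.
  have rr : r' < r by rewrite lt_max; apply/orP; right; lra.
  have r0 : 0 < r by rewrite (le_lt_trans _ zr)// cabs_ge0.
  rewrite -cabsV; apply: (@maxmod_punctured (fun z => (g z)^-1) r) => //.
  - by rewrite invr_gt0.
  - have hc : cderiv (fun w => w^-1) (g 0) (- g 0 ^- 2) by apply: cderiv_inv; rewrite g0.
    move=> e /(cderiv_cont hc)[t t0 ht].
    have t20 : 0 < t / 2 by rewrite divr_gt0.
    have [s s0 hs1] := gc _ t20; exists s => // h /hs1 hh.
    have := ht (g h - g 0); rewrite (addrC (g 0)) subrK; apply; lra.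
  - move=> w w0 wr; have w1 : cabs w < 1 by lra.
    have [e he] := gd w w0 w1; eexists; apply: cderivV he; exact: gn0.
  - move=> w wr; have w0 : w != 0 by rewrite -cabs_gt0 wr.
    have w1 : cabs w < 1 by rewrite wr.
    rewrite gE// invfM invrK cabsM cabsV wr.
    have h1 : rho < cabs (phi w).
      rewrite ltNge; apply/negP => /(hr w w1); rewrite wr; lra.
    rewrite -[leRHS]mulr1 ler_pM ?invr_ge0 ?cabs_ge0 ?(ltW r0) ?(ltW r11)//.
    by rewrite lef_pV2 ?posrE//; lra.
have gd0 z : z != 0 -> cabs z < 1 -> cderiv g z 0.
  move=> z0 z1; have [e he] := gd z z0 z1; suff -> : 0 = e by [].
  apply/eqP; rewrite eq_sym; apply/negPn/negP => e0.
  have E0 : 0 < cabs e / 2 by rewrite divr_gt0// cabs_gt0.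
  have [t t0 ht] := he _ E0.
  pose s := Num.min (t / 2) (Num.min ((1 - cabs z) / 2) (cabs z / 2)).
  have zp : 0 < cabs z by rewrite cabs_gt0.
  have s0 : 0 < s by rewrite !lt_min; apply/and3P; split; lra.
  have st : s < t by rewrite gt_min; apply/orP; left; lra.
  have sz : s < 1 - cabs z by rewrite !gt_min; apply/or3P/Or32; lra.
  have sz' : s < cabs z by rewrite !gt_min; apply/or3P/Or33; lra.
  (* This makes [e * h] a positive multiple of [g z]: to first order the modulus grows from 1 to
     [1 + s * cabs e], and the remainder takes away at most half of the gain. *)
  pose h := RC (s * cabs e) * g z / e.
  have hE : cabs h = s.
    rewrite cabs_div cabsM cabs_RC g1// mulr1 ger0_norm ?mulr_ge0 ?cabs_ge0 ?ltW//.
    by rewrite mulfK// cabs_eq0.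
  have := ht h; rewrite hE => /(_ st).
  have zh0 : z + h != 0.
    rewrite -cabs_gt0; have := cabs_ge_sub z (- h); rewrite opprK cabsN hE; lra.
  have zh1 : cabs (z + h) < 1 by rewrite (le_lt_trans (cabsD _ _))// hE; lra.
  have eh : e * h = RC (s * cabs e) * g z by rewrite mulrC divfK.
  have := cabsB (g (z + h)) (g (z + h) - g z - e * h).
  rewrite (_ : _ - (_ - _ - _) = RC (1 + s * cabs e) * g z); last first.
    by rewrite eh RCD RC1; ring.
  have se0 : 0 < s * cabs e by rewrite mulr_gt0// cabs_gt0.
  have se1 : 0 <= 1 + s * cabs e by lra.
  rewrite cabsM cabs_RC g1// mulr1 g1// (ger0_norm se1).
  by lra.
have gz z : z != 0 -> cabs z < 1 -> g z = d.
  move=> z0 z1; apply/eqP; rewrite -subr_eq0 -cabs_eq0 eq_le cabs_ge0 andbT.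
  apply/ler_addgt0Pr => e e0; rewrite add0r; have [t t0 ht] := gc e e0.
  have zp : 0 < cabs z by rewrite cabs_gt0.
  (* The segment stops at [RC a * z], short of the origin, where only the continuity of [g] is
     available. *)
  pose a := Num.min 1 (t / 2).
  have a0 : 0 < a by rewrite lt_min ltr01 divr_gt0.
  have a1 : a <= 1 by rewrite ge_min lexx.
  have at_ : a < t by rewrite gt_min; apply/orP; right; lra.
  rewrite (@cderiv0_segment R g z a a1); last first.
    move=> u /andP[ua u1]; apply: gd0.
      by rewrite mulf_neq0// RC_eq0 gt_eqF//; lra.
    by rewrite cabsM cabs_RC ger0_norm; nra.
  rewrite -g0 ht// cabsM cabs_RC ger0_norm; nra.
have pE z : cabs z < 1 -> phi z = d * z.
  move=> z1; have [->|z0] := eqVneq z 0; first by rewrite mulr0.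
  by have := gz z z0 z1; rewrite gE// => <-; rewrite divfK.
split=> //.
have h20 : RC 2^-1 != 0 :> Cx R by rewrite RC_eq0 invr_eq0 pnatr_eq0.
have h21 : cabs (RC 2^-1 : Cx R) < 1 by rewrite cabs_RC ger0_norm ?invr_ge0//; lra.
by rewrite -(gz _ h20 h21) g1.
Qed.

(** If the derivative were 0 throughout the disc, [phi] would take the same value at 0 and at
    [RC 2^-1], against injectivity. *)
Lemma autom_deriv_neq0 phi : autom phi -> exists z d, [/\ cabs z < 1, cderiv phi z d & d != 0].
Proof.
move=> [hd hm hi hs]; apply: contrapT => H.
have d0 z : cabs z < 1 -> cderiv phi z 0.
  move=> z1; have [d hdz] := hd z z1; suff <- : d = 0 by [].
  by apply/eqP/negPn/negP => dn0; apply: H; exists z, d.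
have h20 : RC 2^-1 != 0 :> Cx R by rewrite RC_eq0 invr_eq0 pnatr_eq0.
have h21 : cabs (RC 2^-1 : Cx R) < 1 by rewrite cabs_RC ger0_norm ?invr_ge0//; lra.
have := @cderiv0_segment R phi (RC 2^-1) 0 ler01; rewrite mul0r => E.
move: h20; suff -> : RC 2^-1 = 0 :> Cx R by rewrite eqxx.
apply: hi => //; first by rewrite cabs0.
by apply: E => t t01; apply: d0; rewrite cabsM !cabs_RC !ger0_norm ?invr_ge0//; lra.
Qed.

(** Composition with Moebius maps on both sides moves [p] and [q] to 0, where [autom_rotation]
    applies. *)
Lemma autom_deriv_neq0_at0 phi p q d : autom phi -> phi p = q -> cabs p < 1 ->
  cderiv phi p d -> d != 0 ->
  exists2 e, cabs e = 1 & forall z, cabs z < 1 -> phi z = mob (- q) (e * mob p z).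
Proof.
move=> aphi pq p1 hd d0; have [hd' hm hi hs] := aphi.
have q1 : cabs q < 1 by rewrite -pq hm.
have p1' : cabs (- p) < 1 by rewrite cabsN.
pose f z := mob q (phi (mob (- p) z)).
have af : autom f.
  by apply: autom_comp; [exact: autom_mob|apply: autom_comp => //; exact: autom_mob].
have mp0 : mob (- p) 0 = p by rewrite /mob mulr0 subr0 divr1 sub0r opprK.
have f0 : f 0 = 0 by rewrite /f mp0 pq /mob subrr mul0r.
have [|e1 he1 e10] := @cderiv_mob q q q1 _ => //.
have [|e2 he2 e20] := @cderiv_mob (- p) 0 p1' _; first by rewrite cabs0.
have hf : cderiv f 0 (e1 * (d * e2)).
  apply: (@cderiv_comp _ (mob q) (fun z => phi (mob (- p) z))).
    by rewrite mp0 pq.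
  by apply: cderiv_comp he2; rewrite mp0.
have fn0 : e1 * (d * e2) != 0 by rewrite !mulf_neq0.
have [e11 fE] := autom_rotation af f0 hf fn0.
exists (e1 * (d * e2)) => // z z1.
rewrite -fE; last exact: mob_disc.
by rewrite /f mobK// mobK// hm.
Qed.

(** A nonzero derivative is known at first at a single point [p]. The formula obtained from it shows
    that the derivative is also nonzero at the zero [b] of [phi], and the same formula based at [b]
    has [q = 0]. *)
Theorem autom_moebius phi : autom phi -> exists b c,
  [/\ cabs b < 1, cabs c = 1 & forall z, cabs z < 1 -> phi z = c * mob b z].
Proof.
move=> aphi; have [hd hm hi hs] := aphi.
have [p [d [p1 hp d0]]] := autom_deriv_neq0 aphi.
have [e e1 phiE] := autom_deriv_neq0_at0 aphi erefl p1 hp d0.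
set q := phi p in phiE.
have q1 : cabs q < 1 by rewrite hm.
have [|b b1 b0] := hs 0; first by rewrite cabs0.
have q1' : cabs (- q) < 1 by rewrite cabsN.
have eb : cabs (e * mob p b) < 1 by rewrite cabsM e1 mul1r mob_disc.
have [l1 hl1 l10] := cderiv_mob q1' eb; have [l2 hl2 l20] := cderiv_mob p1 b1.
have b10 : 0 < 1 - cabs b by lra.
have hk : cderiv phi b (l1 * (e * l2)).
  apply: cderiv_ext b10 _ (@cderiv_comp _ (mob (- q)) (fun w => e * mob p w) _ _ _ hl1 (cderivZ e hl2)).
  by move=> h hh; rewrite phiE// (le_lt_trans (cabsD _ _))//; lra.
have k0 : l1 * (e * l2) != 0 by rewrite !mulf_neq0// -cabs_eq0 e1 oner_eq0.
have [c c1 hc] := autom_deriv_neq0_at0 aphi b0 b1 hk k0.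
exists b, c; split => // z z1.
by rewrite hc// oppr0 /mob cconj0 mul0r !subr0 divr1.
Qed.

End Autom.

(** * Complex series, and power series with bounded coefficients *)

Section CSeries.
Context {R : realType}.
Implicit Types (z w h d l : Cx R) (r t M B e : R) (u v c : (Cx R)^nat).

Lemma ccvg_unique u l l' : u @ \oo --> l -> u @ \oo --> l' -> l = l'.
Proof. exact: cvg_unique. Qed.

Lemma ccvg_limn u l : u @ \oo --> l -> limn u = l.
Proof. exact: cvg_lim. Qed.

Lemma ccvgB u v l l' : u @ \oo --> l -> v @ \oo --> l' ->
  (fun n => u n - v n) @ \oo --> l - l'.
Proof.
move=> /ccvgP ul /ccvgP vl; apply/ccvgP => e e0.
have e2 : 0 < e / 2 by rewrite divr_gt0.
have [N1 h1] := ul _ e2; have [N2 h2] := vl _ e2.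
exists (maxn N1 N2) => n; rewrite geq_max => /andP[/h1 k1 /h2 k2].
rewrite (_ : _ - _ = (u n - l) - (v n - l')); last by ring.
by rewrite (le_trans (cabsB _ _))//; lra.
Qed.

Lemma ccvgMr u l h : u @ \oo --> l -> (fun n => u n * h) @ \oo --> l * h.
Proof.
move=> /ccvgP ul; apply/ccvgP => e e0.
have h0 : 0 < cabs h + 1 by have := cabs_ge0 h; lra.
have [N hN] := ul _ (divr_gt0 e0 h0); exists N => n /hN.
rewrite ler_pdivlMr// -mulrBl cabsM; apply: le_trans.
by rewrite ler_wpM2l ?cabs_ge0//; lra.
Qed.

Lemma ccvg_bound u l B N : u @ \oo --> l -> (forall n, (N <= n)%N -> cabs (u n) <= B) ->
  cabs l <= B.
Proof.
move=> /ccvgP ul uB; apply/ler_addgt0Pr => e e0.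
have [N1 hN] := ul e e0; pose n := maxn N N1.
have h1 := uB n (leq_maxl _ _); have h2 := hN n (leq_maxr _ _).
by have := cabsB (u n) (u n - l); rewrite opprB addrC subrK; lra.
Qed.

Lemma ccvg_Rez_ge u l B N : u @ \oo --> l -> (forall n, (N <= n)%N -> B <= Rez (u n)) ->
  B <= Rez l.
Proof.
move=> /ccvgP ul uB; apply/ler_addgt0Pr => e e0.
have [N1 hN] := ul e e0; pose n := maxn N N1.
have h1 := uB n (leq_maxl _ _); have h2 := hN n (leq_maxr _ _).
by have := Rez_le (u n - l); rewrite RezB ler_norml; lra.
Qed.

Lemma ccvg_ReIm u (x y : R) : (fun n => Rez (u n)) @ \oo --> x ->
  (fun n => Imz (u n)) @ \oo --> y -> u @ \oo --> ((x +i* y)%C : Cx R).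
Proof.
move=> /cvgrPdist_le hx /cvgrPdist_le hy; apply/ccvgP => e e0.
have e2 : 0 < e / 2 by rewrite divr_gt0.
have [N1 _ h1] := hx _ e2; have [N2 _ h2] := hy _ e2.
exists (maxn N1 N2) => n; rewrite geq_max => /andP[/h1 + /h2] /=.
rewrite (distrC x) (distrC y) => k1 k2; rewrite (le_trans (cabs_le_ReIm _))//.
by rewrite RezB ImzB -[Rez (x +i* y)%C]/x -[Imz (x +i* y)%C]/y; lra.
Qed.

Lemma Rez_series u n : Rez (series u n) = series (fun k => Rez (u k)) n.
Proof. by rewrite !seriesEnat /= (big_morph _ (@RezD R) Rez0). Qed.

Lemma Imz_series u n : Imz (series u n) = series (fun k => Imz (u k)) n.
Proof. by rewrite !seriesEnat /= (big_morph _ (@ImzD R) Imz0). Qed.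

Lemma real_abs_cvg (x : R^nat) B : (forall n, \sum_(0 <= k < n) `|x k| <= B) ->
  cvgn (series x).
Proof.
move=> hB; apply: normed_cvg; apply: nondecreasing_is_cvgn.
  apply/nondecreasing_seqP => k.
  by rewrite /= !seriesEnat /= big_nat_recr//= lerDl.
exists B => _ [n _ <-]; rewrite /= seriesEnat /=. exact: hB.
Qed.

Lemma abs_cvg u B : (forall n, \sum_(0 <= k < n) cabs (u k) <= B) ->
  exists l, series u @ \oo --> l.
Proof.
move=> hB.
have /cvg_ex[x hx] : cvgn (series (fun k => Rez (u k))).
  apply: (@real_abs_cvg _ B) => n; apply: le_trans (hB n).
  by apply: ler_sum => k _; exact: Rez_le.
have /cvg_ex[y hy] : cvgn (series (fun k => Imz (u k))).
  apply: (@real_abs_cvg _ B) => n; apply: le_trans (hB n).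
  by apply: ler_sum => k _; exact: Imz_le.
exists (x +i* y)%C; apply: ccvg_ReIm.
  by apply: cvg_trans hx; apply: near_eq_cvg; apply: nearW => n; rewrite Rez_series.
by apply: cvg_trans hy; apply: near_eq_cvg; apply: nearW => n; rewrite Imz_series.
Qed.

Lemma cvg_terms_bounded u l : series u @ \oo --> l -> exists B, forall n, cabs (u n) <= B.
Proof.
move=> /ccvgP/(_ 1 ltr01)[N hN].
exists (2 + \sum_(0 <= k < N) cabs (u k)) => n.
have [Nn|nN] := leqP N n; last first.
  rewrite (bigD1_seq n) ?mem_index_iota ?iota_uniq//=.
  have : 0 <= \sum_(0 <= i < N | i != n) cabs (u i) by apply: sumr_ge0 => *; exact: cabs_ge0.
  by have := cabs_ge0 (u n); lra.
have h1 := hN n Nn; have h2 := hN n.+1 (leqW Nn).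
have : 0 <= \sum_(0 <= k < N) cabs (u k) by apply: sumr_ge0 => *; exact: cabs_ge0.
have := cabsB (series u n.+1 - l) (series u n - l).
rewrite (_ : _ - _ - _ = u n); first lra.
by rewrite !seriesEnat /= big_nat_recr//=; ring.
Qed.

Lemma sum_geo (T : comNzRingType) (x : T) N :
  (\sum_(0 <= k < N) x ^+ k) * (1 - x) = 1 - x ^+ N.
Proof. by rewrite -[RHS]opprB subrX1 big_mkord -mulNr opprB mulrC. Qed.

Lemma sum_n2_geo (q : R) N : 0 <= q -> q < 1 ->
  \sum_(0 <= n < N) n%:R ^+ 2 * q ^+ n <= q * ((1 - q)^-1 + 2 * q * (1 - q) ^- 2) / (1 - q).
Proof.
move=> q0 q1; have s0 : 0 < 1 - q by lra.
(* The sums telescope because [Q] solves [Q n - q * Q n.+1 = n%:R ^+ 2]; comparing coefficients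
   gives [al], [be] and [ga = Q 0]. *)
pose al := (1 - q)^-1; pose be := 2 * q * (1 - q) ^- 2.
pose ga := q * (al + be) / (1 - q).
pose Q (n : nat) := al * n%:R ^+ 2 + be * n%:R + ga.
have al0 : 0 <= al by rewrite invr_ge0 ltW.
have be0 : 0 <= be by rewrite mulr_ge0 ?invr_ge0 ?exprn_ge0 ?mulr_ge0// ltW.
have ga0 : 0 <= ga.
  by apply: divr_ge0; [apply: mulr_ge0 => //; exact: addr_ge0|exact: ltW].
have : \sum_(0 <= n < N) n%:R ^+ 2 * q ^+ n + q ^+ N * Q N = ga.
  elim: N => [|N ih]; first by rewrite big_nil /Q expr0; ring.
  rewrite big_nat_recr//= -[RHS]ih /Q -(natr1 N) (exprS q N) /ga /be /al.
  by field; rewrite gt_eqF.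
have : 0 <= q ^+ N * Q N.
  by rewrite mulr_ge0 ?exprn_ge0// !addr_ge0// mulr_ge0// exprn_ge0.
by rewrite -/al -/be -/ga; lra.
Qed.

(** The second-order remainder of the power is of size n^2 q^(n-2) |h|^2; the factor [q ^+ 2] on the
    left avoids the exponent n - 2. *)
Lemma pow_diff_bound z h (q : R) n : cabs z <= q -> cabs (z + h) <= q ->
  cabs ((z + h) ^+ n - z ^+ n - n%:R * z ^+ n.-1 * h) * q ^+ 2 <= n%:R ^+ 2 * q ^+ n * cabs h ^+ 2.
Proof.
move=> zq zhq; have q0 : 0 <= q by rewrite (le_trans _ zq)// cabs_ge0.
elim: n => [|n ih].
  by rewrite !expr0 !mul0r subrr subr0 cabs0 mul0r expr0n/= !mul0r.
case: n ih => [|n] ih.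
  rewrite !expr1 /= expr0 !mul1r (_ : _ - z - h = 0); last by ring.
  by rewrite cabs0 mul0r expr1n mul1r mulr_ge0// exprn_ge0// cabs_ge0.
rewrite (_ : _ - _ - _ = (z + h) * ((z + h) ^+ n.+1 - z ^+ n.+1 - n.+1%:R * z ^+ n.+1.-1 * h)
  + n.+1%:R * z ^+ n * h ^+ 2); last first.
  by rewrite /= -(natr1 n.+1) !exprS; ring.
set E := _ - _ - _ in ih *.
apply: (@le_trans _ _ ((q * cabs E + n.+1%:R * q ^+ n * cabs h ^+ 2) * q ^+ 2)).
  rewrite ler_wpM2r ?exprn_ge0// (le_trans (cabsD _ _))// !cabsM !cabsX.
  rewrite -RC_nat cabs_RC ger0_norm// lerD//.
    by rewrite ler_wpM2r ?cabs_ge0.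
  rewrite -expr2 ler_wpM2r ?exprn_ge0 ?cabs_ge0// ler_wpM2l// lerXn2r ?nnegrE ?cabs_ge0//.
rewrite mulrDl -mulrA.
apply: (@le_trans _ _ (q * (n.+1%:R ^+ 2 * q ^+ n.+1 * cabs h ^+ 2) + n.+1%:R * q ^+ n * cabs h ^+ 2 * q ^+ 2)).
  by rewrite lerD2r ler_wpM2l.
have k0 : 0 <= q ^+ n.+2 * cabs h ^+ 2 by rewrite mulr_ge0 ?exprn_ge0 ?cabs_ge0.
have n0 : 0 <= n%:R :> R by [].
rewrite [leLHS](_ : _ = (n.+1%:R ^+ 2 + n.+1%:R) * (q ^+ n.+2 * cabs h ^+ 2)); last by rewrite !exprS; ring.
rewrite -mulrA ler_wpM2r// -(natr1 n.+1) -natr1; nra.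
Qed.

Definition psum c z : Cx R := limn (series (fun n => c n * z ^+ n)).

Lemma psum_abs c B z (q : R) N : (forall n, cabs (c n) <= B) -> cabs z <= q -> q < 1 ->
  \sum_(0 <= n < N) cabs (c n * z ^+ n) <= B / (1 - q).
Proof.
move=> cB zq q1; have q0 : 0 <= q by rewrite (le_trans _ zq)// cabs_ge0.
have B0 : 0 <= B by rewrite (le_trans _ (cB 0%N))// cabs_ge0.
apply: (@le_trans _ _ (B * \sum_(0 <= n < N) q ^+ n)).
  rewrite mulr_sumr; apply: ler_sum => n _.
  by rewrite cabsM cabsX ler_pM ?exprn_ge0 ?cabs_ge0// lerXn2r ?nnegrE ?cabs_ge0.
rewrite ler_wpM2l//.
have h := sum_geo q N; have s0 : 0 < 1 - q by lra.
by rewrite -[leRHS]mul1r ler_pdivlMr// h gerBl exprn_ge0.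
Qed.

Lemma psum_cvg c B z : (forall n, cabs (c n) <= B) -> cabs z < 1 ->
  series (fun n => c n * z ^+ n) @ \oo --> psum c z.
Proof.
move=> cB z1; have [l hl] := abs_cvg (fun n => psum_abs n cB (lexx _) z1).
by rewrite /psum (ccvg_limn hl).
Qed.

(** The remainders of the powers, summed by [sum_n2_geo], are of order [cabs h ^+ 2]. The derivative
    comes with its series because later bounds on it are read off the partial sums. *)
Lemma psum_cderiv c B z : (forall n, cabs (c n) <= B) -> cabs z < 1 ->
  exists2 d, series (fun n => n%:R * c n * z ^+ n.-1) @ \oo --> d & cderiv (psum c) z d.
Proof.
move=> cB z1.
have B0 : 0 <= B by rewrite (le_trans _ (cB 0%N))// cabs_ge0.
pose q := (1 + cabs z) / 2.
have q0 : 0 < q by rewrite /q; have := cabs_ge0 z; lra.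
have q1 : q < 1 by rewrite /q; lra.
have zq : cabs z <= q by rewrite /q; lra.
set K := q * ((1 - q)^-1 + 2 * q * (1 - q) ^- 2) / (1 - q).
have hK N : \sum_(0 <= n < N) n%:R ^+ 2 * q ^+ n <= K by apply: sum_n2_geo => //; exact: ltW.
have [d hd] : exists d, series (fun n => n%:R * c n * z ^+ n.-1) @ \oo --> d.
  apply: (@abs_cvg _ (B * K / q)) => N.
  apply: le_trans (_ : B / q * \sum_(0 <= n < N) n%:R ^+ 2 * q ^+ n <= _).
    rewrite mulr_sumr; apply: ler_sum => -[|n] _.
      by rewrite !mul0r cabs0 expr0n/= mul0r mulr0.
    rewrite !cabsM cabsX -RC_nat cabs_RC ger0_norm//=.
    rewrite [leRHS](_ : _ = n.+1%:R * B * q ^+ n * n.+1%:R); last by rewrite (exprS q n); field; rewrite gt_eqF.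
    rewrite -[leLHS]mulr1 ler_pM ?mulr_ge0 ?exprn_ge0 ?cabs_ge0 ?ler1n//.
    by rewrite ler_pM ?mulr_ge0 ?exprn_ge0 ?cabs_ge0 ?ler_wpM2l// lerXn2r ?nnegrE ?cabs_ge0// ltW.
  by rewrite [leRHS]mulrAC ler_wpM2l// divr_ge0// ltW.
exists d => // e e0.
pose K' := B * K / q ^+ 2 + 1.
have K0 : 0 <= K by have := hK 0%N; rewrite big_nil.
have K'0 : 0 < K'.
  apply: ltr_wpDl => //; apply: divr_ge0; first exact: mulr_ge0.
  exact/exprn_ge0/ltW.
exists (Num.min (q - cabs z) (e / K')).
  by rewrite lt_min divr_gt0// andbT subr_gt0 /q; lra.
move=> h; rewrite lt_min ltr_pdivlMr// => /andP[hq he].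
have zhq : cabs (z + h) <= q by rewrite (le_trans (cabsD _ _))//; lra.
have zh1 : cabs (z + h) < 1 by lra.
have c1 := psum_cvg cB z1; have c2 := psum_cvg cB zh1.
have c3 := ccvgB (ccvgB c2 c1) (ccvgMr (h := h) hd).
apply: (@le_trans _ _ (K' * cabs h ^+ 2)); last first.
  by rewrite expr2 mulrA ler_wpM2r ?cabs_ge0// mulrC ltW.
apply: (ccvg_bound (N := 0%N) c3) => N _.
rewrite !seriesEnat /= mulr_suml -!sumrB (le_trans (cabs_sum _ _ _))//.
apply: (@le_trans _ _ (\sum_(0 <= n < N) B / q ^+ 2 * cabs h ^+ 2 * (n%:R ^+ 2 * q ^+ n))).
  apply: ler_sum => n _.
  rewrite (_ : _ - _ - _ = c n * ((z + h) ^+ n - z ^+ n - n%:R * z ^+ n.-1 * h)); last by ring.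
  have := pow_diff_bound n zq zhq; set E := cabs (_ - _ - _) => hE.
  rewrite cabsM -/E.
  apply: (@le_trans _ _ (B * E)); first by rewrite ler_wpM2r ?cabs_ge0.
  rewrite [leRHS](_ : _ = B * (n%:R ^+ 2 * q ^+ n * cabs h ^+ 2 / q ^+ 2)); last by ring.
  by rewrite ler_wpM2l// ler_pdivlMr// exprn_gt0.
rewrite -mulr_sumr.
apply: (@le_trans _ _ (B / q ^+ 2 * cabs h ^+ 2 * K)).
  apply: ler_wpM2l => //; apply: mulr_ge0; last by rewrite exprn_ge0// cabs_ge0.
  by apply: divr_ge0 => //; exact/exprn_ge0/ltW.
rewrite /K' mulrDl mul1r -[leLHS]addr0 lerD ?exprn_ge0 ?cabs_ge0//.
by apply: le_of_eq; ring.
Qed.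

End CSeries.

(** * Parseval's inequality by roots of unity *)

Section Parseval.
Context {R : realType}.
Implicit Types (z w h d l : Cx R) (r t M B e : R) (a c : (Cx R)^nat).

Lemma bernoulli (x : R) n : 0 <= x -> x <= 1 -> 1 - n%:R * x <= (1 - x) ^+ n.
Proof.
move=> x0 x1; elim: n => [|n ih]; first by rewrite mul0r subr0 expr0.
rewrite exprS -(natr1 n).
apply: (@le_trans _ _ ((1 - x) * (1 - n%:R * x))); last by rewrite ler_wpM2l// subr_ge0.
have : 0 <= n%:R * x ^+ 2 by rewrite mulr_ge0// sqr_ge0.
lra.
Qed.

Lemma expr_small (q e : R) : 0 <= q -> q < 1 -> 0 < e ->
  exists N, forall n, (N <= n)%N -> q ^+ n <= e.
Proof.
move=> q0 q1 e0; have := @cvg_expr R q; rewrite ger0_norm// => /(_ q1)/cvgrPdist_le/(_ e e0)[N _ hN].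
by exists N => n /hN; rewrite sub0r normrN ger0_norm// exprn_ge0.
Qed.

Lemma tail_small (x : R^nat) C : (forall k, 0 <= x k) ->
  (forall n, \sum_(0 <= k < n) x k <= C) -> forall e, 0 < e ->
  exists K, forall m n, (K <= m)%N -> (m <= n)%N -> \sum_(m <= k < n) x k <= e.
Proof.
move=> x0 xC e e0; pose S := [set \sum_(0 <= k < n) x k | n in [set: nat]].
have hS : has_sup S by split; [exists (\sum_(0 <= k < 0) x k), 0%N|exists C => _ [n _ <-]].
have [_ [K _ <-] hK] := sup_adherent e0 hS.
exists K => m n Km mn.
have h1 : \sum_(0 <= k < n) x k <= sup S by apply: ub_le_sup; [case: hS|exists n].
have h2 : \sum_(0 <= k < K) x k <= \sum_(0 <= k < m) x k.
  by rewrite (big_cat_nat (n := K) _ Km)//= lerDl sumr_ge0.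
by move: h1; rewrite (big_cat_nat (n := m) _ mn)//=; lra.
Qed.

(** Convergence at the single point [RC r'] with [r < r' < 1] bounds the terms there, and for
    [cabs z <= r] the tails are dominated by a geometric series of ratio [r / r']. *)
Lemma expansion_uniform a (f : Cx R -> Cx R) r e :
  (forall z, cabs z < 1 -> series (fun k => a k * z ^+ k) @ \oo --> f z) ->
  0 <= r -> r < 1 -> 0 < e ->
  exists L0, forall L z, (L0 <= L)%N -> cabs z <= r ->
    cabs (f z - series (fun k => a k * z ^+ k) L) <= e.
Proof.
move=> af r0 r1 e0; pose r' := (1 + r) / 2.
have r'0 : 0 < r' by rewrite /r'; lra.
have r'1 : r' < 1 by rewrite /r'; lra.
have [|B hB] := cvg_terms_bounded (af (RC r') _); first by rewrite cabs_RC gtr0_norm.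
have B0 : 0 <= B by rewrite (le_trans _ (hB 0%N))// cabs_ge0.
pose q := r / r'.
have q0 : 0 <= q by rewrite divr_ge0// ltW.
have q1 : q < 1 by rewrite ltr_pdivrMr// mul1r /r'; lra.
have s0 : 0 < 1 - q by lra.
have e1 : 0 < e * (1 - q) / (B + 1) by rewrite divr_gt0 ?mulr_gt0// ltr_wpDl.
have [L0 hL0] := expr_small q0 q1 e1.
exists L0 => L z /hL0 hL zr.
have z1 : cabs z < 1 by lra.
have h1 : (fun n => series (fun k => a k * z ^+ k) n - series (fun k => a k * z ^+ k) L) @ \oo -->
  f z - series (fun k => a k * z ^+ k) L.
  by apply: cvgB; [exact: af|exact: cvg_cst].
apply: (ccvg_bound (N := L) h1) => n Ln.
rewrite !seriesEnat /= (big_cat_nat (n := L) _ Ln)//= addrAC subrr add0r.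
rewrite (le_trans (cabs_sum _ _ _))//.
apply: (@le_trans _ _ (\sum_(L <= k < n) B * q ^+ k)).
  apply: ler_sum => k _; rewrite cabsM cabsX.
  apply: (@le_trans _ _ (cabs (a k) * r ^+ k)).
    by rewrite ler_wpM2l ?cabs_ge0// lerXn2r ?nnegrE ?cabs_ge0.
  have -> : r ^+ k = r' ^+ k * q ^+ k by rewrite -exprMn /q mulrC divfK// gt_eqF.
  rewrite mulrA ler_wpM2r ?exprn_ge0//.
  by have := hB k; rewrite cabsM cabsX cabs_RC gtr0_norm.
have hg m : \sum_(L <= k < L + m) q ^+ k * (1 - q) = q ^+ L - q ^+ (L + m).
  elim: m => [|m ih]; first by rewrite addn0 big_geq// subrr.
  by rewrite addnS big_nat_recr ?leq_addr//= ih exprS; ring.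
have := hg (n - L)%N; rewrite subnKC// -mulr_suml => hgn.
rewrite -mulr_sumr -(ler_pM2r s0) -mulrA hgn.
apply: (@le_trans _ _ (B * q ^+ L)).
  by rewrite ler_wpM2l// gerBl exprn_ge0.
apply: (@le_trans _ _ (B * (e * (1 - q) / (B + 1)))); first by rewrite ler_wpM2l.
rewrite mulrA ler_pdivrMr ?ltr_wpDl// mulrC ler_wpM2l ?mulr_ge0 ?ltW//.
by rewrite ltr_pwDr.
Qed.

(** Half the angle lies strictly between 0 and pi, where the sine is positive, so the cosine of the
    full angle is below 1. *)
Lemma root_unity_neq1 (N k : nat) : (0 < k)%N -> (k < N)%N ->
  cexp (0 +i* (2 * pi / N%:R * k%:R) : Cx R)%C != 1.
Proof.
move=> k0 kN; apply/eqP => E.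
have N0 : (0 : R) < N%:R by rewrite ltr0n (leq_trans _ kN).
have := congr1 (@Rez R) E; rewrite Rez_cexp Rez1 /Rez /Imz /= expR0 mul1r.
pose x : R := pi / N%:R * k%:R.
have -> : 2 * pi / N%:R * k%:R = x + x by rewrite /x; field; rewrite gt_eqF.
rewrite cosD -!expr2 => h.
have := cos2Dsin2 x; have : 0 < sin x.
  apply: sin_gt0_pi; apply/andP; split.
    by rewrite !mulr_gt0 ?pi_gt0 ?invr_gt0// ltr0n.
  by rewrite /x mulrAC ltr_pdivrMr// ltr_pM2l ?pi_gt0// ltr_nat.
nra.
Qed.

Lemma sum_geo_root (x : Cx R) N : x ^+ N = 1 -> x != 1 -> \sum_(0 <= j < N) x ^+ j = 0.
Proof.
move=> xN x1; have := sum_geo x N; rewrite xN subrr => /eqP.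
by rewrite mulf_eq0 subr_eq0 [1 == x]eq_sym (negbTE x1) orbF => /eqP.
Qed.

Lemma cexp_natmul z n : cexp (n%:R * z) = cexp z ^+ n.
Proof.
elim: n => [|n ih]; first by rewrite mul0r cexp0 expr0.
by rewrite -natr1 mulrDl mul1r cexpD ih exprSr.
Qed.

Lemma cconj_sum (I : Type) (s : seq I) (F : I -> Cx R) :
  cconj (\sum_(i <- s) F i) = \sum_(i <- s) cconj (F i).
Proof. exact: rmorph_sum. Qed.

Lemma cconjX z n : cconj (z ^+ n) = cconj z ^+ n.
Proof. exact: rmorphXn. Qed.

Lemma RC_sum (I : Type) (s : seq I) (F : I -> R) :
  RC (\sum_(i <- s) F i) = \sum_(i <- s) RC (F i).
Proof. exact: rmorph_sum. Qed.

(** The [w j] are the [N]-th roots of unity. Since all exponents are below [N], summing over them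
    keeps exactly the diagonal terms of the double sum. *)
Lemma parseval_poly a N r : (0 < N)%N ->
  exists w : nat -> Cx R, (forall j, cabs (w j) = 1) /\
  \sum_(0 <= j < N) cabs (\sum_(0 <= k < N) a k * (RC r * w j) ^+ k) ^+ 2 =
  N%:R * \sum_(0 <= k < N) (cabs (a k) * r ^+ k) ^+ 2.
Proof.
move=> N0.
have NR : (N%:R : R) != 0 by rewrite pnatr_eq0 -lt0n.
pose om : Cx R := cexp (0 +i* (2 * pi / N%:R))%C.
have om1 : cabs om = 1 by rewrite cabs_cexp /Rez /= expR0.
have omk k : om ^+ k = cexp (0 +i* (2 * pi / N%:R * k%:R))%C.
  rewrite -cexp_natmul; congr cexp; apply: cplx_eq.
    by rewrite RezM -RC_nat Imz_RC {2 3}/Rez /= mulr0 mul0r subr0.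
  by rewrite ImzM -RC_nat Imz_RC Rez_RC mul0r addr0 {1 2}/Imz /= mulrC.
have omN : om ^+ N = 1.
  rewrite omk divfK// -(add0r (Complex _ _)) cexp_period; exact: cexp0.
have cc : om * cconj om = 1 by rewrite mul_cconj om1 expr1n.
have orth (k l : nat) : (k < N)%N -> (l < N)%N ->
    \sum_(0 <= j < N) ((om ^+ k * cconj om ^+ l) ^+ j) = (if k == l then N%:R else 0).
  move=> kN lN; case: eqP => [->|/eqP kl].
    rewrite -exprMn cc (eq_bigr (fun=> 1)); last by move=> j _; rewrite !expr1n.
    by rewrite sumr_const_nat subn0.
  apply: sum_geo_root.
    by rewrite exprMn -!exprM mulnC exprM omN expr1n mul1r mulnC exprM -cconjX omN cconj1 expr1n.
  apply/eqP => E; have [kl'|lk] := ltnP k l.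
    have := @root_unity_neq1 N (l - k) _ _; rewrite subn_gt0 => /(_ kl' (leq_ltn_trans (leq_subr _ _) lN)).
    rewrite -omk => /eqP; apply.
    have e : om ^+ (l - k) * (om ^+ k * cconj om ^+ l) =
        (om * cconj om) ^+ k * (om * cconj om) ^+ (l - k).
      rewrite -{2}(subnK (ltnW kl')) exprD !exprMn.
      move: (om ^+ (l - k)) (om ^+ k) (cconj om ^+ (l - k)) (cconj om ^+ k) => x1 x2 x3 x4.
      by ring.
    by move: e; rewrite E mulr1 cc !expr1n mulr1.
  have lk' : (l < k)%N by rewrite ltn_neqAle eq_sym kl lk.
  have := @root_unity_neq1 N (k - l) _ _; rewrite subn_gt0 => /(_ lk' (leq_ltn_trans (leq_subr _ _) kN)).
  rewrite -omk => /eqP; apply.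
  rewrite -[RHS]E -(subnK lk) [om ^+ (_ + _)]exprD -mulrA -exprMn cc expr1n mulr1.
  by rewrite subnK.
exists (fun j => om ^+ j); split; first by move=> j; rewrite cabsX om1 expr1n.
apply: (@complexI R); rewrite -/(RC _) -/(RC (N%:R * _)) RCM RC_sum RC_nat.
rewrite RC_sum mulr_sumr.
pose T j k (l : nat) := a k * cconj (a l) * RC r ^+ (k + l) * (om ^+ k * cconj om ^+ l) ^+ j.
transitivity (\sum_(0 <= j < N) \sum_(0 <= k < N) \sum_(0 <= l < N) T j k l).
  apply: eq_bigr => j _; rewrite -mul_cconj cconj_sum big_distrl/=; apply: eq_bigr => k _.
  rewrite big_distrr/=; apply: eq_bigr => l _.
  have rr : cconj (RC r) = RC r by apply: cplx_eq => //; rewrite ImzC Imz_RC oppr0.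
  have -> : cconj (a l * (RC r * om ^+ j) ^+ l) = cconj (a l) * (RC r ^+ l * cconj om ^+ (l * j)).
    by rewrite cconjM cconjX cconjM cconjX rr exprMn -exprM (mulnC j l).
  rewrite /T [(RC r * om ^+ j) ^+ k]exprMn -[(om ^+ j) ^+ k]exprM (mulnC j k).
  rewrite [(om ^+ k * _) ^+ j]exprMn -!exprM exprD.
  move: (a k) (cconj (a l)) (RC r ^+ k) (RC r ^+ l) (om ^+ (k * j)) (cconj om ^+ (l * j)) => x1 x2 x3 x4 x5 x6.
  by ring.
rewrite exchange_big/=; rewrite !big_mkord; apply: eq_bigr => k _.
rewrite exchange_big/= big_mkord.
transitivity (\sum_(l < N) a k * cconj (a l) * RC r ^+ (k + l) * (if k == l then N%:R else 0)).
  apply: eq_bigr => l _; have <- := orth k l (ltn_ord k) (ltn_ord l).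
  by rewrite mulr_sumr; apply: eq_bigr.
rewrite (bigD1 k)//= eqxx big1 ?addr0; last first.
  by move=> l lk; rewrite eq_sym (negbTE lk) mulr0.
rewrite mul_cconj exprMn (RCM (cabs (a k) ^+ 2)) -[(r ^+ k) ^+ 2]exprM muln2 -addnn (RCX r (k + k)).
exact: mulrC.
Qed.

(** Two limits in succession: at fixed radius [r] the truncation error tends to 0 while [N] is free
    to grow, then [r] tends to 1. *)
Lemma parseval_le a (f : Cx R -> Cx R) M K :
  (forall z, cabs z < 1 -> series (fun k => a k * z ^+ k) @ \oo --> f z) ->
  (forall z, cabs z < 1 -> cabs (f z) <= M) ->
  \sum_(0 <= k < K) cabs (a k) ^+ 2 <= M ^+ 2.
Proof.
move=> af fM.
have M0 : 0 <= M by rewrite (le_trans _ (fM 0 _)) ?cabs_ge0 ?cabs0.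
have step1 r e : 0 <= r -> r < 1 -> 0 < e ->
    \sum_(0 <= k < K) (cabs (a k) * r ^+ k) ^+ 2 <= (M + e) ^+ 2.
  move=> r0 r1 e0; have [L0 hL] := expansion_uniform af r0 r1 e0.
  pose N := (maxn L0 K).+1.
  have [w [w1 hw]] := @parseval_poly a N r (ltn0Sn _).
  have N0 : (0 : R) < N%:R by rewrite ltr0n.
  have h : N%:R * \sum_(0 <= k < N) (cabs (a k) * r ^+ k) ^+ 2 <= N%:R * (M + e) ^+ 2.
    rewrite -hw; apply: (@le_trans _ _ (\sum_(0 <= j < N) (M + e) ^+ 2)); last first.
      by rewrite sumr_const_nat subn0 mulr_natl.
    apply: ler_sum => j _; rewrite lerXn2r ?nnegrE ?cabs_ge0 ?addr_ge0 ?(ltW e0)//.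
    have zr : cabs (RC r * w j) <= r by rewrite cabsM w1 mulr1 cabs_RC ger0_norm.
    have := hL N (RC r * w j) (leqW (leq_maxl _ _)) zr.
    have := fM (RC r * w j) (le_lt_trans zr r1).
    rewrite seriesEnat /=; set F := f _; set P := \sum_(_ <= _ < _) _.
    by have := cabsB F (F - P); rewrite opprB addrC subrK; lra.
  move: h; rewrite ler_pM2l//; apply: le_trans.
  have KN : (K <= N)%N by rewrite leqW// leq_maxr.
  by rewrite (big_cat_nat (n := K) _ KN)//= lerDl sumr_ge0// => k _; rewrite sqr_ge0.
have step2 r : 0 <= r -> r < 1 -> \sum_(0 <= k < K) (cabs (a k) * r ^+ k) ^+ 2 <= M ^+ 2.
  move=> r0 r1; apply/ler_addgt0Pr => e e0.
  pose e' := Num.min 1 (e / (2 * M + 1)).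
  have e'0 : 0 < e' by rewrite lt_min ltr01 divr_gt0// ltr_wpDl// mulr_ge0.
  have e'1 : e' <= 1 by rewrite ge_min lexx.
  have e'e : e' * (2 * M + 1) <= e by rewrite -ler_pdivlMr ?ge_min ?lexx ?orbT// ltr_wpDl// mulr_ge0.
  rewrite (le_trans (step1 r e' r0 r1 e'0))//; nra.
set S := \sum_(0 <= k < K) cabs (a k) ^+ 2.
have S0 : 0 <= S by rewrite sumr_ge0// => k _; rewrite sqr_ge0.
apply/ler_addgt0Pr => e e0.
(* By [bernoulli], [(1 - d) ^+ (2 * K)] is at least [1 - 2 * K%:R * d], so passing to the radius
   [1 - d] costs at most [2 * K%:R * d * S <= e]. *)
pose d := Num.min 1 (e / (2 * K%:R * S + 1)).
have D0 : 0 < 2 * K%:R * S + 1 by rewrite ltr_wpDl// !mulr_ge0.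
have d0 : 0 < d by rewrite lt_min ltr01 divr_gt0.
have d1 : d <= 1 by rewrite ge_min lexx.
have de : d * (2 * K%:R * S + 1) <= e by rewrite -ler_pdivlMr// ge_min lexx orbT.
have r0 : 0 <= 1 - d by lra.
have r1 : 1 - d < 1 by lra.
have h : (1 - d) ^+ (2 * K) * S <= M ^+ 2.
  apply: le_trans (step2 _ r0 r1); rewrite mulr_sumr big_nat [leRHS]big_nat.
  apply: ler_sum => k /andP[_ kK].
  rewrite exprMn mulrC ler_wpM2l ?sqr_ge0// -exprM (mulnC k).
  by apply: ler_wiXn2l; rewrite ?leq_mul2l ?(ltnW kK) ?orbT ?(ltW r1).
have := bernoulli (2 * K) (ltW d0) d1; rewrite natrM => hb.
have : (1 - 2 * K%:R * d) * S <= M ^+ 2.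
  by rewrite (le_trans _ h)// ler_wpM2r.
have : 0 <= 2 * K%:R * S by rewrite !mulr_ge0.
nra.
Qed.

Lemma sum_inv_sq (K : nat) : \sum_(0 <= k < K) (k.+1%:R ^- 2 : R) <= 2.
Proof.
case: K => [|K]; first by rewrite big_nil.
suff : \sum_(0 <= k < K.+1) (k.+1%:R ^- 2 : R) <= 2 - K.+1%:R^-1.
  by move=> /le_trans; apply; rewrite gerBl invr_ge0.
elim: K => [|K ih]; first by rewrite big_nat1 expr1n invr1; lra.
rewrite big_nat_recr//= (le_trans (lerD ih (lexx _)))//.
set n : R := K.+1%:R; have -> : (K.+2%:R : R) = n + 1 by rewrite -natr1.
have n0 : 0 < n by rewrite ltr0n.
rewrite -subr_ge0 (_ : _ - _ = (n * (n + 1) ^+ 2)^-1).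
  by rewrite invr_ge0 mulr_ge0 ?sqr_ge0// ltW.
by field; lra.
Qed.

(** A product is at most half the sum of the squares of its factors. The bound dominates the
    coefficient series of the Hilbert operator for all [n] at once, as [1 / (k + n + 1)] is at most
    [1 / k.+1]. *)
Lemma coef_summable a (f : Cx R -> Cx R) M K :
  (forall z, cabs z < 1 -> series (fun k => a k * z ^+ k) @ \oo --> f z) ->
  (forall z, cabs z < 1 -> cabs (f z) <= M) ->
  \sum_(0 <= k < K) cabs (a k) / k.+1%:R <= (M ^+ 2 + 2) / 2.
Proof.
move=> af fM.
apply: (@le_trans _ _ (\sum_(0 <= k < K) (cabs (a k) ^+ 2 + k.+1%:R ^- 2) / 2)).
  apply: ler_sum => k _; set x := cabs _; rewrite -exprVn; set y := _^-1.
  by have := sqr_ge0 (x - y); lra.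
rewrite -mulr_suml ler_pM2r ?invr_gt0// big_split lerD//.
  exact: parseval_le af fM.
exact: sum_inv_sq.
Qed.

End Parseval.

(** * The derivative of the Hilbert operator *)

Section HilbertBound.
Context {R : realType}.
Implicit Types (z w h d : Cx R) (r t M B e : R) (a c : (Cx R)^nat).

Lemma real_mono (g dg : R -> R) : (forall t : R, 0 <= t <= 1 -> is_derive t 1 g (dg t)) ->
  (forall t : R, 0 <= t <= 1 -> 0 <= dg t) -> g 0 <= g 1.
Proof.
move=> hd hp.
have [||t tab h] := @MVT_segment R g dg 0 1 ler01.
- move=> x; rewrite in_itv/= => xab; apply: hd.
  by case/andP: xab => /ltW -> /ltW ->.
- apply: derivable_within_continuous => x; rewrite in_itv/= => xab.
  exact: (@ex_derive _ _ _ _ _ _ _ (hd _ xab)).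
by rewrite -subr_ge0 h subr0 mulr1 hp//; move: tab; rewrite in_itv.
Qed.

Lemma Rez_mono (G dG : Cx R -> Cx R) (c : Cx R) (b db : R -> R) :
  (forall t : R, 0 <= t <= 1 -> cderiv G (RC t) (dG (RC t))) ->
  (forall t : R, 0 <= t <= 1 -> is_derive t 1 b (db t)) ->
  (forall t : R, 0 <= t <= 1 -> Rez (c * dG (RC t)) <= db t) ->
  Rez (c * (G 1 - G 0)) <= b 1 - b 0.
Proof.
move=> hG hb hdb.
have := @real_mono (fun t => b t - Rez (c * G (RC t * 1))) (fun t => db t - Rez (c * dG (RC t) * 1)) _ _.
rewrite !mulr1 RC1 RC0 mulrBr RezB => H.
suff : b 0 - Rez (c * G 0) <= b 1 - Rez (c * G 1) by lra.
apply: H => t t01; last by rewrite subr_ge0 mulr1 hdb.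
apply: is_deriveB; first exact: hb.
by apply: (@is_derive_line R G c 1); rewrite mulr1; exact: hG.
Qed.

(** A mean value inequality in which a primitive [b] stands for the integral of the bound [db]; [c]
    is the unit factor that turns the increment of [G] into its modulus. *)
Lemma cabs_mono (G dG : Cx R -> Cx R) (b db : R -> R) :
  (forall t : R, 0 <= t <= 1 -> cderiv G (RC t) (dG (RC t))) ->
  (forall t : R, 0 <= t <= 1 -> is_derive t 1 b (db t)) ->
  (forall t : R, 0 <= t <= 1 -> cabs (dG (RC t)) <= db t) ->
  cabs (G 1 - G 0) <= b 1 - b 0.
Proof.
move=> hG hb hdb; set w := G 1 - G 0.
have [w0|w0] := eqVneq w 0.
  rewrite w0 cabs0 subr_ge0; apply: (@real_mono b db) => // t t01.
  by rewrite (le_trans (cabs_ge0 _) (hdb t t01)).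
have wp : 0 < cabs w by rewrite cabs_gt0.
pose c := cconj w / RC (cabs w).
have c1 : cabs c = 1 by rewrite cabs_div cabs_cconj cabs_RC gtr0_norm// divff// gt_eqF.
have := @Rez_mono G dG c b db hG hb.
have -> : Rez (c * (G 1 - G 0)) = cabs w.
  rewrite -/w /c mulrAC (mulrC (cconj w)) mul_cconj -RCV -RCM Rez_RC expr2 mulfK//.
  by rewrite gt_eqF.
apply=> t t01; rewrite (le_trans (ler_norm _))// (le_trans (Rez_le _))//.
by rewrite cabsM c1 mul1r hdb.
Qed.

Lemma cderiv_sum (N : nat) (f : nat -> Cx R -> Cx R) (z : Cx R) (d : nat -> Cx R) :
  (forall n, cderiv (f n) z (d n)) ->
  cderiv (fun w => \sum_(0 <= n < N) f n w) z (\sum_(0 <= n < N) d n).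
Proof.
move=> hf; elim: N => [|N ih].
  rewrite big_nil; apply: (cderiv_ext ltr01) (cderiv_cst 0 z) => h _.
  by rewrite big_nil.
rewrite big_nat_recr//=; apply: (cderiv_ext ltr01) (cderivD ih (hf N)) => h _.
by rewrite big_nat_recr.
Qed.

Lemma sum_deriv_geo (x : Cx R) N : x != 1 ->
  \sum_(0 <= n < N.+1) n%:R * x ^+ n.-1 =
  (1 - N.+1%:R * x ^+ N + N%:R * x ^+ N.+1) / (1 - x) ^+ 2.
Proof.
move=> x1; have x0 : 1 - x != 0 by rewrite subr_eq0 eq_sym.
elim: N => [|N ih]; first by rewrite big_nat1 mul0r expr0 mul0r addr0 mulr1 subrr mul0r.
rewrite big_nat_recr//= ih -(natr1 N.+1) -(natr1 N) !exprS.
move: (x ^+ N) (N%:R : Cx R) => y m.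
by field.
Qed.

Lemma n_expr_small (q e : R) : 0 < q -> q < 1 -> 0 < e ->
  exists N0, forall N, (N0 <= N)%N -> N%:R * q ^+ N <= e.
Proof.
move=> q0 q1 e0.
set K := q * ((1 - q)^-1 + 2 * q * (1 - q) ^- 2) / (1 - q).
have hK (N : nat) : N%:R ^+ 2 * q ^+ N <= K.
  have := sum_n2_geo N.+1 (ltW q0) q1; rewrite big_nat_recr//=; apply: le_trans.
  rewrite lerDr sumr_ge0// => k _; rewrite mulr_ge0 ?exprn_ge0//; exact: ltW.
have K0 : 0 <= K by have := hK 0%N; rewrite expr0n/= mul0r.
exists (Num.bound (K / e)) => N hN.
have := archi_boundP (divr_ge0 K0 (ltW e0)).
rewrite ltr_pdivrMr// => h.
case: N hN => [|N] hN; first by rewrite mul0r ltW.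
have h1 : K <= N.+1%:R * e by rewrite (le_trans (ltW h))// ler_wpM2r ?ler_nat// ltW.
have N0 : (0 : R) < N.+1%:R by rewrite ltr0n.
by have := le_trans (hK N.+1) h1; rewrite expr2 -mulrA ler_pM2l.
Qed.

(** It bounds the integral of 1 / |1 - t z|^2 over [0, 1] by 9 / |1 - z|, the origin of the 9 in the
    later bounds. *)
Lemma one_sub_tz (z : Cx R) (t : R) : cabs z < 1 -> 0 <= t <= 1 ->
  1 - t + cabs (1 - z) <= 3 * cabs (1 - RC t * z).
Proof.
move=> z1 t01.
have h1 : 1 - t <= cabs (1 - RC t * z).
  have := cabs_ge_sub 1 (RC t * z); rewrite cabs1 cabsM cabs_RC ger0_norm; last by case/andP: t01.
  by have := cabs_ge0 z; nra.
have h2 : cabs (1 - z) <= cabs (1 - RC t * z) + (1 - t).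
  rewrite (_ : 1 - z = (1 - RC t * z) - RC (1 - t) * z); last by rewrite RCB RC1; ring.
  rewrite (le_trans (cabsB _ _))// lerD2l cabsM cabs_RC ger0_norm; last by lra.
  by have := cabs_ge0 z; nra.
lra.
Qed.

(** Since 1 / (k + n + 1) is the integral of t^(k+n) over [0, 1], the double sum is [G 1] for a
    polynomial [G] with [G 0 = 0]. Its derivative [dG] is the polynomial with coefficients [p] times
    a partial sum of t / (1 - t z)^2. *)
Lemma double_sum_bound (p : (Cx R)^nat) (z : Cx R) (B e : R) (N K : nat) :
  cabs z < 1 -> 0 <= B -> 0 <= e ->
  (forall t : R, 0 <= t <= 1 -> cabs (\sum_(0 <= k < K) p k * RC t ^+ k) <= B) ->
  (forall t : R, 0 <= t <= 1 -> cabs (\sum_(0 <= n < N) n%:R * z ^+ n.-1 * RC t ^+ n) <=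
     (1 + e) / cabs (1 - RC t * z) ^+ 2) ->
  cabs (\sum_(0 <= n < N) n%:R * z ^+ n.-1 * \sum_(0 <= k < K) p k / (k + n + 1)%:R) <=
    9 * (1 + e) * B / cabs (1 - z).
Proof.
move=> z1 B0 e0 hp ht.
have dz : 0 < cabs (1 - z).
  by have := cabs_ge_sub 1 z; rewrite cabs1; lra.
pose G s := \sum_(0 <= n < N) \sum_(0 <= k < K)
   (n%:R * z ^+ n.-1 * p k / (k + n + 1)%:R) * s ^+ (k + n + 1).
pose dG s := (\sum_(0 <= k < K) p k * s ^+ k) * (\sum_(0 <= n < N) n%:R * z ^+ n.-1 * s ^+ n).
have hG s : cderiv G s (dG s).
  have h := @cderiv_sum N (fun n s => \sum_(0 <= k < K)
     (n%:R * z ^+ n.-1 * p k / (k + n + 1)%:R) * s ^+ (k + n + 1)) s _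
     (fun n => @cderiv_sum K _ s _ (fun k =>
      cderivZ (n%:R * z ^+ n.-1 * p k / (k + n + 1)%:R) (cderivX (k + n + 1) s))).
  apply: (cderiv_eq h); rewrite /dG mulr_sumr; apply: eq_bigr => n _.
  rewrite mulr_suml; apply: eq_bigr => k _.
  have nz : ((k + n + 1)%:R : Cx R) != 0 by rewrite pnatr_eq0 addn1.
  rewrite addn1 /= exprD; rewrite addn1 in nz.
  move: ((k + n).+1%:R : Cx R) nz (z ^+ n.-1) (s ^+ k) (s ^+ n) (n%:R : Cx R) => x1 nz x2 x3 x4 x5.
  by field.
set dl := cabs (1 - z) in dz *.
(* A primitive of the bound on [dG] supplied by [one_sub_tz]; its increment over [0, 1] is at most
   its value at 1. *)
pose b (t : R) := B * (1 + e) * 9 * (1 - t + dl)^-1.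
pose db (t : R) := B * (1 + e) * 9 * (1 - t + dl) ^- 2.
have hb t : 0 <= t <= 1 -> is_derive t 1 b (db t).
  move=> t01; have q0 : 1 - t + dl != 0 by rewrite gt_eqF//; lra.
  have h1 : is_derive t 1 (fun t : R => 1 - t + dl) (-1).
    have h2 : is_derive t 1 (cst (1 : R) - id + cst dl : R -> R) (0 - 1 + 0).
      by apply: is_deriveD; apply: is_deriveB.
    by rewrite addr0 sub0r in h2.
  have h3 := @is_deriveZ _ _ _ _ (B * (1 + e) * 9) _ _ _ (@is_deriveV R (fun t : R => 1 - t + dl) t (-1) 1 q0 h1).
  by apply: is_derive_eq h3 _; rewrite /db /GRing.scale /=; ring.
have := @cabs_mono G dG b db (fun t _ => hG (RC t)) hb _.
have G0 : G 0 = 0.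
  rewrite /G big1// => n _; rewrite big1// => k _.
  by rewrite addn1 expr0n mulr0.
have G1 : G 1 = \sum_(0 <= n < N) n%:R * z ^+ n.-1 * \sum_(0 <= k < K) p k / (k + n + 1)%:R.
  rewrite /G; apply: eq_bigr => n _; rewrite mulr_sumr; apply: eq_bigr => k _.
  by rewrite expr1n mulr1 !mulrA.
rewrite G0 G1 subr0 => H; apply: (le_trans (H _)); last first.
  rewrite /b subrr add0r subr0 [leRHS](_ : _ = B * (1 + e) * 9 / dl); last by ring.
  rewrite gerBl !mulr_ge0 ?invr_ge0//; lra.
move=> t t01; rewrite /dG cabsM /db.
have q0 : 0 < 1 - t + dl by lra.
have c0 : 0 < cabs (1 - RC t * z) by have := one_sub_tz z1 t01; rewrite -/dl; lra.
rewrite -!mulrA; apply: ler_pM; rewrite ?cabs_ge0 ?hp//.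
rewrite (le_trans (ht t t01))// ler_wpM2l//; first lra.
rewrite ler_pdivlMr ?exprn_gt0// mulrC ler_pdivrMr ?exprn_gt0//.
have := one_sub_tz z1 t01; rewrite -/dl; nra.
Qed.

(** The [n]-th Taylor coefficient of the image: [hilbert f] unfolds to [psum (hcoef (taylor f))]. *)
Definition hcoef a (n : nat) : Cx R := limn (series (fun k => a k / (k + n + 1)%:R)).

Lemma hcoef_term_le a n k : cabs (a k / (k + n + 1)%:R) <= cabs (a k) / k.+1%:R.
Proof.
rewrite cabs_div -RC_nat cabs_RC ger0_norm// ler_wpM2l ?cabs_ge0//.
by rewrite lef_pV2 ?posrE ?ltr0n ?addn1// ler_nat ltnS leq_addr.
Qed.

Lemma hcoef_cvg a C n : (forall K, \sum_(0 <= k < K) cabs (a k) / k.+1%:R <= C) ->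
  series (fun k => a k / (k + n + 1)%:R) @ \oo --> hcoef a n /\ cabs (hcoef a n) <= C.
Proof.
move=> hC.
have le k := hcoef_term_le a n k.
have [l hl] : exists l : Cx R, series (fun k => a k / (k + n + 1)%:R) @ \oo --> l.
  by apply: (@abs_cvg _ _ C) => K; apply: le_trans (hC K); apply: ler_sum => k _.
rewrite /hcoef (ccvg_limn hl); split => //.
apply: (ccvg_bound (N := 0%N) hl) => K _; rewrite seriesEnat /=.
by rewrite (le_trans (cabs_sum _ _ _))// (le_trans _ (hC K))//; apply: ler_sum => k _.
Qed.

(** Partial sums of a bounded function need not be bounded by its supremum; damped by [RC r ^+ k]
    they nearly are, once long enough. The error is uniform in [n] because [1 / (k + n + 1)] is at
    most [1 / k.+1]. *)
Lemma hcoef_approx a C (e : R) : (forall K, \sum_(0 <= k < K) cabs (a k) / k.+1%:R <= C) ->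
  0 < e -> exists2 r, 0 <= r < 1 & exists K0, forall K n, (K0 <= K)%N ->
   cabs (hcoef a n - \sum_(0 <= k < K) (a k * RC r ^+ k) / (k + n + 1)%:R) <= e.
Proof.
move=> hC e0; have e3 : 0 < e / 3 by rewrite divr_gt0.
have x0 k : 0 <= cabs (a k) / k.+1%:R by rewrite divr_ge0 ?cabs_ge0.
have C0 : 0 <= C by have := hC 0%N; rewrite big_nil.
have [K0 hK0] := tail_small x0 hC e3.
(* Three errors of [e / 3]: the truncated tail, the damping of the terms beyond [K0], and that of
   the first [K0] terms, which by [bernoulli] lose at most the fraction [K0%:R * s] each. *)
pose s := Num.min 1 (e / 3 / (K0%:R * C + 1)).
have D0 : 0 < K0%:R * C + 1 by rewrite ltr_wpDl// mulr_ge0.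
have s0 : 0 < s by rewrite lt_min ltr01 divr_gt0.
have s1 : s <= 1 by rewrite ge_min lexx.
have se : s * (K0%:R * C + 1) <= e / 3 by rewrite -ler_pdivlMr// ge_min lexx orbT.
exists (1 - s); first by lra.
exists K0 => K n K0K.
have [hc _] := hcoef_cvg n hC.
have le k := hcoef_term_le a n k.
have h1 : cabs (hcoef a n - \sum_(0 <= k < K) a k / (k + n + 1)%:R) <= e / 3.
  have h2 := ccvgB hc (_ : (fun=> \sum_(0 <= k < K) a k / (k + n + 1)%:R) @ \oo --> _).
  apply: (ccvg_bound (N := K) (h2 _ (cvg_cst _))) => L KL.
  rewrite seriesEnat /= (big_cat_nat (n := K) _ KL)//= addrAC subrr add0r.
  rewrite (le_trans (cabs_sum _ _ _))// (le_trans _ (hK0 K L K0K KL))//.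
  by apply: ler_sum => k _.
rewrite (_ : hcoef a n - _ = (hcoef a n - \sum_(0 <= k < K) a k / (k + n + 1)%:R)
  + \sum_(0 <= k < K) (a k / (k + n + 1)%:R) * RC (1 - (1 - s) ^+ k)); last first.
  rewrite -addrA; congr (_ + _); rewrite -sumrN -[X in _ = X + _]sumrN -big_split/=; apply: eq_bigr => k _.
  by rewrite (RCB 1 ((1 - s) ^+ k)) RC1 RCX; ring.
have es : e = e / 3 + (e / 3 + e / 3) by field.
rewrite (le_trans (cabsD _ _))// [leRHS]es lerD//.
rewrite (le_trans (cabs_sum _ _ _))//.
have ss k : 0 <= 1 - (1 - s) ^+ k <= 1.
  rewrite subr_ge0 exprn_ile1 ?gerBl ?exprn_ge0//; lra.
rewrite (big_cat_nat (n := K0) _ K0K)//= lerD//.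
  apply: (@le_trans _ _ (\sum_(0 <= k < K0) cabs (a k) / k.+1%:R * (K0%:R * s))).
    rewrite big_nat [leRHS]big_nat; apply: ler_sum => k /andP[_ kK].
    rewrite cabsM ler_pM ?cabs_ge0// cabs_RC ger0_norm; last by case/andP: (ss k).
    have := bernoulli k (ltW s0) s1.
    have : k%:R * s <= K0%:R * s by apply: ler_wpM2r; [exact: ltW|rewrite ler_nat ltnW].
    lra.
  rewrite -mulr_suml (le_trans _ se)//.
  apply: (@le_trans _ _ (C * (K0%:R * s))); last by nra.
  by rewrite ler_wpM2r// mulr_ge0// ltW.
apply: le_trans (hK0 K0 K (leqnn _) K0K); apply: ler_sum => k _.
rewrite cabsM -[leRHS]mulr1 ler_pM ?cabs_ge0// cabs_RC ger0_norm; by case/andP: (ss k).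
Qed.

(** Both series are truncated and the coefficients damped, so that [double_sum_bound] applies to
    finite sums with [M + e] for [B]; all errors are absorbed into [e], which then tends to 0. *)
Theorem hilbert_deriv_bound a (f : Cx R -> Cx R) M z :
  (forall z, cabs z < 1 -> series (fun k => a k * z ^+ k) @ \oo --> f z) ->
  (forall z, cabs z < 1 -> cabs (f z) <= M) -> cabs z < 1 ->
  exists2 d, cderiv (psum (hcoef a)) z d & cabs d <= 9 * M / cabs (1 - z).
Proof.
move=> af fM z1.
have hC K := coef_summable K af fM.
have cB n := (hcoef_cvg n hC).2.
have [d hd cd] := psum_cderiv cB z1.
exists d => //.
have dz : 0 < cabs (1 - z).
  by have := cabs_ge_sub 1 z; rewrite cabs1; lra.
have M0 : 0 <= M by rewrite (le_trans _ (fM 0 _)) ?cabs_ge0 ?cabs0.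
suff main e : 0 < e -> cabs d <= 9 * (1 + e) * (M + e) / cabs (1 - z) + e.
  apply/ler_addgt0Pr => e e0.
  pose D := 9 * (M + 2) / cabs (1 - z) + 1.
  have D0 : 0 < D by rewrite ltr_wpDl// divr_ge0 ?mulr_ge0 ?cabs_ge0//; lra.
  pose e' := Num.min 1 (e / D).
  have e'0 : 0 < e' by rewrite lt_min ltr01 divr_gt0.
  have e'1 : e' <= 1 by rewrite ge_min lexx.
  have e'e : e' * D <= e by rewrite -ler_pdivlMr// ge_min lexx orbT.
  rewrite (le_trans (main e' e'0))//.
  apply: (@le_trans _ _ (9 * M / cabs (1 - z) + e' * D)); last by rewrite lerD2l.
  rewrite [leRHS](_ : _ = (9 * M + e' * (9 * (M + 2))) / cabs (1 - z) + e'); last by rewrite /D; ring.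
  rewrite lerD2r.
  rewrite ler_wpM2r ?invr_ge0 ?cabs_ge0//; nra.
move=> e0.
pose q := (1 + cabs z) / 2.
have q0 : 0 < q by rewrite /q; have := cabs_ge0 z; lra.
have q1 : q < 1 by rewrite /q; lra.
have zq : cabs z <= q by rewrite /q; lra.
have e3 : 0 < e / 3 by rewrite divr_gt0.
(* The numerator in [sum_deriv_geo] differs from 1 by at most [2 * N%:R * q ^+ N + q ^+ N], hence
   the thirds of [e]. *)
have [N1 hN1] := n_expr_small q0 q1 e3.
have [N2 hN2] := expr_small (ltW q0) q1 e3.
have hT N t : (maxn N1 N2 <= N)%N -> 0 <= t <= 1 ->
   cabs (\sum_(0 <= n < N.+1) n%:R * z ^+ n.-1 * RC t ^+ n) <=
     (1 + e) / cabs (1 - RC t * z) ^+ 2.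
  rewrite geq_max => /andP[/hN1 k1 /hN2 k2] t01.
  have /andP[t0 t1] := t01.
  pose x := RC t * z.
  have xz : cabs x <= cabs z by rewrite cabsM cabs_RC ger0_norm// ler_piMl ?cabs_ge0.
  have xq : cabs x <= q by rewrite (le_trans xz).
  have x1 : x != 1 by apply/eqP => E; move: xq; rewrite E cabs1; lra.
  have -> : \sum_(0 <= n < N.+1) n%:R * z ^+ n.-1 * RC t ^+ n =
     RC t * \sum_(0 <= n < N.+1) n%:R * x ^+ n.-1.
    rewrite mulr_sumr; apply: eq_bigr => -[|n] _; first by rewrite !mul0r mulr0.
    rewrite /x /= exprMn exprS.
    move: (z ^+ n) (RC t ^+ n) => y1 y2; ring.
  rewrite sum_deriv_geo// cabsM cabs_RC (ger0_norm t0) cabs_div cabsX.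
  have c0 : 0 < cabs (1 - x) by rewrite cabs_gt0 subr_eq0 eq_sym.
  rewrite mulrA ler_wpM2r ?invr_ge0 ?exprn_ge0 ?cabs_ge0//.
  apply: (@le_trans _ _ (cabs (1 - N.+1%:R * x ^+ N + N%:R * x ^+ N.+1))).
    by rewrite ler_piMl ?cabs_ge0.
  have xN : cabs x ^+ N <= q ^+ N by rewrite lerXn2r ?nnegrE ?cabs_ge0// ltW.
  have qN : q ^+ N.+1 <= q ^+ N by rewrite exprS ler_piMl ?exprn_ge0 ?ltW.
  have xN1 : cabs x ^+ N.+1 <= q ^+ N.
    by rewrite (le_trans _ qN)// lerXn2r ?nnegrE ?cabs_ge0// ltW.
  rewrite (le_trans (cabsD _ _))// (le_trans (lerD (cabsB _ _) (lexx _)))//.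
  rewrite !cabsM !cabsX cabs1 -!RC_nat !cabs_RC !ger0_norm// -(natr1 N).
  have n0 : 0 <= N%:R :> R by [].
  have h1 : (N%:R + 1) * cabs x ^+ N <= (N%:R + 1) * q ^+ N by rewrite ler_wpM2l//; lra.
  have h2 : N%:R * cabs x ^+ N.+1 <= N%:R * q ^+ N by rewrite ler_wpM2l.
  lra.
have hD : forall N, (maxn N1 N2 <= N)%N ->
  cabs (series (fun n => n%:R * hcoef a n * z ^+ n.-1) N.+1) <= 9 * (1 + e) * (M + e) / cabs (1 - z) + e.
  move=> N hN; rewrite seriesEnat /=.
  pose S := \sum_(0 <= n < N.+1) cabs (n%:R * z ^+ n.-1).
  have S0 : 0 <= S by apply: sumr_ge0 => n _; exact: cabs_ge0.
  have S1 : 0 < S + 1 by lra.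
  (* The coefficient errors enter with weights [cabs (n%:R * z ^+ n.-1)], of total [S], hence the
     accuracy [e / (S + 1)]. *)
  have [r /andP[r0 r1] [K0 hK0]] := hcoef_approx hC (divr_gt0 e0 S1).
  have [L0 hL0] := expansion_uniform af r0 r1 e0.
  pose K := maxn K0 L0.
  have hP t : 0 <= t <= 1 -> cabs (\sum_(0 <= k < K) (a k * RC r ^+ k) * RC t ^+ k) <= M + e.
    move=> /andP[t0 t1].
    have rt : cabs (RC (r * t)) <= r by rewrite cabs_RC ger0_norm ?mulr_ge0// ler_piMr.
    have fr := fM _ (le_lt_trans rt r1).
    have := hL0 K (RC (r * t)) (leq_maxr _ _) rt; rewrite seriesEnat /= => h.
    have E : \sum_(0 <= k < K) a k * RC (r * t) ^+ k = \sum_(0 <= k < K) (a k * RC r ^+ k) * RC t ^+ k.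
      by apply: eq_bigr => k _; rewrite (RCM r t) -mulrA; congr (_ * _); exact: exprMn.
    rewrite E in h.
    move: fr h.
    set F := f _; set P := \sum_(_ <= _ < _) _.
    by have := cabsB F (F - P); rewrite opprB addrC subrK; lra.
  have Me : 0 <= M + e by lra.
  have := double_sum_bound z1 Me (ltW e0) hP (fun t => hT N t hN).
  set X := \sum_(0 <= n < N.+1) _ * _ => hX.
  set Y := \sum_(0 <= n < N.+1) _.
  rewrite (_ : Y = X + (Y - X)); last by ring.
  rewrite (le_trans (cabsD _ _))// lerD//.
  rewrite -sumrB (le_trans (cabs_sum _ _ _))//.
  apply: (@le_trans _ _ (\sum_(0 <= n < N.+1) cabs (n%:R * z ^+ n.-1) * (e / (S + 1)))).
    apply: ler_sum => n _; rewrite (_ : _ - _ = n%:R * z ^+ n.-1 *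
      (hcoef a n - \sum_(0 <= k < K) (a k * RC r ^+ k) / (k + n + 1)%:R)); last by ring.
    by rewrite cabsM ler_wpM2l ?cabs_ge0// hK0// leq_maxl.
  rewrite -mulr_suml -/S mulrA ler_pdivrMr// mulrC ler_wpM2l ?ltW//; lra.
apply: (ccvg_bound (N := (maxn N1 N2).+1) hd) => -[//|N] hN.
exact: hD.
Qed.

(* [(1 - z) * h'(z)] is the integral over [0, 1] of [(1 - t) / (1 - t z)],
   whose integrand has real part at least [(1 - t) / 2]. *)
Theorem hilbert_one_lower z d :
  cabs z < 1 -> series (fun n => n%:R * n.+1%:R^-1 * z ^+ n.-1) @ \oo --> d ->
  1 / 4 <= Rez ((1 - z) * d).
Proof.
move=> z1 hd.
pose W N s := \sum_(0 <= n < N) z ^+ n * (s ^+ n.+1 / n.+1%:R - s ^+ n.+2 / n.+2%:R).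
pose dW N s := \sum_(0 <= n < N) z ^+ n * (s ^+ n - s ^+ n.+1).
have hW N s : cderiv (W N) s (dW N s).
  apply: (@cderiv_sum N (fun n s => z ^+ n * (s ^+ n.+1 / n.+1%:R - s ^+ n.+2 / n.+2%:R))) => n.
  apply: cderivZ; apply: cderivB.
    apply: (cderiv_ext ltr01 _ (cderiv_eq (cderivZ n.+1%:R^-1 (cderivX n.+1 s)) _)).
      by move=> h _ /=; rewrite mulrC.
    by rewrite /= mulKf// pnatr_eq0.
  apply: (cderiv_ext ltr01 _ (cderiv_eq (cderivZ n.+2%:R^-1 (cderivX n.+2 s)) _)).
    by move=> h _ /=; rewrite mulrC.
  by rewrite /= mulKf// pnatr_eq0.
have half (x : Cx R) : cabs x < 1 -> 1 / 2 <= Rez (1 - x)^-1.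
  move=> x1; have n0 : 1 - x != 0.
    by rewrite subr_eq0; apply/eqP => E; move: x1; rewrite -E cabs1 ltxx.
  have p0 : 0 < cabs (1 - x) ^+ 2 by rewrite exprn_gt0// cabs_gt0.
  have -> : (1 - x)^-1 = RC (cabs (1 - x) ^- 2) * cconj (1 - x).
    have cn0 : cconj (1 - x) != 0 by rewrite -cabs_eq0 cabs_cconj cabs_eq0.
    rewrite RCV -mul_cconj; move: (1 - x) (cconj (1 - x)) n0 cn0 => y1 y2 n0 cn0.
    by field; rewrite n0 cn0.
  rewrite RezM Rez_RC Imz_RC mul0r subr0 RezC [leRHS]mulrC ler_pdivlMr//.
  have : cabs x ^+ 2 < 1 by rewrite expr_lt1// cabs_ge0.
  rewrite !cabs_sqr !RezB !ImzB Rez1 Imz1; nra.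
have hdW N (t : R) : 0 <= t <= 1 ->
   (1 - t) * (1 / 2 - cabs z ^+ N / (1 - cabs z)) <= Rez (dW N (RC t)).
  move=> /andP[t0 t1]; pose x := RC t * z.
  have xz : cabs x <= cabs z by rewrite cabsM cabs_RC ger0_norm// ler_piMl ?cabs_ge0.
  have x1 : cabs x < 1 by lra.
  have n0 : 1 - x != 0.
    by rewrite subr_eq0; apply/eqP => E; move: x1; rewrite -E cabs1 ltxx.
  have -> : dW N (RC t) = RC (1 - t) * ((1 - x)^-1 - x ^+ N / (1 - x)).
    transitivity (RC (1 - t) * \sum_(0 <= n < N) x ^+ n).
      rewrite mulr_sumr; apply: eq_bigr => n _.
      rewrite RCB RC1 exprMn exprS; move: (RC t ^+ n) (z ^+ n) => y1 y2; ring.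
    by congr (_ * _); apply: (mulIf n0); rewrite mulrBl mulVf// divfK// sum_geo.
  rewrite RezM Rez_RC Imz_RC mul0r subr0 ler_wpM2l ?subr_ge0// RezB lerB ?half//.
  rewrite (le_trans (ler_norm _))// (le_trans (Rez_le _))// cabs_div cabsX.
  have d1 : 0 < 1 - cabs z by lra.
  have d2 : 1 - cabs z <= cabs (1 - x) by have := cabs_ge_sub 1 x; rewrite cabs1; lra.
  rewrite ler_pM ?exprn_ge0 ?invr_ge0 ?cabs_ge0//.
    by rewrite lerXn2r ?nnegrE ?cabs_ge0.
  by rewrite lef_pV2 ?posrE// (lt_le_trans d1).
have W1 N : (1 / 2 - cabs z ^+ N / (1 - cabs z)) / 2 <= Rez (W N 1).
  set k := _ - _ / _.
  pose b (t : R) := k / 2 * (1 - t) ^+ 2.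
  have hb (t : R) : 0 <= t <= 1 -> is_derive t 1 b (- (k * (1 - t))).
    move=> _; have h1 : is_derive t 1 (cst (1 : R) - id : R -> R) (0 - 1).
      by apply: is_deriveB.
    have h3 := @is_deriveZ _ _ _ _ (k / 2) _ _ _ (@is_deriveX _ _ _ 2 _ _ _ h1).
    apply: is_derive_eq h3 _; rewrite /GRing.scale /= expr1.
    rewrite (_ : (cst 1 - id) t = 1 - t) //; by field.
  have := @Rez_mono (W N) (dW N) (-1) b _ (fun t _ => hW N (RC t)) hb.
  have W0 : W N 0 = 0.
    by rewrite /W big1// => n _; rewrite !expr0n/= !mul0r subrr mulr0.
  rewrite W0 subr0 mulN1r RezN /b subrr subr0 expr0n/= mulr0 expr1n mulr1 sub0r.
  rewrite lerN2; apply => t t01; rewrite mulN1r RezN lerN2 mulrC; exact: hdW.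
(* Summation by parts: (n+1)/(n+2) - n/(n+1) equals 1/(n+1) - 1/(n+2), the coefficient of [z ^+ n]
   in [W N 1]. *)
have WD N : (1 - z) * series (fun n => n%:R * n.+1%:R^-1 * z ^+ n.-1) N.+1 =
    W N 1 - N%:R / N.+1%:R * z ^+ N.
  rewrite seriesEnat /=; elim: N => [|N ih].
    by rewrite big_nat1 !mul0r mulr0 /W big_nil subr0.
  rewrite big_nat_recr//= mulrDr ih /W big_nat_recr//= !expr1n (exprS z N).
  have n1 : (N.+1%:R : Cx R) != 0 by rewrite pnatr_eq0.
  have n2 : (N.+2%:R : Cx R) != 0 by rewrite pnatr_eq0.
  move: n1 n2; rewrite -(natr1 N.+1) -(natr1 N).
  move: (\sum_(_ <= _ < _) _) (z ^+ N) (N%:R : Cx R) => S y m n1 n2.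
  by field; rewrite n1 n2.
apply/ler_addgt0Pr => e e0.
have d1 : 0 < 1 - cabs z by lra.
pose D := (1 - cabs z)^-1 / 2 + 1.
have D0 : 0 < D by rewrite ltr_wpDl// divr_ge0// invr_ge0 ltW.
have [N0 hN0] := expr_small (cabs_ge0 z) z1 (divr_gt0 e0 D0).
rewrite -lerBlDr.
have := ccvgMr (h := 1 - z) hd; rewrite (mulrC d) => hd'.
apply: (ccvg_Rez_ge (N := N0.+1) hd') => -[//|N]; rewrite ltnS => /hN0 hN.
rewrite [_ * (1 - z)]mulrC WD RezB; have := W1 N.
have : Rez (N%:R / N.+1%:R * z ^+ N) <= cabs z ^+ N.
  rewrite (le_trans (ler_norm _))// (le_trans (Rez_le _))// cabsM cabsX.
  rewrite ler_piMl ?exprn_ge0 ?cabs_ge0// cabs_div -!RC_nat !cabs_RC !ger0_norm//.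
  by rewrite ler_pdivrMr ?ltr0n// mul1r ler_nat.
move: hN; rewrite ler_pdivlMr// /D mulrDr mulr1 mulrA; lra.
Qed.
End HilbertBound.

(** * The derivative of the principal logarithm on the right half-plane *)

Section LogDeriv.
Context {R : realType}.
Implicit Types (z w h u d : Cx R) (r t e x : R).

Lemma cos_gt0_pihalf_lt x : `|x| <= pi -> 0 < cos x -> `|x| < pi / 2.
Proof.
move=> xpi c0; rewrite ltNge; apply/negP => xp.
have : 0 <= sin (`|x| - pi / 2).
  by apply: sin_ge0_pi; rewrite subr_ge0 xp/= lerBlDr (le_trans xpi)// lerDl divr_ge0// pi_ge0.
rewrite sinBpihalf (_ : cos `|x| = cos x); first lra.
by case: (ger0P x) => // _; rewrite cosN.
Qed.

Lemma Rez_div_cabs w : w != 0 -> -1 <= Rez w / cabs w <= 1.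
Proof.
rewrite -cabs_gt0 => w0; have := Rez_le w; rewrite ler_norml => /andP[h1 h2].
by rewrite ler_pdivlMr// ler_pdivrMr// mulN1r mul1r h1.
Qed.

Lemma cexp_Log w : w != 0 -> cexp (Log w) = w.
Proof.
move=> w0; have wb := Rez_div_cabs w0; have wp : 0 < cabs w by rewrite cabs_gt0.
have cA : cos (acos (Rez w / cabs w)) = Rez w / cabs w by rewrite acosK// in_itv.
have sA : sin (acos (Rez w / cabs w)) = `|Imz w| / cabs w.
  rewrite sin_acos// -[RHS]ger0_norm ?divr_ge0 ?(ltW wp)// -sqrtr_sqr; congr Num.sqrt.
  rewrite !expr_div_n real_normK ?num_real// (_ : 1 = cabs w ^+ 2 / cabs w ^+ 2).
    by rewrite -mulrBl cabs_sqr addrAC subrr add0r.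
  by rewrite divff// expf_neq0// gt_eqF.
have RL : Rez (Log w) = ln (cabs w) by [].
have IL : Imz (Log w) = Arg w by [].
apply: cplx_eq; rewrite ?Rez_cexp ?Imz_cexp RL IL lnK ?posrE// /Arg -/(Rez w) -/(Imz w).
  by case: ifP => _; rewrite ?cosN cA mulrC divfK// gt_eqF.
case: ifP => h; rewrite ?sinN sA ?mulrN mulrC divfK ?gt_eqF//.
  by rewrite ger0_norm.
by rewrite ltr0_norm ?opprK// ltNge h.
Qed.

Lemma Arg_bound w : 0 < Rez w -> `|Arg w| < pi / 2.
Proof.
move=> rw; have w0 : w != 0 by apply/eqP => E; move: rw; rewrite E Rez0 ltxx.
have wp : 0 < cabs w by rewrite cabs_gt0.
have wb := Rez_div_cabs w0.
have E := congr1 (@Rez R) (cexp_Log w0).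
apply: cos_gt0_pihalf_lt.
  by rewrite /Arg; case: ifP => _; rewrite ?normrN ger0_norm ?acos_ge0 ?acos_lepi.
move: E; rewrite Rez_cexp => E; move: rw; rewrite -{1}E.
by rewrite pmulr_rgt0// expR_gt0.
Qed.

Lemma rderiv_near (f : R -> R) x : is_derive x 1 f 1 -> f x = 0 ->
  exists2 t, 0 < t & forall h : R, `|h| < t -> `|f (x + h)| <= 2 * `|h|.
Proof.
move=> fd fx; have [t t0 ht] := rderivP fd ltr01; exists t => // h /ht.
rewrite fx subr0 !mul1r => H.
by have := ler_normD (f (x + h) - h) h; rewrite subrK; lra.
Qed.

(** The increment [k] of [Log] solves [cexp k = 1 + h / w]. Arguments in the right half-plane differ
    by less than pi, and a positive cosine then confines [Imz k] to modulus below pi / 2, where it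
    is an arcsine: no jump of the branch can occur. *)
Lemma Log_near w : 0 < Rez w -> forall e, 0 < e -> exists2 t, 0 < t &
  forall h, cabs h < t -> w + h != 0 /\ cabs (Log (w + h) - Log w) <= e.
Proof.
move=> rw e e0; have w0 : w != 0 by apply/eqP => E; move: rw; rewrite E Rez0 ltxx.
have wp : 0 < cabs w by rewrite cabs_gt0.
have d1 : is_derive (0 : R) 1 (@asin R) (Num.sqrt (1 - 0 ^+ 2))^-1.
  by apply: is_derive1_asin; lra.
rewrite expr0n/= subr0 sqrtr1 invr1 in d1.
have a0 : asin (0 : R) = 0.
  by rewrite -{1}sin0 sinK// in_itv/= oppr_le0 divr_ge0 ?pi_ge0.
have [t1 t10 ht1] := rderiv_near d1 a0.
have d2 := is_derive1_ln (ltr01 : 0 < (1 : R)); rewrite invr1 in d2.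
have [t2 t20 ht2] := rderiv_near d2 (ln1 R).
pose s := Num.min (2^-1) (Num.min (t1 / 3) (Num.min (t2 / 2) (e / 8))).
have s0 : 0 < s by rewrite !lt_min; apply/and4P; split; rewrite ?divr_gt0 ?invr_gt0.
exists (Num.min (s * cabs w) (Rez w)); first by rewrite lt_min rw mulr_gt0.
move=> h; rewrite lt_min => /andP[hs hr].
have rwh : 0 < Rez (w + h) by rewrite RezD; have := Rez_le h; rewrite ler_norml; lra.
have wh0 : w + h != 0 by apply/eqP => E; move: rwh; rewrite E Rez0 ltxx.
split => //.
pose k := Log (w + h) - Log w.
pose u := h / w.
have us : cabs u < s by rewrite cabs_div ltr_pdivrMr.
have ck : cexp k = 1 + u.
  apply: (mulIf w0); rewrite -{1}(cexp_Log w0) -cexpD subrK cexp_Log//.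
  by rewrite mulrDl mul1r divfK.
have := us; rewrite !lt_min => /and4P[u1 u2 u3 u4].
have u10 : 0 < Rez (1 + u) by rewrite RezD Rez1; have := Rez_le u; rewrite ler_norml; lra.
have cu0 : 1 - cabs u <= cabs (1 + u).
  by have := cabs_ge_sub 1 (- u); rewrite opprK cabsN cabs1.
have cu1 : cabs (1 + u) <= 1 + cabs u by rewrite (le_trans (cabsD _ _))// cabs1.
have ek : expR (Rez k) = cabs (1 + u) by rewrite -cabs_cexp ck.
have k1 : Rez k = ln (cabs (1 + u)) by rewrite -ek expRK.
have k1b : `|Rez k| <= 2 * cabs u.
  have x1 : `|cabs (1 + u) - 1| <= cabs u by rewrite ler_norml; clear -cu0 cu1; lra.
  have := ht2 (cabs (1 + u) - 1); rewrite (addrC 1 (_ - 1)) subrK -k1 => H.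
  by apply: le_trans (H _) _; [apply: le_lt_trans x1 _; clear -u3 t20; have := cabs_ge0 u; lra|rewrite ler_pM2l].
have k2pi : `|Imz k| < pi / 2.
  apply: cos_gt0_pihalf_lt.
    rewrite /k ImzB -[Imz (Log _)]/(Arg _) -[Imz (Log w)]/(Arg _).
    have A1 := Arg_bound rw; have A2 := Arg_bound rwh.
    by apply: le_trans (ler_normB _ _) _; clear -A1 A2; lra.
  have := congr1 (@Rez R) ck; rewrite Rez_cexp => E.
  by move: u10; rewrite -E pmulr_rgt0// expR_gt0.
have k2 : Imz k = asin (Imz (1 + u) / cabs (1 + u)).
  have -> : Imz (1 + u) / cabs (1 + u) = sin (Imz k).
    by rewrite -ck Imz_cexp cabs_cexp mulrC mulKf// gt_eqF// expR_gt0.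
  by rewrite sinK// in_itv/= -ler_norml ltW.
have k2b : `|Imz k| <= 4 * cabs u.
  set v := Imz (1 + u) / cabs (1 + u) in k2.
  have v2 : `|v| <= 2 * cabs u.
    have c0 : 0 < cabs (1 + u) by clear -cu0 u1; lra.
    rewrite normrM normfV (ger0_norm (cabs_ge0 _)) ler_pdivrMr//.
    rewrite ImzD Imz1 add0r (le_trans (Imz_le _))//.
    by have := cabs_ge0 u; clear -cu0 u1; nra.
  have := ht1 v; rewrite add0r -k2 => H.
  apply: le_trans (H _) _; first by apply: le_lt_trans v2 _; clear -u2 t10; lra.
  by clear -v2; lra.
by rewrite (le_trans (cabs_le_ReIm _))// -/k; clear -k1b k2b u4 e0; lra.
Qed.

(** Inverts the expansion [cexp k = 1 + k + o(k)] at the increment [k], small by [Log_near];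
    [cabs k <= 2 * cabs (h / w)] turns o(k) into o(h). *)
Lemma cderiv_Log w : 0 < Rez w -> cderiv (@Log R) w w^-1.
Proof.
move=> rw e e0; have w0 : w != 0 by apply/eqP => E; move: rw; rewrite E Rez0 ltxx.
have wp : 0 < cabs w by rewrite cabs_gt0.
pose e1 := Num.min (2^-1) (e * cabs w / 2).
have e10 : 0 < e1 by rewrite lt_min invr_gt0 ltr0n/= divr_gt0// mulr_gt0.
have e12 : e1 <= 2^-1 by rewrite ge_min lexx.
have e1e : e1 <= e * cabs w / 2 by rewrite ge_min lexx orbT.
have [t t0 ht] := cderiv_cexp (0 : Cx R) e10.
have t20 : 0 < t / 2 by rewrite divr_gt0.
have [s s0 hs] := Log_near rw t20.
exists s => // h /hs[wh0 hk]; set k := Log (w + h) - Log w in hk *.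
pose u := h / w.
have ck : cexp k = 1 + u.
  apply: (mulIf w0); rewrite -{1}(cexp_Log w0) -cexpD subrK cexp_Log//.
  by rewrite mulrDl mul1r divfK.
have := ht k; rewrite add0r cexp0 mul1r ck (_ : 1 + u - 1 - k = u - k); last by ring.
move=> H; have kt : cabs k < t by lra.
have {H} := H kt => H.
have ku : cabs k <= cabs u + e1 * cabs k by have := cabsB u (u - k); rewrite opprB addrC subrK; lra.
have k0 := cabs_ge0 k; have u0 := cabs_ge0 u.
have k2u : cabs k <= 2 * cabs u by nra.
rewrite (mulrC w^-1) -/u cabsBC (le_trans H)//.
apply: (@le_trans _ _ (e1 * (2 * cabs u))); first by rewrite ler_wpM2l// ltW.
rewrite (_ : e1 * _ = (2 * e1 / cabs w) * cabs h); last by rewrite /u cabs_div; ring.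
apply: ler_wpM2r; first exact: cabs_ge0.
rewrite ler_pdivrMr//; lra.
Qed.

Lemma cderiv_Log1B z : cabs z < 1 -> cderiv (fun z : Cx R => Log (1 - z)) z (- (1 - z)^-1).
Proof.
move=> z1; have r1 : 0 < Rez (1 - z).
  by rewrite RezB Rez1; have := Rez_le z; rewrite ler_norml; lra.
have h : cderiv (fun z : Cx R => 1 - z) z (0 - 1).
  by apply: cderivB (cderiv_cst _ _) (cderiv_id _).
have := @cderiv_comp _ (@Log R) (fun z : Cx R => 1 - z) z _ _ (cderiv_Log r1) h.
by rewrite sub0r mulrN1.
Qed.

End LogDeriv.

(** * The Hilbert operator on bounded functions and on the constant 1 *)

Section HilbertHinf.
Context {R : realType}.
Implicit Types (z w h u d : Cx R) (f : Cx R -> Cx R).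

Lemma hilbert_Hinf f : Hinf f -> exists K : R, forall z, cabs z < 1 ->
  exists2 d, cderiv (hilbert f) z d & cabs d <= K / cabs (1 - z).
Proof.
move=> [_ [M fM]].
have [E|nE] := pselect (exists a : (Cx R)^nat, forall z, disc z ->
    series (fun k => a k * z ^+ k) @ \oo --> f z).
  have af : forall z, disc z -> series (fun k => taylor f k * z ^+ k) @ \oo --> f z.
    rewrite /taylor; case: xgetP => [a _ //|ne]; case: E => a ha.
    by have := ne a.
  exists (9 * M) => z z1; exact: (hilbert_deriv_bound af fM z1).
(* The default branch of [taylor]: all coefficients are 0, and the bound is that of the zero
   function with [M = 0]. *)
have t0 : taylor f = (fun=> 0).
  by rewrite /taylor; case: xgetP => [a _ ha|//]; case: nE; exists a.
exists (9 * 0) => z z1; rewrite -/(psum _).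
have h0 : forall z : Cx R, cabs z < 1 -> series (fun k => taylor f k * z ^+ k) @ \oo --> (0 : Cx R).
  move=> w _; apply/ccvgP => e e0; exists 0%N => n _.
  by rewrite t0 seriesEnat /= big1 ?subrr ?cabs0 ?ltW// => k _; rewrite mul0r.
have h1 : forall z : Cx R, cabs z < 1 -> cabs (0 : Cx R) <= 0 by move=> *; rewrite cabs0.
exact: (@hilbert_deriv_bound R (taylor f) (fun=> 0) 0 z h0 h1 z1).
Qed.

Lemma Hinf_cst (c : Cx R) : Hinf (fun=> c).
Proof.
split; last by exists (cabs c).
by move=> z _; apply: cderiv_derivable (cderiv_cst c z).
Qed.

(** The constant 1 is the test function for the operator; its image is the sum of z^n / (n + 1),
    that is - log (1 - z) / z. *)
Lemma hilbert_cst1 z : cabs z < 1 ->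
  exists2 d, cderiv (hilbert (fun=> 1)) z d & 4^-1 / cabs (1 - z) <= cabs d.
Proof.
move=> z1; pose f : Cx R -> Cx R := fun=> 1.
have af : forall z, disc z -> series (fun k => taylor f k * z ^+ k) @ \oo --> f z.
  rewrite /taylor; case: xgetP => [a _ //|ne].
  have := ne (fun k => if k is 0%N then 1 else 0); case => w _.
  apply/ccvgP => e e0; exists 1%N => -[//|n] _.
  rewrite seriesEnat /= big_nat_recl//= expr0 mulr1 big1 ?addr0 ?subrr ?cabs0 ?ltW//.
  by move=> k _; rewrite mul0r.
set a := taylor f in af.
have a0 : a 0%N = 1.
  have d0 : disc (0 : Cx R) by rewrite /disc /mkset cabs0.
  have h := af 0 d0.
  apply: (ccvg_unique (u := series (fun k => a k * 0 ^+ k)) _ h).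
  apply/ccvgP => e e0; exists 1%N => -[//|n] _.
  rewrite seriesEnat /= big_nat_recl//= expr0 mulr1 big1 ?addr0 ?subrr ?cabs0 ?ltW//.
  by move=> k _; rewrite exprS mul0r mulr0.
have f1 : forall z : Cx R, cabs z < 1 -> cabs (f z) <= 1 by move=> *; rewrite cabs1.
(* The coefficient [a 0 = 1] already exhausts the bound 1 in Parseval's inequality, so all others
   vanish; this identifies the sequence chosen by [xget]. *)
have aS k : a k.+1 = 0.
  have := parseval_le k.+2 af f1.
  rewrite big_nat_recl//= a0 cabs1 expr1n -[leRHS]addr0 lerD2l => h.
  have : cabs (a k.+1) ^+ 2 <= 0.
    apply: le_trans h; rewrite big_nat_recr//= lerDr sumr_ge0// => i _; exact: sqr_ge0.
  by rewrite exprn_even_le0//= cabs_eq0 => /eqP.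
have hc n : hcoef a n = n.+1%:R^-1.
  apply: ccvg_limn; apply/ccvgP => e e0; exists 1%N => -[//|m] _.
  rewrite seriesEnat /= big_nat_recl//= a0 mul1r add0n addn1 big1 ?addr0 ?subrr ?cabs0 ?ltW//.
  by move=> k _; rewrite aS mul0r.
have cB n : cabs (hcoef a n) <= 1.
  by rewrite hc cabsV -RC_nat cabs_RC ger0_norm// invf_le1 ?ltr0n// ler1n.
have [d hd cd] := psum_cderiv cB z1.
exists d => //.
have hd' : series (fun n => n%:R * n.+1%:R^-1 * z ^+ n.-1) @ \oo --> d.
  by move: hd; rewrite (_ : hcoef a = (fun n => n.+1%:R^-1))//; apply/funext => n; exact: hc.
have := hilbert_one_lower z1 hd'.
have dz : 0 < cabs (1 - z) by have := cabs_ge_sub 1 z; rewrite cabs1; lra.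
have := Rez_le ((1 - z) * d); rewrite ler_norml cabsM => /andP[_ h1] h2.
by rewrite ler_pdivrMr// mulrC; lra.
Qed.
End HilbertHinf.

(** * Monotonicity of integrals, and measurability of complex functions by coordinates *)

Section NonMeasurable.
Local Open Scope ereal_scope.
Context d (T : measurableType d) (R : realType).
Variable mu : {measure set T -> \bar R}.

(* No measurability is needed: the integral of a nonnegative function is a
   supremum over the simple functions below it. *)
Lemma ge0_le_integral_nomeas (D : set T) (f g : T -> \bar R) :
  (forall x, D x -> 0 <= f x) -> (forall x, D x -> f x <= g x) ->
  \int[mu]_(x in D) f x <= \int[mu]_(x in D) g x.
Proof.
move=> f0 fg; have g0 x : D x -> 0 <= g x by move=> Dx; exact: le_trans (f0 x Dx) (fg x Dx).
rewrite !ge0_integralE//; apply: ereal_sup_le => _ [h hf <-]; exists h => //= x.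
apply: le_trans (hf x) _; rewrite /patch; case: ifPn => // /set_mem; exact: fg.
Qed.

End NonMeasurable.

Section ComplexMeasurable.
Context d (T : measurableType d) (R : realType).
Implicit Types (f g : T -> Cx R).

Definition cmeas f := measurable_fun setT (fun x => Rez (f x)) /\
  measurable_fun setT (fun x => Imz (f x)).

Lemma measurable_inv_real (f : T -> R) : measurable_fun setT f ->
  measurable_fun setT (fun x => (f x)^-1).
Proof.
(* [powR] with exponent -1 is the inverse on nonnegative numbers, hence the detour through the
   square; at 0 both sides are 0. *)
move=> mf; rewrite (_ : (fun x => (f x)^-1) = (fun x => f x * ((f x ^+ 2) `^ (-1)))).
  apply: measurable_funM => //.
  by apply: (measurableT_comp (measurable_powR _)); exact: measurable_funX.
apply/funext => x; rewrite powR_inv1 ?sqr_ge0//.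
have [->|x0] := eqVneq (f x) 0; first by rewrite invr0 mul0r.
by rewrite expr2 invfM mulrA divff// mul1r.
Qed.

Lemma cmeas_cst c : cmeas (fun=> c).
Proof. by split; exact: measurable_cst. Qed.

Lemma cmeasD f g : cmeas f -> cmeas g -> cmeas (fun x => f x + g x).
Proof.
move=> [f1 f2] [g1 g2]; split.
  by rewrite (_ : (fun _ => _) = (fun x => Rez (f x) + Rez (g x))); [exact: measurable_funD|apply/funext => x; rewrite RezD].
by rewrite (_ : (fun _ => _) = (fun x => Imz (f x) + Imz (g x))); [exact: measurable_funD|apply/funext => x; rewrite ImzD].
Qed.

Lemma cmeasM f g : cmeas f -> cmeas g -> cmeas (fun x => f x * g x).
Proof.
move=> [f1 f2] [g1 g2]; split.
  rewrite (_ : (fun _ => _) = (fun x => Rez (f x) * Rez (g x) - Imz (f x) * Imz (g x))); last by apply/funext => x; rewrite RezM.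
  by apply: measurable_funB; exact: measurable_funM.
rewrite (_ : (fun _ => _) = (fun x => Rez (f x) * Imz (g x) + Imz (f x) * Rez (g x))); last by apply/funext => x; rewrite ImzM.
by apply: measurable_funD; exact: measurable_funM.
Qed.

Lemma cmeas_conj f : cmeas f -> cmeas (fun x => cconj (f x)).
Proof.
move=> [f1 f2]; split.
  by rewrite (_ : (fun _ => _) = (fun x => Rez (f x))) //; apply/funext => x; rewrite RezC.
rewrite (_ : (fun _ => _) = (fun x => - Imz (f x))); last by apply/funext => x; rewrite ImzC.
exact: measurableT_comp.
Qed.

Lemma cmeas_RC (f : T -> R) : measurable_fun setT f -> cmeas (fun x => RC (f x)).
Proof. by move=> mf; split => //; exact: measurable_cst. Qed.

Lemma measurable_cabs2 f : cmeas f -> measurable_fun setT (fun x => cabs (f x) ^+ 2).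
Proof.
move=> [f1 f2]; rewrite (_ : (fun _ => _) = (fun x => Rez (f x) ^+ 2 + Imz (f x) ^+ 2)).
  by apply: measurable_funD; exact: measurable_funX.
by apply/funext => x; rewrite cabs_sqr.
Qed.

Lemma measurable_cabs f : cmeas f -> measurable_fun setT (fun x => cabs (f x)).
Proof.
move=> mf; rewrite (_ : (fun _ => _) = (fun x => (cabs (f x) ^+ 2) `^ 2^-1)).
  by apply: (measurableT_comp (measurable_powR _)); exact: measurable_cabs2.
apply/funext => x; rewrite powR12_sqrt ?sqr_ge0// sqrtr_sqr ger0_norm//.
exact: cabs_ge0.
Qed.

Lemma cmeasN f : cmeas f -> cmeas (fun x => - f x).
Proof.
move=> mf; rewrite (_ : (fun _ => _) = (fun x => -1 * f x)); last by apply/funext => x; rewrite mulN1r.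
exact: (cmeasM (cmeas_cst _)).
Qed.

Lemma cmeasB f g : cmeas f -> cmeas g -> cmeas (fun x => f x - g x).
Proof. by move=> mf mg; apply: cmeasD => //; exact: cmeasN. Qed.

Lemma cmeasV f : cmeas f -> cmeas (fun x => (f x)^-1).
Proof.
move=> mf; rewrite (_ : (fun _ => _) = (fun x => RC ((cabs (f x) ^+ 2)^-1) * cconj (f x))).
  apply: cmeasM; last exact: cmeas_conj.
  by apply: cmeas_RC; apply: measurable_inv_real; exact: measurable_cabs2.
apply/funext => x; have [->|x0] := eqVneq (f x) 0.
  by rewrite invr0 cconj0 mulr0.
have c0 : cconj (f x) != 0 by rewrite -cabs_eq0 cabs_cconj cabs_eq0.
by rewrite RCV -mul_cconj invfM -mulrA mulVf// mulr1.
Qed.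

Lemma cmeas_div f g : cmeas f -> cmeas g -> cmeas (fun x => f x / g x).
Proof. by move=> mf mg; apply: cmeasM => //; exact: cmeasV. Qed.

End ComplexMeasurable.

(** * Squares in the plane and the dyadic kernel *)

Section Plane.
Context {R : realType}.
Implicit Types (p z w : Cx R) (e r : R).

Lemma cmeas_toC : cmeas (@toC R).
Proof. by split; [exact: measurable_fst|exact: measurable_snd]. Qed.

Lemma cmeas_comp d1 d2 (T1 : measurableType d1) (T2 : measurableType d2)
  (f : T2 -> Cx R) (g : T1 -> T2) : cmeas f -> measurable_fun setT g -> cmeas (fun x => f (g x)).
Proof. by move=> [f1 f2] mg; split; [exact: (measurableT_comp f1)|exact: (measurableT_comp f2)]. Qed.

Lemma measurable_discP : measurable (@discP R).
Proof.
have h : measurable_fun setT (fun w : plane R => cabs (toC w) < 1).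
  apply: measurable_fun_ltr; last exact: measurable_cst.
  exact/measurable_cabs/cmeas_toC.
have := h measurableT [set true] (I : measurable [set true]).
rewrite setTI; congr measurable; apply/seteqP; split => x //=.
Qed.

(** Squares of half-side [r] take the place of discs because their measure is a product of interval
    lengths. *)
Definition insq p r w : bool := (`|Rez w - Rez p| <= r) && (`|Imz w - Imz p| <= r).

Lemma dA_square p r : 0 <= r ->
  measurable [set w : plane R | insq p r (toC w)] /\
  dA R [set w : plane R | insq p r (toC w)] = (4 * r ^+ 2 / pi)%:E.
Proof.
move=> r0.
have E : [set w : plane R | insq p r (toC w)] =
   `[Rez p - r, Rez p + r]%classic `*` `[Imz p - r, Imz p + r]%classic.
  apply/seteqP; split => -[x y] /=; rewrite /insq /Rez /Imz /= !in_itv/= !ler_norml.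
    by move=> /andP[]; lra.
  by move=> [h1 h2]; apply/andP; split; lra.
have m1 (a b : R) : measurable (`[a, b]%classic : set (measurableTypeR R)) by exact: measurable_itv.
split; first by rewrite E; apply: measurableX.
have l (a : R) : lebesgue_measure (`[a - r, a + r]%classic : set (measurableTypeR R)) = (2 * r)%:E.
  rewrite lebesgue_measure_itv/= lte_fin; case: ifPn => h.
    by rewrite -EFinB; congr (_%:E); ring.
  by congr (_%:E); lra.
have dAE (X : set (plane R)) : dA R X =
  ((pi^-1)%:E * (@lebesgue_measure R \x @lebesgue_measure R)%E X)%E by [].
rewrite E dAE product_measure1E//.
rewrite [X in (_ * (X * _))%E](l (Rez p)) [X in (_ * (_ * X))%E](l (Imz p)) -!EFinM.
by congr (_%:E); ring.
Qed.

Local Notation q n := ((2^-1 : R) ^+ n).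

(** Scale [n] of a majorant of 1 / (X max(X, e)^2) with X = |w - p|. The small squares treat
    distances up to [e], where this is 1 / (X e^2), the large ones those beyond, where it is 1 /
    X^3. *)
Definition Sterm p e w (n : nat) : R :=
  (if insq p (e * q n) w then 2 * 2 ^+ n / e ^+ 3 else 0) +
  (if insq p (e * 2 ^+ n.+1) w then q n ^+ 3 / e ^+ 3 else 0).

Definition Skern p e w : \bar R := (\sum_(n <oo) (Sterm p e w n)%:E)%E.

Lemma Sterm_ge0 p e w n : 0 < e -> 0 <= Sterm p e w n.
Proof.
move=> e0; have e3 : 0 < e ^+ 3 by rewrite exprn_gt0.
have h1 : 0 <= 2 * 2 ^+ n / e ^+ 3 by rewrite divr_ge0 ?mulr_ge0 ?exprn_ge0// ltW.
have h2 : 0 <= q n ^+ 3 / e ^+ 3 by rewrite divr_ge0 ?exprn_ge0 ?ltW.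
by rewrite /Sterm addr_ge0//; case: ifP.
Qed.

Lemma Skern_ge0 p e w : 0 < e -> (0 <= Skern p e w)%E.
Proof. by move=> e0; apply: nneseries_ge0 => n _ _; rewrite lee_fin Sterm_ge0. Qed.

Lemma Skern_ge_term p e w n : 0 < e -> ((Sterm p e w n)%:E <= Skern p e w)%E.
Proof.
move=> e0; apply: le_trans (nneseries_lim_ge n.+1 _); last first.
  by move=> k _ _; rewrite lee_fin Sterm_ge0.
rewrite big_nat_recr//= -[leLHS]add0e leeD//.
by apply: sume_ge0 => k _; rewrite lee_fin Sterm_ge0.
Qed.

Lemma dyadic_bracket (x : R) : 0 < x -> x <= 1 -> exists n, q n.+1 < x <= q n.
Proof.
move=> x0 x1.
have ex : exists n, q n < x.
  have := @cvg_expr R 2^-1; rewrite ger0_norm// => /(_ _)/cvgrPdist_lt.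
  have h21 : 2^-1 < 1 :> R by lra.
  move=> /(_ h21 _ x0)[n _ hn]; exists n.
  by have := hn n (leqnn n); rewrite sub0r normrN ger0_norm ?exprn_ge0.
have [[|n] hn hmin] := ex_minnP ex; first by move: hn; rewrite expr0; lra.
exists n; rewrite hn/= leNgt; apply/negP => /hmin; rewrite ltnn//.
Qed.

(** At [w = p] the terms are unbounded and exceed every [y]. Elsewhere one term suffices, at the
    scale that brackets [rho / e] or [e / rho], where [rho] is the distance in the maximum norm. *)
Lemma Skern_lower p e w y : 0 < e ->
  (w != p -> y <= (cabs (w - p) * Num.max (cabs (w - p)) e ^+ 2)^-1) ->
  (y%:E <= Skern p e w)%E.
Proof.
move=> e0 hy; have e3 : 0 < e ^+ 3 by rewrite exprn_gt0.
have [wp|wp] := eqVneq w p.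
  have [n hn] : exists n, q n * (y * e ^+ 3) < 1.
    have [y0|y0] := leP (y * e ^+ 3) 0; first by exists 0%N; rewrite expr0 mul1r; lra.
    have := @dyadic_bracket (Num.min 1 ((y * e ^+ 3)^-1)) _ _.
    rewrite lt_min ltr01 invr_gt0 y0 ge_min lexx => /(_ isT isT)[n /andP[h _]].
    by exists n.+1; move: h; rewrite lt_min => /andP[_]; rewrite -ltr_pdivlMr// div1r.
  apply: le_trans (Skern_ge_term p w n e0); rewrite lee_fin /Sterm.
  have q0 : 0 <= q n by rewrite exprn_ge0.
  have q1 : 0 < q n by rewrite exprn_gt0.
  rewrite /insq wp !subrr normr0 !mulr_ge0 ?exprn_ge0 ?(ltW e0)//=.
  rewrite -[leLHS]addr0 lerD ?divr_ge0 ?exprn_ge0 ?(ltW e0)//.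
  rewrite ler_pdivlMr// -(ler_pM2l q1) (le_trans (ltW hn))//.
  rewrite (_ : q n * (2 * 2 ^+ n) = 2 * (2^-1 * 2) ^+ n); last by rewrite exprMn; ring.
  by rewrite mulVf// expr1n; lra.
have X0 : 0 < cabs (w - p) by rewrite cabs_gt0 subr_eq0.
set X := cabs (w - p) in hy X0.
have {}hy := hy wp.
pose rho := Num.max `|Rez (w - p)| `|Imz (w - p)|.
have rX : rho <= X by rewrite ge_max Rez_le Imz_le.
have r0 : 0 < rho.
  rewrite lt_max; apply/orP; apply: contrapT => /not_orP[/negP + /negP].
  rewrite -!leNgt => h1 h2; have := cabs_le_ReIm (w - p); rewrite -/X; lra.
have insqE r : rho <= r -> insq p r w by rewrite ge_max /insq -RezB -ImzB.
have [re|re] := leP rho e.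
  have [|n /andP[h1 h2]] := @dyadic_bracket (rho / e) (divr_gt0 r0 e0).
    by rewrite ler_pdivrMr// mul1r.
  apply: le_trans (Skern_ge_term p w n e0); rewrite lee_fin /Sterm.
  rewrite insqE; last by rewrite mulrC -ler_pdivrMr.
  have s0 : 0 <= (if insq p (e * 2 ^+ n.+1) w then q n ^+ 3 / e ^+ 3 else 0).
    by case: ifP => // _; rewrite divr_ge0 ?exprn_ge0 ?(ltW e0).
  apply: (le_trans hy); rewrite -[leLHS]addr0 lerD//.
  have m0 : 0 < q n.+1 * e ^+ 3 by rewrite mulr_gt0// exprn_gt0.
  rewrite [leRHS](_ : _ = (q n.+1 * e ^+ 3)^-1); last first.
    by rewrite [RHS]invfM exprVn invrK (exprS 2 n).
  rewrite lef_pV2 ?posrE ?mulr_gt0 ?exprn_gt0 ?lt_max ?e0 ?orbT//.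
  rewrite [e ^+ 3]exprS mulrA ler_pM ?mulr_ge0 ?exprn_ge0 ?(ltW e0)//.
    by rewrite (le_trans _ rX)// -ler_pdivlMr// ltW.
  by rewrite lerXn2r ?nnegrE ?(ltW e0) ?le_max ?lexx ?(ltW e0) ?orbT.
have [||n /andP[h1 h2]] := @dyadic_bracket (e / rho); first exact: divr_gt0.
  by rewrite ler_pdivrMr// mul1r ltW.
have rE : rho <= e * 2 ^+ n.+1.
  move: h1; rewrite ltr_pdivlMr// exprVn mulrC ltr_pdivrMr ?exprn_gt0//; exact: ltW.
apply: le_trans (Skern_ge_term p w n e0); rewrite lee_fin /Sterm.
rewrite (insqE _ rE).
have s0 : 0 <= (if insq p (e * q n) w then 2 * 2 ^+ n / e ^+ 3 else 0).
  by case: ifP => // _; rewrite divr_ge0 ?mulr_ge0 ?exprn_ge0 ?(ltW e0).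
apply: (le_trans hy); rewrite -[leLHS]add0r lerD//.
have M0 : rho ^+ 3 <= X * Num.max X e ^+ 2.
  rewrite exprS ler_pM ?exprn_ge0 ?(ltW r0)//.
  have rm : rho <= Num.max X e by rewrite le_max rX.
  by apply: lerXn2r rm; rewrite nnegrE ?(ltW r0)// (le_trans (ltW r0))// le_max rX.
apply: (@le_trans _ _ (rho ^+ 3)^-1).
  have r30 : 0 < rho ^+ 3 by rewrite exprn_gt0.
  by have r31 := lt_le_trans r30 M0; rewrite lef_pV2 ?posrE.
rewrite -expr_div_n -exprVn.
apply: lerXn2r; rewrite ?nnegrE ?invr_ge0 ?divr_ge0 ?exprn_ge0 ?(ltW e0) ?(ltW r0)//.
by rewrite ler_pdivlMr// mulrC.
Qed.

Lemma measurable_Skern d (T : measurableType d) (p w : T -> Cx R) (e : T -> R) :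
  cmeas p -> cmeas w -> measurable_fun setT e -> (forall x, 0 < e x) ->
  measurable_fun setT (fun x => Skern (p x) (e x) (w x)).
Proof.
move=> [p1 p2] [w1 w2] me e0.
have mi (r : T -> R) : measurable_fun setT r -> measurable_fun setT (fun x => insq (p x) (r x) (w x)).
  move=> mr; apply: measurable_and; apply: measurable_fun_ler => //.
    by apply: measurableT_comp => //; exact: measurable_funB.
  by apply: measurableT_comp => //; exact: measurable_funB.
have me3 (c : R) : measurable_fun setT (fun x => c / e x ^+ 3).
  apply: measurable_funM; first exact: measurable_cst.
  by apply: measurable_inv_real; exact: measurable_funX.
have := @ge0_emeasurable_sum _ T R setT (fun n x => (Sterm (p x) (e x) (w x) n)%:E) xpredT.
rewrite /Skern; apply.
  by move=> k x _ _; rewrite lee_fin Sterm_ge0.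
move=> n _; apply/measurable_EFinP; apply: measurable_funD.
  apply: measurable_fun_if => //.
  - by apply: mi; apply: measurable_funM => //; exact: measurable_cst.
  - by apply: measurable_funTS; exact: me3.
apply: measurable_fun_if => //.
- by apply: mi; apply: measurable_funM => //; exact: measurable_cst.
- by apply: measurable_funTS; exact: me3.
Qed.

Lemma integral_insq p (c r : R) : 0 <= r -> 0 <= c ->
  (\int[@dA R]_w (if insq p r (toC w) then c else 0)%:E = (c * (4 * r ^+ 2 / pi))%:E)%E.
Proof.
move=> r0 c0; have [mA dAE] := dA_square p r0.
rewrite (eq_integral (fun x => (c%:E * (\1_[set w : plane R | insq p r (toC w)] x)%:E)%E)); last first.
  move=> w _; rewrite indicE.
  have -> : (w \in [set w : plane R | insq p r (toC w)]) = insq p r (toC w).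
    by apply/idP/idP => [/set_mem//|h]; exact/mem_set.
  by case: (insq p r (toC w)); rewrite /= -EFinM ?mulr1 ?mulr0.
rewrite ge0_integralZl_EFin//.
  by rewrite integral_indic// setIT dAE.
exact/measurable_EFinP.
Qed.

Lemma measurable_insq p (r c : R) :
  measurable_fun setT (fun w : plane R => if insq p r (toC w) then c else 0).
Proof.
apply: measurable_fun_if => //; apply: measurable_and; apply: measurable_fun_ler;
do ?[exact: measurable_cst]; apply: measurableT_comp => //; apply: measurable_funB;
do ?[exact: measurable_cst]; first [exact: measurable_fst|exact: measurable_snd].
Qed.

(** Scale [n] contributes 8 q^n / (pi e) from its small square and 16 q^n / (pi e) from its large
    one, where q = 1/2; summing over [n] doubles 24 to 48. *)
Lemma integral_Skern p e : 0 < e ->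
  (\int[@dA R]_w Skern p e (toC w) <= (48 / (pi * e))%:E)%E.
Proof.
move=> e0; have pi0 : 0 < pi :> R by exact: pi_gt0.
have mS n : measurable_fun setT (fun w : plane R => (Sterm p e (toC w) n)%:E).
  by apply/measurable_EFinP; apply: measurable_funD; exact: measurable_insq.
rewrite /Skern integral_nneseries//; last by move=> n w _; rewrite lee_fin Sterm_ge0.
have term n : (\int[@dA R]_w (Sterm p e (toC w) n)%:E = (24 / (pi * e) * q n)%:E)%E.
  have qn : 0 < q n by rewrite exprn_gt0.
  have q2 : 2 ^+ n * q n = 1 :> R by rewrite -exprMn divff// expr1n.
  rewrite /Sterm; under eq_integral do rewrite EFinD.
  rewrite ge0_integralD//=; last 4 first.
  - by move=> w _; case: ifP => // _; rewrite lee_fin divr_ge0 ?mulr_ge0 ?exprn_ge0 ?(ltW e0).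
  - by apply/measurable_EFinP; exact: measurable_insq.
  - by move=> w _; case: ifP => // _; rewrite lee_fin divr_ge0 ?exprn_ge0 ?(ltW e0).
  - by apply/measurable_EFinP; exact: measurable_insq.
  have e3 : 0 <= e ^+ 3 by rewrite exprn_ge0 ?ltW.
  rewrite !integral_insq ?mulr_ge0 ?divr_ge0 ?mulr_ge0 ?exprn_ge0 ?invr_ge0 ?(ltW e0)//.
  rewrite -EFinD; congr (_%:E); rewrite (exprS (2 : R) n).
  have -> : (2 : R) ^+ n = (q n)^-1 by rewrite exprVn invrK.
  move: (q n) qn (@pi R) pi0 => y y0 P P0; field.
  by rewrite !gt_eqF.
apply: lime_le.
  by apply: is_cvg_nneseries => n _ _; apply: integral_ge0 => w _; rewrite lee_fin Sterm_ge0.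
apply: nearW => N; rewrite (eq_bigr (fun n => (24 / (pi * e) * q n)%:E)); last by move=> n _; exact: term.
rewrite sumEFin lee_fin -mulr_sumr.
have h : \sum_(0 <= i < N) q i = 2 - 2 * q N.
  elim: N => [|N ih]; first by rewrite big_nil expr0; ring.
  by rewrite big_nat_recr//= ih exprS; field.
rewrite h (_ : 48 / (pi * e) = 24 / (pi * e) * 2); last by ring.
rewrite ler_wpM2l ?divr_ge0 ?mulr_ge0 ?(ltW e0) ?(ltW pi0)//.
by rewrite gerBl mulr_ge0 ?exprn_ge0.
Qed.

End Plane.

(** * Pointwise estimates of kernels and Green functions *)

Section Pointwise.
Context {R : realType}.
Implicit Types (p b z w a l : Cx R) (e y : R).

Lemma one_sub_sqr_ge0 z : cabs z < 1 -> 0 < 1 - cabs z ^+ 2.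
Proof. by move=> z1; rewrite subr_gt0 expr_lt1// cabs_ge0. Qed.

Lemma cabs_1subC z w : cabs (1 - cconj z * w) = cabs (1 - cconj w * z).
Proof. by rewrite -cabs_cconj cconjB cconj1 cconjM cconjK mulrC. Qed.

(** Meant for X = |w - p|, Y = |w - b|, Z = |1 - conj b w|, N = 1 - |w|^2 and e = |p - b| / 2. The
    smaller of X and Y is the distance to the nearer singularity, and the other one is at least
    [e]. *)
Lemma kernel_real (X Y Z N e : R) : 0 < X -> 0 < Y -> Y <= Z -> 0 <= N -> N <= 2 * X -> N <= 2 * Z ->
  0 < e -> 2 * e <= X + Y ->
  N / (X ^+ 2 * Z * Y) <= (if X <= Y then 2 * (X * Num.max X e ^+ 2)^-1 else 2 * (Y * Num.max Y e ^+ 2)^-1).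
Proof.
move=> X0 Y0 YZ N0 NX NZ e0 eXY; have Z0 : 0 < Z by lra.
case: ifPn => XY.
  have m0 : 0 < Num.max X e by rewrite lt_max X0.
  have mY : Num.max X e <= Y by rewrite ge_max XY; lra.
  apply: (@le_trans _ _ (2 * X / (X ^+ 2 * Z * Y))).
    by rewrite ler_wpM2r// invr_ge0 !mulr_ge0 ?exprn_ge0 ?ltW.
  rewrite (_ : 2 * X / _ = 2 * (X * (Z * Y))^-1); last by field; rewrite !gt_eqF.
  rewrite ler_pM2l// lef_pV2 ?posrE ?mulr_gt0 ?exprn_gt0// ler_pM2l// expr2.
  by apply: ler_pM => //; [exact: ltW|exact: ltW|exact: le_trans mY YZ].
rewrite -ltNge in XY.
have m0 : 0 < Num.max Y e by rewrite lt_max Y0.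
have mX : Num.max Y e <= X by rewrite ge_max (ltW XY); lra.
apply: (@le_trans _ _ (2 * Z / (X ^+ 2 * Z * Y))).
  by rewrite ler_wpM2r// invr_ge0 !mulr_ge0 ?exprn_ge0 ?ltW.
rewrite (_ : 2 * Z / _ = 2 * (Y * X ^+ 2)^-1); last by field; rewrite !gt_eqF.
rewrite ler_pM2l// lef_pV2 ?posrE ?mulr_gt0 ?exprn_gt0// ler_pM2l//.
by apply: lerXn2r mX; rewrite nnegrE ltW.
Qed.

(** At [w = b] every nonnegative [y] is allowed, so the right-hand side is infinite there and
    dominates a Green function at its pole as well. *)
Lemma kernel_Skern p b w y : cabs w < 1 -> cabs p = 1 -> cabs b < 1 -> 0 <= y ->
  (w != b -> y <= (1 - cabs w ^+ 2) / (cabs (w - p) ^+ 2 * cabs (1 - cconj b * w) * cabs (w - b))) ->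
  (y%:E <= 2%:E * (Skern p (cabs (p - b) / 2) w + Skern b (cabs (p - b) / 2) w))%E.
Proof.
move=> w1 p1 b1 y0 hy.
set e := cabs (p - b) / 2.
have pb : 0 < cabs (p - b) by have := cabs_ge_sub p b; lra.
have e0 : 0 < e by rewrite divr_gt0.
have wp : 0 < cabs (w - p) by have := cabs_ge_sub p w; rewrite cabsBC; lra.
have N0 := one_sub_sqr_ge0 w1.
have Nw : 1 - cabs w ^+ 2 <= 2 * (1 - cabs w) by have := cabs_ge0 w; nra.
have NX : 1 - cabs w ^+ 2 <= 2 * cabs (w - p).
  by have := cabs_ge_sub p w; rewrite cabsBC p1; lra.
have NZ : 1 - cabs w ^+ 2 <= 2 * cabs (1 - cconj b * w).
  have := cabs_ge_sub 1 (cconj b * w); rewrite cabs1 cabsM cabs_cconj.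
  by have := cabs_ge0 w; have := cabs_ge0 b; nra.
have YZ : cabs (w - b) <= cabs (1 - cconj b * w).
  rewrite -(@ler_pXn2r _ 2) ?nnegrE ?cabs_ge0// -subr_ge0 moebius_norm.
  by rewrite mulr_ge0// ltW// one_sub_sqr_ge0.
have eXY : 2 * e <= cabs (w - p) + cabs (w - b).
  rewrite /e mulrC divfK// (_ : p - b = (w - b) - (w - p)); last by ring.
  by rewrite (le_trans (cabsB _ _))// addrC.
have [S1 S2] := (Skern_ge0 p w e0, Skern_ge0 b w e0).
have yE : y%:E = (2%:E * (y / 2)%:E)%E by rewrite -EFinM; congr (_%:E); field.
rewrite yE; apply: lee_wpmul2l; first by rewrite lee_fin.
have key : w != b -> y / 2 <= (if cabs (w - p) <= cabs (w - b)
    then (cabs (w - p) * Num.max (cabs (w - p)) e ^+ 2)^-1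
    else (cabs (w - b) * Num.max (cabs (w - b)) e ^+ 2)^-1).
  move=> wb; have Y0 : 0 < cabs (w - b) by rewrite cabs_gt0 subr_eq0.
  have := kernel_real wp Y0 YZ (ltW N0) NX NZ e0 eXY.
  by case: ifP => _ h; rewrite ler_pdivrMr// mulrC (le_trans (hy wb)).
have [XY|XY] := boolP (cabs (w - p) <= cabs (w - b)).
  apply: (@le_trans _ _ (Skern p e w)); last by rewrite leeDl.
  have wb : w != b by apply/eqP => E; move: XY; rewrite E subrr cabs0 cabsBC; lra.
  by apply: Skern_lower => // _; have := key wb; rewrite XY.
apply: (@le_trans _ _ (Skern b e w)); last by rewrite leeDr.
by apply: Skern_lower => // wb; have := key wb; rewrite (negbTE XY).
Qed.

Lemma one_sub_sigma z w : cabs z < 1 -> cabs w < 1 ->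
  1 - cabs (sigma z w) ^+ 2 = (1 - cabs z ^+ 2) * (1 - cabs w ^+ 2) / cabs (1 - cconj z * w) ^+ 2.
Proof.
move=> z1 w1; have n0 : 0 < cabs (1 - cconj z * w) by rewrite cabs_gt0 one_sub_neq0// ltW.
rewrite /sigma cabs_div expr_div_n (cabsBC z) -moebius_norm mulrBl divff//.
by rewrite gt_eqF// exprn_gt0.
Qed.

Lemma one_sub_sigma_ge0 z w : cabs z < 1 -> cabs w < 1 -> 0 <= 1 - cabs (sigma z w) ^+ 2.
Proof.
move=> z1 w1; rewrite one_sub_sigma// divr_ge0 ?exprn_ge0 ?cabs_ge0// mulr_ge0// ltW// one_sub_sqr_ge0//.
Qed.

(** The form suits [x = Z / Y]: then [x - x^-1] is [(Z ^+ 2 - Y ^+ 2) / (Z * Y)], whose numerator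
    [moebius_norm] factors. *)
Lemma ln_le_sub_inv (x : R) : 1 <= x -> ln x <= x - x^-1.
Proof.
move=> x1; have x0 : 0 < x by lra.
have h : ln x <= x - 1.
  have := expR_ge1Dx (ln x); rewrite lnK ?posrE//; lra.
apply: (le_trans h); rewrite lerB// invf_le1//.
Qed.

Lemma green_le z w (Y Z : R) : 0 < Y -> Y <= Z -> z != w ->
  cabs (1 - cconj w * z) / cabs (z - w) = Z / Y ->
  (green z w <= (2 * ((Z ^+ 2 - Y ^+ 2) / (Z * Y)))%:E)%E.
Proof.
move=> Y0 YZ zw E; have Z0 : 0 < Z by lra.
rewrite /green (negbTE zw) lee_fin cabs_div E.
have yz1 : 1 <= Z / Y by rewrite ler_pdivlMr// mul1r.
have yz0 : 0 < Z / Y by rewrite divr_gt0.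
have -> : ln ((Z / Y) ^+ 2) = 2 * ln (Z / Y) by rewrite expr2 lnM ?posrE//; ring.
rewrite ler_pM2l//.
apply: (le_trans (ln_le_sub_inv yz1)); apply: le_of_eq.
by field; rewrite !gt_eqF.
Qed.

(** With [s = cabs (sigma z w) ^+ 2] this is [1 - s <= - ln s]. *)
Lemma green_ge z w : cabs z < 1 -> cabs w < 1 -> ((1 - cabs (sigma z w) ^+ 2)%:E <= green z w)%E.
Proof.
move=> z1 w1; rewrite /green; case: eqP => [_|/eqP zw]; first by rewrite leey.
rewrite lee_fin.
have n0 : 0 < cabs (1 - cconj z * w) by rewrite cabs_gt0 one_sub_neq0// ltW.
have d0 : 0 < cabs (z - w) by rewrite cabs_gt0 subr_eq0.
have s0 : 0 < cabs (sigma z w) ^+ 2 by rewrite exprn_gt0// /sigma cabs_div divr_gt0.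
have -> : cabs ((1 - cconj w * z) / (z - w)) ^+ 2 = (cabs (sigma z w) ^+ 2)^-1.
  by rewrite /sigma !cabs_div -exprVn invf_div cabs_1subC.
rewrite lnV ?posrE//.
have := expR_ge1Dx (ln (cabs (sigma z w) ^+ 2)); rewrite lnK ?posrE//; lra.
Qed.

Lemma green_ge0 z w : cabs z < 1 -> cabs w < 1 -> (0 <= green z w)%E.
Proof.
by move=> z1 w1; apply: le_trans (green_ge z1 w1); rewrite lee_fin one_sub_sigma_ge0.
Qed.

(** Replaces an interior parameter by its radial projection to the circle: the displacement is at
    most [1 - r], which is itself at most [cabs (1 - RC r * l * z)]. *)
Lemma radial_bound (r : R) l z : 0 <= r <= 1 -> cabs l = 1 -> cabs z < 1 ->
  cabs (1 - l * z) <= 2 * cabs (1 - RC r * l * z).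
Proof.
move=> /andP[r0 r1] l1 z1.
rewrite (_ : 1 - l * z = (1 - RC r * l * z) - RC (1 - r) * (l * z)); last by rewrite RCB RC1; ring.
rewrite (le_trans (cabsB _ _))// !cabsM cabs_RC l1 ger0_norm ?subr_ge0// mul1r.
have := cabs_ge_sub 1 (RC r * l * z); rewrite cabs1 !cabsM cabs_RC l1 ger0_norm//.
have := cabs_ge0 z; nra.
Qed.

Lemma polar_form a : exists2 l, cabs l = 1 & a = RC (cabs a) * l.
Proof.
have [->|a0] := eqVneq a 0; first by exists 1; rewrite ?cabs1// cabs0 mul0r.
have c0 : cabs a != 0 by rewrite cabs_eq0.
exists (a / RC (cabs a)).
  by rewrite cabs_div cabs_RC ger0_norm ?cabs_ge0// divff.
by rewrite mulrC divfK// RC_eq0.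
Qed.

(** The factor of [cabs (z - w)] reappears in [mob_1sub] and cancels in the Green function, which is
    therefore Moebius invariant. *)
Lemma mob_sub a z w : cabs a < 1 -> cabs z < 1 -> cabs w < 1 ->
  cabs (mob a z - mob a w) = cabs (z - w) * (1 - cabs a ^+ 2) / (cabs (1 - cconj a * z) * cabs (1 - cconj a * w)).
Proof.
move=> a1 z1 w1.
have n1 := one_sub_neq0 a1 (ltW z1); have n2 := one_sub_neq0 a1 (ltW w1).
rewrite -[1 - cabs a ^+ 2]ger0_norm ?(ltW (one_sub_sqr_ge0 a1))// -cabs_RC -!cabsM -cabs_div.
congr cabs; rewrite RCB RC1 -mul_cconj /mob.
move: (cconj a) n1 n2 => a' n1 n2; by field; rewrite n1 n2.
Qed.

Lemma mob_1sub a z w : cabs a < 1 -> cabs z < 1 -> cabs w < 1 ->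
  cabs (1 - cconj (mob a w) * mob a z) =
  cabs (1 - cconj w * z) * (1 - cabs a ^+ 2) / (cabs (1 - cconj a * z) * cabs (1 - cconj a * w)).
Proof.
move=> a1 z1 w1.
have n1 := one_sub_neq0 a1 (ltW z1); have n2 := one_sub_neq0 a1 (ltW w1).
have n3 : 1 - a * cconj w != 0.
  by rewrite -cabs_eq0 -cabs_cconj cconjB cconj1 cconjM cconjK cabs_eq0.
have -> : cabs (1 - cconj a * w) = cabs (1 - a * cconj w).
  by rewrite -cabs_cconj cconjB cconj1 cconjM cconjK.
rewrite -[1 - cabs a ^+ 2]ger0_norm ?(ltW (one_sub_sqr_ge0 a1))// -cabs_RC -!cabsM -cabs_div.
congr cabs; rewrite RCB RC1 -mul_cconj /mob cconjM cconj_inv !cconjB cconj1 cconjM cconjK.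
move: (cconj a) (cconj w) n1 n3 => a' w' n1 n3; by field; rewrite n1 n3.
Qed.

Lemma one_sub_mob a z : cabs a < 1 -> cabs z < 1 ->
  1 - cabs (mob a z) ^+ 2 = (1 - cabs a ^+ 2) * (1 - cabs z ^+ 2) / cabs (1 - cconj a * z) ^+ 2.
Proof.
move=> a1 z1; have n0 : 0 < cabs (1 - cconj a * z) by rewrite cabs_gt0 one_sub_neq0// ltW.
rewrite /mob cabs_div expr_div_n -moebius_norm mulrBl divff//.
by rewrite gt_eqF// exprn_gt0.
Qed.

(* With [c' := cconj c], the inverse of [c * mob beta] is [mob (- beta) \o (c' * _)];
   [eta] is the preimage of 1 under it, reflected in the circle. *)
Lemma inverse_bound beta c : cabs beta < 1 -> cabs c = 1 ->
  exists a eta, [/\ cabs a < 1, cabs eta = 1 & forall z, cabs z < 1 ->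
    (1 - cabs (mob (- beta) (cconj c * z)) ^+ 2) / cabs (1 - mob (- beta) (cconj c * z)) <=
    4 * (1 - cabs z ^+ 2) * ((cabs (1 - a * z))^-1 + (cabs (1 - eta * z))^-1)].
Proof.
move=> b1 c1.
pose b' := cconj beta; pose c' := cconj c.
have c1' : cabs c' = 1 by rewrite cabs_cconj.
have b1' : cabs b' < 1 by rewrite cabs_cconj.
have nb : 1 - beta != 0.
  by rewrite subr_eq0; apply/eqP => E; move: b1; rewrite -E cabs1 ltxx.
have nbp : 0 < cabs (1 - beta) by rewrite cabs_gt0.
pose a := - (b' * c'); pose eta := c' * (1 - b') / (1 - beta).
have a1 : cabs a < 1 by rewrite cabsN cabsM c1' mulr1.
have e1 : cabs eta = 1.
  rewrite cabs_div cabsM c1' mul1r (_ : 1 - b' = cconj (1 - beta)).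
    by rewrite cabs_cconj divff// gt_eqF.
  by rewrite cconjB cconj1.
have ea : cabs (eta - a) = (1 - cabs beta ^+ 2) / cabs (1 - beta).
  rewrite (_ : eta - a = c' * (RC (1 - cabs beta ^+ 2) / (1 - beta))).
    by rewrite cabsM c1' mul1r cabs_div cabs_RC ger0_norm// ltW// one_sub_sqr_ge0.
  by rewrite RCB RC1 -mul_cconj /eta /a -/b'; field.
exists a, eta; split => // z z1.
have cz : cabs (cconj c * z) < 1 by rewrite cabsM cabs_cconj c1 mul1r.
have bN : cabs (- beta) < 1 by rewrite cabsN.
rewrite one_sub_mob// cabsN cconjN -/b' -/c' [cabs (c' * z)]cabsM c1' mul1r.
have E1 : 1 - - b' * (c' * z) = 1 - a * z by rewrite /a; ring.
have az0 : 0 < cabs (1 - a * z).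
  have := cabs_ge_sub 1 (a * z); rewrite cabs1 cabsM; have := cabs_ge0 z; have := cabs_ge0 a; nra.
have ez0 : 0 < cabs (1 - eta * z).
  have := cabs_ge_sub 1 (eta * z); rewrite cabs1 cabsM e1 mul1r; lra.
have azn : 1 - a * z != 0 by rewrite -cabs_gt0.
have E2 : 1 - mob (- beta) (c' * z) = (1 - beta) * (1 - eta * z) / (1 - a * z).
  rewrite /mob cconjN -/b' E1; apply: (mulIf azn); rewrite mulrBl !divfK// mul1r.
  by rewrite /eta /a; field.
rewrite E1 E2 cabs_div cabsM.
set N := 1 - cabs z ^+ 2; have N0 : 0 < N by exact: one_sub_sqr_ge0.
rewrite (_ : _ / _ = cabs (eta - a) * N / (cabs (1 - a * z) * cabs (1 - eta * z))); last first.
  rewrite ea; field; by rewrite !gt_eqF.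
set A := cabs (1 - a * z) in az0 *; set B := cabs (1 - eta * z) in ez0 *.
rewrite ler_pdivrMr ?mulr_gt0//.
rewrite (_ : 4 * N * (A^-1 + B^-1) * (A * B) = N * (4 * (A + B))); last first.
  by field; rewrite !gt_eqF.
rewrite mulrC ler_pM2l//.
(* For [cabs z >= 1 / 2], writing [(eta - a) * z] as a difference of the two denominators separates
   the poles; for smaller [z], [B >= 1 / 2] and [cabs (eta - a) <= 2] suffice. *)
have [zh|zh] := leP (1 / 2) (cabs z).
  have : cabs (eta - a) * cabs z <= A + B.
    rewrite -cabsM (_ : (eta - a) * z = (1 - a * z) - (1 - eta * z)); last by ring.
    exact: cabsB.
  have := cabs_ge0 (eta - a); nra.
have : cabs (eta - a) <= 2 by rewrite (le_trans (cabsB _ _))// e1; lra.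
have : 1 / 2 <= B by have := cabs_ge_sub 1 (eta * z); rewrite cabs1 cabsM e1 mul1r -/B; lra.
lra.
Qed.

(** The centre is [z0] pulled towards the origin, far enough for 1 - |z|^2 >= d / 8 on the square,
    and little enough for |1 - a z| <= 2 d and |1 - conj z0 z| <= 3 d; hence 288 = 8 * 4 * 9. *)
Lemma lower_kernel a z0 : cabs a <= 1 -> cabs z0 < 1 ->
  let d := cabs (1 - a * z0) in forall z, insq (RC (1 - d / 4) * z0) (d / 16) z ->
  cabs z < 1 /\ (288 * d ^+ 3)^-1 <= (1 - cabs z ^+ 2) / (cabs (1 - a * z) ^+ 2 * cabs (1 - cconj z0 * z) ^+ 2).
Proof.
move=> a1 z01 d z hz.
have a0 := cabs_ge0 a; have z00 := cabs_ge0 z0.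
have d1 : 1 - cabs z0 <= d.
  by have := cabs_ge_sub 1 (a * z0); rewrite cabs1 cabsM -/d; nra.
have d0 : 0 < d by lra.
have d2 : d <= 2 by rewrite /d (le_trans (cabsB _ _))// cabs1 cabsM; nra.
have zz : cabs (z - RC (1 - d / 4) * z0) <= d / 8.
  move: hz => /andP[h1 h2]; rewrite (le_trans (cabs_le_ReIm _))// RezB ImzB; lra.
have w0 : cabs (RC (1 - d / 4) * z0) <= 1 - d / 4.
  rewrite cabsM cabs_RC ger0_norm; last by lra.
  nra.
have z1 : cabs z <= 1 - d / 8.
  by have := cabsD (z - RC (1 - d / 4) * z0) (RC (1 - d / 4) * z0); rewrite subrK; lra.
have zz0 : cabs (z0 - z) <= 3 * d / 8.
  rewrite (_ : z0 - z = RC (d / 4) * z0 - (z - RC (1 - d / 4) * z0)); last by rewrite RCB RC1; ring.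
  rewrite (le_trans (cabsB _ _))// cabsM cabs_RC ger0_norm; last by lra.
  nra.
have zl : cabs z < 1 by lra.
split => //.
have N0 : d / 8 <= 1 - cabs z ^+ 2 by have := cabs_ge0 z; nra.
have h1 : cabs (1 - a * z) <= 2 * d.
  rewrite (_ : 1 - a * z = (1 - a * z0) + a * (z0 - z)); last by ring.
  rewrite (le_trans (cabsD _ _))// cabsM -/d; have := cabs_ge0 (z0 - z); nra.
have h2 : cabs (1 - cconj z0 * z) <= 3 * d.
  rewrite (_ : 1 - cconj z0 * z = RC (1 - cabs z0 ^+ 2) + cconj z0 * (z0 - z)); last first.
    by rewrite RCB RC1 -mul_cconj; ring.
  rewrite (le_trans (cabsD _ _))// cabsM cabs_cconj cabs_RC ger0_norm ?(ltW (one_sub_sqr_ge0 z01))//.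
  have := cabs_ge0 (z0 - z); nra.
have p1 : 0 < cabs (1 - cconj z0 * z) by rewrite cabs_gt0 one_sub_neq0// ltW.
have p2 : 0 < cabs (1 - a * z).
  have := cabs_ge_sub 1 (a * z); rewrite cabs1 cabsM; have := cabs_ge0 z; nra.
rewrite ler_pdivlMr ?mulr_gt0 ?exprn_gt0//.
apply: le_trans N0.
rewrite mulrC ler_pdivrMr; last by apply: mulr_gt0; [rewrite ltr0n|exact: exprn_gt0].
apply: (@le_trans _ _ ((2 * d) ^+ 2 * (3 * d) ^+ 2)).
  by apply: ler_pM; rewrite ?exprn_ge0 ?cabs_ge0//; apply: lerXn2r; rewrite ?nnegrE ?cabs_ge0//; lra.
by apply: le_of_eq; field.
Qed.

End Pointwise.

(** * Tonelli's theorem on the disc, with upper and lower bounds *)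

Section Tonelli.
Local Open Scope ereal_scope.
Context {R : realType} (mu : {measure set (plane R) -> \bar R}).
Hypothesis hmu : \int[mu]_(w in @discP R) (1 - cabs (toC w) ^+ 2)%:E < +oo.

Let D := @discP R.
Let mD : measurable D := measurable_discP.
(** The integrability hypothesis concerns the disc only, so it is this restriction that is
    sigma-finite. *)
Definition mu_disc : {measure set (plane R) -> \bar R} := mrestr mu (@measurable_discP R).

Lemma mu_discE (f : plane R -> \bar R) :
  \int[mu]_(x in D) f x = \int[mu_disc]_(x in D) f x.
Proof. by apply: eq_measure_integral => A mA AD; rewrite /= /mrestr setIidl. Qed.

Lemma measurable_defect : measurable_fun setT (fun w : plane R => 1 - cabs (toC w) ^+ 2)%R.
Proof.
apply: measurable_funB; first exact: measurable_cst.
exact/measurable_cabs2/cmeas_toC.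
Qed.

(** Markov's inequality for [1 - cabs (toC w) ^+ 2] bounds the measure of [E n] inside the disc; the
    complement of the disc, null for [mu_disc], completes each set of the cover. *)
Lemma mu_disc_sigma_finite : sigma_finite setT mu_disc.
Proof.
pose E (n : nat) := [set w : plane R | (n.+1%:R^-1 <= 1 - cabs (toC w) ^+ 2)%R].
have mE n : measurable (E n).
  have h : measurable_fun setT (fun w : plane R => n.+1%:R^-1 <= 1 - cabs (toC w) ^+ 2)%R.
    by apply: measurable_fun_ler; [exact: measurable_cst|exact: measurable_defect].
  have := h measurableT [set true] (I : measurable [set true]).
  by rewrite setTI; congr measurable; apply/seteqP; split => x //=.
exists (fun n => E n `|` ~` D).
  apply/seteqP; split => // w _.
  have [wD|wD] := pselect (D w); last by exists 0%N => //; right.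
  have w0 : (0 < 1 - cabs (toC w) ^+ 2)%R by exact: one_sub_sqr_ge0.
  exists (Num.bound (1 - cabs (toC w) ^+ 2)^-1)%R => //; left.
  rewrite /E /= -[leRHS]invrK lef_pV2 ?posrE ?invr_gt0//.
  have := archi_boundP (ltW (_ : (0 < (1 - cabs (toC w) ^+ 2)^-1)%R)).
  rewrite invr_gt0 => /(_ w0) h; rewrite (le_trans (ltW h))// ler_nat//.
move=> n; split; first by apply: measurableU => //; exact: measurableC.
rewrite /= /mrestr setIUl setICl setU0.
have n0 : (0 < n.+1%:R^-1 :> R)%R by rewrite invr_gt0.
have mED : measurable (E n `&` D) by exact: measurableI.
have h : (n.+1%:R^-1)%:E * mu (E n `&` D) <= \int[mu]_(w in D) (1 - cabs (toC w) ^+ 2)%:E.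
  rewrite -(integral_cst mu mED) [leRHS]integral_mkcond [leLHS]integral_mkcond.
  apply: ge0_le_integral_nomeas => w _; rewrite /patch.
    by case: ifP => // _; rewrite lee_fin ltW.
  case: ifPn => [/set_mem[Ew Dw]|_]; first by rewrite mem_set// lee_fin.
  case: ifPn => // /set_mem Dw; rewrite lee_fin ltW//; exact: one_sub_sqr_ge0.
rewrite ltNge leye_eq; apply/negP => /eqP hoo.
move: (le_lt_trans h hmu); rewrite hoo gt0_muley ?lte_fin//.
Qed.

Lemma dA_sigma_finite : sigma_finite setT (dA R).
Proof.
exists (fun n => [set w : plane R | insq 0 n%:R (toC w)]).
  apply/seteqP; split => // w _; exists (Num.bound (cabs (toC w))) => //=.
  have h := ltW (archi_boundP (cabs_ge0 (toC w))).
  by rewrite /insq subr0 subr0 (le_trans (Rez_le _) h) (le_trans (Imz_le _) h).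
move=> n; have [mA dAE] := dA_square (0 : Cx R) (ler0n R n).
by split => //; rewrite dAE ltry.
Qed.

Lemma tonelli_disc (K : plane R * plane R -> \bar R) :
  measurable_fun setT K -> (forall x, 0 <= K x) ->
  \int[dA R]_z \int[mu_disc]_w K (z, w) = \int[mu_disc]_w \int[dA R]_z K (z, w).
Proof.
move=> mK K0.
pose H1 := Measure_isSigmaFinite.Build _ _ _ (dA R) dA_sigma_finite.
pose m1 := HB.pack_for (SigmaFiniteMeasure.type (plane R) R) (Measure.sort (dA R)) H1.
pose H2 := Measure_isSigmaFinite.Build _ _ _ mu_disc mu_disc_sigma_finite.
pose m2 := HB.pack_for (SigmaFiniteMeasure.type (plane R) R) (Measure.sort mu_disc) H2.
exact: (@fubini_tonelli _ _ _ _ R m1 m2 K mK K0).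
Qed.

Lemma ge0_integral_sub_setT (m : {measure set (plane R) -> \bar R}) (A : set (plane R)) (f : plane R -> \bar R) :
  (forall x, 0 <= f x) -> \int[m]_(x in A) f x <= \int[m]_x f x.
Proof.
move=> f0; rewrite integral_mkcond; apply: ge0_le_integral_nomeas => x _.
  by rewrite /patch; case: ifP.
by rewrite /patch; case: ifP.
Qed.

(** [F] stands for an integrand containing [U mu] or [V mu] and is only dominated pointwise; Tonelli
    is applied to the jointly measurable kernel [K]. The 96 is 48 for each of the two [Skern]. *)
Lemma tonelli_upper (F : plane R -> \bar R) (c e : plane R -> R) (p b : plane R -> Cx R) :
  measurable_fun setT c -> measurable_fun setT e -> cmeas p -> cmeas b ->
  (forall w, 0 <= c w)%R -> (forall w, ~ D w -> c w = 0%R) -> (forall w, 0 < e w)%R ->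
  (forall z, D z -> 0 <= F z) ->
  (forall z, D z -> F z <= \int[mu]_(w in D)
     ((c w)%:E * (Skern (p w) (e w) (toC z) + Skern (b w) (e w) (toC z)))) ->
  \int[dA R]_(z in D) F z <= \int[mu]_(w in D) (c w * (96 / (pi * e w)))%:E.
Proof.
move=> mc me mp mb c0 cD e0 F0 hF.
pose K (x : plane R * plane R) := (c x.2)%:E * (Skern (p x.2) (e x.2) (toC x.1) + Skern (b x.2) (e x.2) (toC x.1)).
have K0 x : 0 <= K x.
  by rewrite mule_ge0 ?lee_fin// adde_ge0// Skern_ge0.
have mfst : measurable_fun setT (fst : plane R * plane R -> plane R) by exact: measurable_fst.
have msnd : measurable_fun setT (snd : plane R * plane R -> plane R) by exact: measurable_snd.
have mz : cmeas (fun x : plane R * plane R => toC x.1) by exact: (cmeas_comp cmeas_toC).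
have mS (f : plane R -> Cx R) : cmeas f ->
    measurable_fun setT (fun x : plane R * plane R => Skern (f x.2) (e x.2) (toC x.1)).
  move=> mf; apply: measurable_Skern => //; first exact: (cmeas_comp mf).
  exact: (measurableT_comp me).
have mK : measurable_fun setT K.
  apply: emeasurable_funM; last by apply: emeasurable_funD; exact: mS.
  by apply/measurable_EFinP; exact: (measurableT_comp mc).
apply: (@le_trans _ _ (\int[dA R]_(z in D) \int[mu_disc]_w K (z, w))).
  apply: ge0_le_integral_nomeas => // z Dz; apply: (le_trans (hF z Dz)).
  by rewrite mu_discE; apply: ge0_integral_sub_setT => w; exact: (K0 (z, w)).
apply: (@le_trans _ _ (\int[dA R]_z \int[mu_disc]_w K (z, w))).
  by apply: ge0_integral_sub_setT => z; apply: integral_ge0 => w _; exact: (K0 (z, w)).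
rewrite tonelli_disc// mu_discE [leRHS]integral_mkcond.
have mSz (f : plane R -> Cx R) w : cmeas f ->
    measurable_fun setT (fun z : plane R => Skern (f w) (e w) (toC z)).
  move=> mf; exact: (measurable_fun_pair1 w (mS f mf)).
apply: ge0_le_integral_nomeas => w _.
  by apply: integral_ge0 => z _; exact: (K0 (z, w)).
rewrite /patch; case: ifPn => [/set_mem Dw|/negP Dw]; last first.
  rewrite integral0_eq// => z _; rewrite /K /= cD ?mul0e// => Dw'; apply: Dw; exact/mem_set.
rewrite /K /= ge0_integralZl_EFin//; first last.
- by apply: emeasurable_funD; exact: mSz.
- by move=> z _; rewrite adde_ge0// Skern_ge0.
rewrite EFinM; apply: lee_wpmul2l; first by rewrite lee_fin.
rewrite ge0_integralD//; first last.
- exact: mSz.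
- by move=> z _; exact: Skern_ge0.
- exact: mSz.
- by move=> z _; exact: Skern_ge0.
rewrite (_ : (96 / (pi * e w))%R = (48 / (pi * e w) + 48 / (pi * e w))%R); last by ring.
by rewrite EFinD; apply: leeD; exact: integral_Skern.
Qed.

Lemma measurable_disc_if (g : plane R -> R) (k : R) : measurable_fun setT g ->
  measurable_fun setT (fun w => if cabs (toC w) < 1 then g w else k)%R.
Proof.
move=> mg; apply: measurable_fun_if => //; last exact: measurable_funTS.
apply: measurable_fun_ltr; last exact: measurable_cst.
exact/measurable_cabs/cmeas_toC.
Qed.

Lemma tonelli_poles (F : plane R -> \bar R) (C : R) (p : Cx R) (b : plane R -> Cx R) :
  (0 <= C)%R -> cabs p = 1%R -> cmeas b -> (forall w, D w -> cabs (b w) < 1)%R ->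
  (forall z, D z -> 0 <= F z) ->
  (forall z, D z -> F z <= \int[mu]_(w in D) ((C * (1 - cabs (b w) ^+ 2))%:E *
     (Skern p (cabs (p - b w) / 2) (toC z) + Skern (b w) (cabs (p - b w) / 2) (toC z)))) ->
  \int[dA R]_(z in D) F z <= \int[mu]_(w in D) (192 / pi * C * ((1 - cabs (b w) ^+ 2) / cabs (p - b w)))%:E.
Proof.
move=> C0 p1 mb b1 F0 hF.
(* The values off the disc make [c] vanish there and keep [e] positive on the whole plane. *)
pose c (w : plane R) := if (cabs (toC w) < 1)%R then (C * (1 - cabs (b w) ^+ 2))%R else 0%R.
pose e (w : plane R) := if (cabs (toC w) < 1)%R then (cabs (p - b w) / 2)%R else 1%R.
have pb0 w : D w -> (0 < cabs (p - b w))%R.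
  by move=> /b1 bw1; have := cabs_ge_sub p (b w); rewrite p1; lra.
have pi0 : (0 < pi :> R)%R by exact: pi_gt0.
apply: (@le_trans _ _ (\int[mu]_(w in D) (c w * (96 / (pi * e w)))%:E)).
  apply: (@tonelli_upper F c e (fun=> p) b); last 1 first.
  - move=> z Dz; apply: (le_trans (hF z Dz)); apply: le_of_eq.
    by apply: eq_integral => w /set_mem Dw; rewrite /c /e (Dw : (cabs (toC w) < 1)%R).
  - apply: measurable_disc_if; apply: measurable_funM; first exact: measurable_cst.
    by apply: measurable_funB; [exact: measurable_cst|exact: measurable_cabs2].
  - apply: measurable_disc_if; apply: measurable_funM; last exact: measurable_cst.
    by apply: measurable_cabs; apply: cmeasB => //; exact: cmeas_cst.
  - exact: cmeas_cst.
  - exact: mb.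
  - by move=> w; rewrite /c; case: ifPn => // w1; rewrite mulr_ge0// ltW// one_sub_sqr_ge0// b1.
  - by move=> w; rewrite /c /D /discP /disc /=; case: ifP.
  - by move=> w; rewrite /e; case: ifPn => // w1; rewrite divr_gt0// pb0.
  - exact: F0.
apply: le_of_eq; apply: eq_integral => w /set_mem Dw; rewrite /c /e (Dw : (cabs (toC w) < 1)%R); congr (_%:E).
by move: (pb0 w Dw) (@pi R) pi0 => X0 P P0; field; rewrite !gt_eqF.
Qed.

(** [l] allows for the rotation that moves the singularity from 1 to any point of the circle; for
    [l = 1] the inner integral is [V mu]. *)
Lemma tonelli_lower : exists2 k : R, (0 < k)%R & forall a l : Cx R, (cabs a <= 1)%R -> cabs l = 1%R ->
  k%:E * \int[mu]_(w in D) ((1 - cabs (toC w) ^+ 2) / cabs (1 - a * (l * toC w))%R)%:E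
  <= \int[dA R]_(z in D) ((\int[mu]_(w in D) ((1 - cabs (toC z) ^+ 2) * (1 - cabs (toC w) ^+ 2) /
      cabs (1 - cconj (l * toC w) * toC z)%R ^+ 2)%:E) * ((cabs (1 - a * toC z)%R ^+ 2)^-1)%:E).
Proof.
have pi0 : (0 < pi :> R)%R by exact: pi_gt0.
(* The square of half-side [d / 16] has measure [d ^+ 2 / (64 * pi)], and the kernel is at least
   [(288 * d ^+ 3)^-1] on it: 18432 = 64 * 288. *)
have [kk hkk] : exists kk : R, kk = ((18432 * pi)^-1)%R by eexists.
have kk0 : (0 < kk)%R by rewrite hkk invr_gt0 mulr_gt0 ?ltr0n.
exists kk => // a l a1 l1; have c0 := ltW kk0.
pose k (z w : plane R) : R := ((1 - cabs (toC z) ^+ 2) * (1 - cabs (toC w) ^+ 2) /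
      cabs (1 - cconj (l * toC w) * toC z)%R ^+ 2)%R.
pose q (z : plane R) : R := ((cabs (1 - a * toC z)%R ^+ 2)^-1)%R.
pose K (x : plane R * plane R) := (if (cabs (toC x.1) < 1)%R && (cabs (toC x.2) < 1)%R
   then k x.1 x.2 * q x.1 else 0%R)%:E.
have k0 z w : D z -> D w -> (0 <= k z w)%R.
  move=> Dz Dw; rewrite /k divr_ge0 ?exprn_ge0 ?cabs_ge0// mulr_ge0// ltW// one_sub_sqr_ge0//.
have q0 z : (0 <= q z)%R by rewrite invr_ge0 exprn_ge0// cabs_ge0.
have K0 x : 0 <= K x.
  by rewrite /K lee_fin; case: ifP => // /andP[h1 h2]; rewrite mulr_ge0 ?k0.
have mfst : measurable_fun setT (fst : plane R * plane R -> plane R) by exact: measurable_fst.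
have msnd : measurable_fun setT (snd : plane R * plane R -> plane R) by exact: measurable_snd.
have mz : cmeas (fun x : plane R * plane R => toC x.1) by exact: (cmeas_comp cmeas_toC).
have mw : cmeas (fun x : plane R * plane R => toC x.2) by exact: (cmeas_comp cmeas_toC).
have mq : measurable_fun setT q.
  apply: measurable_inv_real; apply: measurable_cabs2; apply: cmeasB; first exact: cmeas_cst.
  by apply: cmeasM; [exact: cmeas_cst|exact: cmeas_toC].
have mk : measurable_fun setT (fun x : plane R * plane R => k x.1 x.2).
  apply: measurable_funM; first apply: measurable_funM.
  - exact: (measurableT_comp measurable_defect).
  - exact: (measurableT_comp measurable_defect).
  apply: measurable_inv_real; apply: measurable_cabs2; apply: cmeasB; first exact: cmeas_cst.
  apply: cmeasM => //; apply: cmeas_conj; apply: cmeasM => //; exact: cmeas_cst.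
have mK : measurable_fun setT K.
  apply/measurable_EFinP; apply: measurable_fun_if => //.
    by apply: measurable_and; apply: measurable_fun_ltr; do ?[exact: measurable_cst]; exact: measurable_cabs.
  apply: measurable_funTS; apply: measurable_funM => //; exact: (measurableT_comp mq).
have mh : measurable_fun setT (fun w : plane R => (1 - cabs (toC w) ^+ 2) / cabs (1 - a * (l * toC w)))%R.
  apply: measurable_funM; first exact: measurable_defect.
  apply: measurable_inv_real; apply: measurable_cabs; apply: cmeasB; first exact: cmeas_cst.
  by apply: cmeasM; [exact: cmeas_cst|apply: cmeasM; [exact: cmeas_cst|exact: cmeas_toC]].
rewrite -ge0_integralZl_EFin//; first last.
- by apply/measurable_EFinP; exact: measurable_funTS.
- by move=> w Dw; rewrite lee_fin divr_ge0 ?cabs_ge0// ltW// one_sub_sqr_ge0.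
apply: (@le_trans _ _ (\int[mu_disc]_w \int[dA R]_z K (z, w))).
  rewrite mu_discE integral_mkcond; apply: ge0_le_integral_nomeas => w _; rewrite /patch.
    case: ifPn => // /set_mem Dw; rewrite lee_fin mulr_ge0// divr_ge0 ?cabs_ge0// ltW// one_sub_sqr_ge0//.
  case: ifPn => [/set_mem Dw|_]; last by apply: integral_ge0 => z _; exact: K0.
  have z01 : (cabs (l * toC w) < 1)%R by rewrite cabsM l1 mul1r.
  set d := cabs (1 - a * (l * toC w))%R.
  have d0 : (0 < d)%R.
    have := cabs_ge_sub 1 (a * (l * toC w))%R; rewrite cabs1 cabsM -/d.
    have := cabs_ge0 a; have := cabs_ge0 (l * toC w)%R; clear -a1 z01; nra.
  have N0 := one_sub_sqr_ge0 (Dw : (cabs (toC w) < 1)%R).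
  pose y : R := ((1 - cabs (toC w) ^+ 2) / (288 * d ^+ 3))%R.
  have y0 : (0 <= y)%R.
    apply: divr_ge0; first exact: ltW.
    by apply: mulr_ge0; [exact: ler0n|exact/exprn_ge0/ltW].
  have r0 : (0 <= d / 16)%R by rewrite divr_ge0// ltW.
  apply: (@le_trans _ _ (\int[dA R]_z (if insq (RC (1 - d / 4) * (l * toC w)) (d / 16) (toC z) then y else 0%R)%:E)).
    rewrite integral_insq// -EFinM lee_fin; apply: le_of_eq.
    rewrite /y hkk; move: (@pi R) pi0 => P P0; field.
    by rewrite !gt_eqF.
  apply: ge0_le_integral_nomeas => z _; first by rewrite lee_fin; case: ifP.
  case: ifPn => hz; last exact: K0.
  have [z1 hl] := lower_kernel a1 z01 hz.
  rewrite /K /= z1 [X in _ && X](_ : _ = true)//= lee_fin /y /k /q -/d.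
  rewrite -/d in hl.
  rewrite [leRHS](_ : _ = ((1 - cabs (toC w) ^+ 2) * ((1 - cabs (toC z) ^+ 2) /
    (cabs (1 - a * toC z) ^+ 2 * cabs (1 - cconj (l * toC w) * toC z) ^+ 2)))%R); last by rewrite [in RHS]invfM; ring.
  by rewrite ler_wpM2l// ltW.
rewrite -tonelli_disc// [leRHS]integral_mkcond.
apply: ge0_le_integral_nomeas => z _; first by apply: integral_ge0 => w _; exact: K0.
rewrite /patch; case: ifPn => [/set_mem Dz|/negP Dz]; last first.
  rewrite integral0_eq// => w _; rewrite /K /= ifF//; apply/negP => /andP[h _].
  by apply: Dz; exact/mem_set.
rewrite mu_discE muleC -ge0_integralZl_EFin//; first last.
- by rewrite -/(q z).
- apply/measurable_EFinP; apply: measurable_funTS.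
  exact: (measurable_fun_pair2 z mk).
- by move=> w Dw; rewrite lee_fin; exact: k0.
rewrite [leRHS]integral_mkcond; apply: ge0_le_integral_nomeas => w _; first exact: K0.
rewrite /patch /K /=; case: ifPn => [/andP[h1 h2]|hn].
  by rewrite mem_set// -EFinM lee_fin mulrC.
by case: ifPn => // /set_mem Dw; rewrite -EFinM lee_fin; apply: mulr_ge0; [exact: q0|exact: k0].
Qed.

End Tonelli.

(** * Positive factors in integrals without measurability *)

Section ScaleNonMeasurable.
Local Open Scope ereal_scope.
Context d (T : measurableType d) (R : realType).
Variable mu : {measure set T -> \bar R}.
Import HBNNSimple.

(** Multiplication by [q] carries simple functions below [f] to simple functions below [g], so the
    suprema defining the integrals compare. *)
Lemma scale_integral_le (q : R) (D : set T) (f g : T -> \bar R) : (0 < q)%R ->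
  (forall x, D x -> 0 <= f x) -> (forall x, D x -> q%:E * f x <= g x) ->
  q%:E * \int[mu]_(x in D) f x <= \int[mu]_(x in D) g x.
Proof.
move=> q0 f0 fg.
have g0 x : D x -> 0 <= g x.
  by move=> Dx; apply: le_trans (fg x Dx); rewrite mule_ge0 ?f0// lee_fin ltW.
rewrite !ge0_integralE// -lee_pdivlMl//; apply: ge_ereal_sup => _ [h hf <-].
rewrite lee_pdivlMl//; apply: ereal_sup_ubound; exists (scale_nnsfun h (ltW q0)).
  move=> x /=; have := hf x; rewrite /patch; case: ifPn => [/set_mem Dx|_] hx.
    by rewrite EFinM (le_trans _ (fg x Dx))// lee_pmul2l.
  by rewrite EFinM -[leRHS](mule0 q%:E) lee_pmul2l.
by rewrite -sintegralrM.
Qed.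

Lemma integral_le_scale (q : R) (D : set T) (f g : T -> \bar R) : (0 < q)%R ->
  (forall x, D x -> 0 <= g x) -> (forall x, D x -> g x <= q%:E * f x) ->
  \int[mu]_(x in D) g x <= q%:E * \int[mu]_(x in D) f x.
Proof.
move=> q0 g0 gf; rewrite -lee_pdivrMl//; apply: scale_integral_le => //.
  by rewrite invr_gt0.
by move=> x Dx; rewrite lee_pdivrMl//; exact: gf.
Qed.

Lemma ereal_sup_ltyP (S : set (\bar R)) : ereal_sup S < +oo ->
  exists2 B : R, (0 <= B)%R & forall x, S x -> x <= B%:E.
Proof.
move=> h; case E : (ereal_sup S) h => [r| |]// _.
  exists (Num.max r 0%R); first by rewrite le_max lexx orbT.
  by move=> x /ereal_sup_ubound; rewrite E => /le_trans; apply; rewrite lee_fin le_max lexx.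
by exists 0%R => // x /ereal_sup_ubound; rewrite E => /le_trans; apply; exact: leNye.
Qed.

End ScaleNonMeasurable.

Section PlaneMeasurable.
Context {R : realType}.

Lemma cmeas_1subM (a : Cx R) : cmeas (fun w : plane R => 1 - a * toC w).
Proof.
apply: cmeasB; first exact: cmeas_cst.
by apply: cmeasM; [exact: cmeas_cst|exact: cmeas_toC].
Qed.

Lemma measurable_jint (a : Cx R) :
  measurable_fun setT (fun w : plane R => (1 - cabs (toC w) ^+ 2) / cabs (1 - a * toC w)).
Proof.
apply: measurable_funM; first exact: measurable_defect.
exact/measurable_inv_real/measurable_cabs/cmeas_1subM.
Qed.

Lemma cabs_1subM_gt0 (a z : Cx R) : cabs a <= 1 -> cabs z < 1 -> 0 < cabs (1 - a * z).
Proof.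
move=> a1 z1; have := cabs_ge_sub 1 (a * z); rewrite cabs1 cabsM.
have := cabs_ge0 z; have := cabs_ge0 a; nra.
Qed.

End PlaneMeasurable.

(** * Integrals of [V] compared with the Carleson-type integral *)

Section Carleson.
Local Open Scope ereal_scope.
Context {R : realType} (mu : {measure set (plane R) -> \bar R}).
Hypothesis hmu : \int[mu]_(w in @discP R) (1 - cabs (toC w) ^+ 2)%:E < +oo.

Let D := @discP R.

Definition jint (a : Cx R) : \bar R :=
  \int[mu]_(w in @discP R) ((1 - cabs (toC w) ^+ 2) / cabs (1 - a * toC w))%:E.

Definition jbounded := exists2 B : R, (0 <= B)%R & forall l : Cx R, cabs l = 1%R -> jint l <= B%:E.

Lemma jint_radial (a : Cx R) : (cabs a <= 1)%R ->
  exists2 l : Cx R, cabs l = 1%R & forall w, D w -> (cabs (1 - l * toC w) <= 2 * cabs (1 - a * toC w))%R.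
Proof.
move=> a1; have [l l1 aE] := polar_form a; exists l => // w Dw.
by rewrite aE; apply: radial_bound => //; rewrite cabs_ge0.
Qed.

Lemma V_ge0 (z : Cx R) : (cabs z < 1)%R -> 0 <= V mu z.
Proof. by move=> z1; apply: integral_ge0 => w Dw; rewrite lee_fin one_sub_sigma_ge0. Qed.

Lemma U_ge0 (z : Cx R) : (cabs z < 1)%R -> 0 <= U mu z.
Proof. by move=> z1; apply: integral_ge0 => w Dw; exact: green_ge0. Qed.

Lemma V_le_U (z : Cx R) : (cabs z < 1)%R -> V mu z <= U mu z.
Proof.
move=> z1; apply: ge0_le_integral_nomeas => w Dw; last exact: green_ge.
by rewrite lee_fin one_sub_sigma_ge0.
Qed.

Lemma integral_V_lower : exists2 k : R, (0 < k)%R & forall a : Cx R, (cabs a <= 1)%R ->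
  k%:E * jint a <=
  \int[@dA R]_(z in @discP R) (V mu (toC z) * ((cabs (1 - a * toC z)%R ^+ 2)^-1)%:E).
Proof.
have [k k0 hk] := tonelli_lower hmu; exists k => // a a1; have := hk _ _ a1 cabs1.
rewrite /jint (eq_integral (fun w => ((1 - cabs (toC w) ^+ 2) / cabs (1 - a * toC w))%:E)); last first.
  by move=> w _; rewrite mul1r.
move=> /le_trans; apply; apply: ge0_le_integral_nomeas => z Dz.
  apply: mule_ge0; last by rewrite lee_fin invr_ge0 exprn_ge0// cabs_ge0.
  apply: integral_ge0 => w Dw; rewrite lee_fin.
  by rewrite divr_ge0 ?exprn_ge0 ?cabs_ge0// mulr_ge0// ltW// one_sub_sqr_ge0.
apply: le_of_eq; congr (_ * _).
apply: eq_integral => w /set_mem Dw; rewrite one_sub_sigma// mul1r; congr (_ / _ ^+ 2)%:E.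
exact: cabs_1subC.
Qed.

(** With [l] the radial projection of [a], the pole on the circle is [cconj l]. Passing from [a] to
    [l] costs 4 after squaring and [kernel_Skern] costs 2, hence the 8 and 1536 = 192 * 8. *)
Lemma integral_V_upper (a : Cx R) (B : R) : (cabs a <= 1)%R ->
  (forall l : Cx R, cabs l = 1%R -> jint l <= B%:E) ->
  \int[@dA R]_(z in @discP R) (V mu (toC z) * ((cabs (1 - a * toC z)%R ^+ 2)^-1)%:E) <= (1536 / pi * B)%:E.
Proof.
move=> a1 hB; have [l l1 hl] := jint_radial a1.
have l'1 : cabs (cconj l) = 1%R by rewrite cabs_cconj.
have ll : (cconj l * l = 1)%R by rewrite mulrC mul_cconj l1 expr1n RC1.
have le (w : Cx R) : cabs (cconj l - w) = cabs (1 - l * w).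
  by rewrite -[LHS]mul1r -[X in (X * _)%R]l1 -cabsM mulrBr [X in (X - _)%R]mulrC ll.
have pi0 : (0 < pi :> R)%R by exact: pi_gt0.
apply: (@le_trans _ _ (\int[mu]_(w in D) (192 / pi * 8 * ((1 - cabs (toC w) ^+ 2) / cabs (cconj l - toC w)))%:E)).
  apply: (@tonelli_poles _ mu hmu _ 8 (cconj l) (@toC R)) => //.
  - exact: cmeas_toC.
  - by move=> z Dz; rewrite mule_ge0 ?V_ge0// lee_fin invr_ge0 exprn_ge0 ?cabs_ge0.
  - move=> z Dz; rewrite muleC.
    have az0 := cabs_1subM_gt0 a1 (Dz : (cabs (toC z) < 1)%R).
    apply: scale_integral_le; first by rewrite invr_gt0 exprn_gt0.
      by move=> w Dw; rewrite lee_fin one_sub_sigma_ge0.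
    move=> w Dw; have Dw' : (cabs (toC w) < 1)%R by [].
    rewrite -EFinM one_sub_sigma// cabs_1subC.
    have lz0 : (0 < cabs (1 - l * toC z))%R by apply: cabs_1subM_gt0; rewrite ?l1.
    have Z0 : (0 < cabs (1 - cconj (toC w) * toC z))%R.
      by apply: cabs_1subM_gt0 => //; rewrite cabs_cconj ltW.
    have Nz := one_sub_sqr_ge0 (Dz : (cabs (toC z) < 1)%R).
    have Nw := one_sub_sqr_ge0 Dw'.
    have Y0 := cabs_ge0 (toC z - toC w).
    have YZ : (cabs (toC z - toC w) <= cabs (1 - cconj (toC w) * toC z))%R.
      rewrite -(@ler_pXn2r _ 2) ?nnegrE ?cabs_ge0// -subr_ge0 moebius_norm.
      by rewrite mulr_ge0// ltW.
    pose y := ((1 - cabs (toC z) ^+ 2) / (cabs (1 - l * toC z) ^+ 2 * cabs (1 - cconj (toC w) * toC z) ^+ 2))%R.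
    have y0 : (0 <= y)%R by rewrite divr_ge0 ?mulr_ge0 ?exprn_ge0 ?(ltW Nz) ?cabs_ge0.
    have := @kernel_Skern _ (cconj l) (toC w) (toC z) y Dz l'1 Dw' y0.
    have E : cabs (toC z - cconj l) = cabs (1 - l * toC z) by rewrite cabsBC le.
    have hy : toC z != toC w -> (y <= (1 - cabs (toC z) ^+ 2) / (cabs (toC z - cconj l) ^+ 2 *
       cabs (1 - cconj (toC w) * toC z) * cabs (toC z - toC w)))%R.
      move=> zw; have Y1 : (0 < cabs (toC z - toC w))%R by rewrite cabs_gt0 subr_eq0.
      rewrite E /y ler_pM2l// lef_pV2 ?posrE ?mulr_gt0 ?exprn_gt0//.
      by rewrite -mulrA ler_pM2l ?exprn_gt0// expr2 ler_pM2l.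
    move=> /(_ hy) hS.
    apply: (@le_trans _ _ ((4 * (1 - cabs (toC w) ^+ 2))%:E * y%:E)).
      rewrite -EFinM lee_fin /y.
      move: (hl z Dz) lz0 az0 Z0 Nz Nw.
      move: (cabs (1 - l * toC z)) (cabs (1 - a * toC z)) (cabs (1 - cconj (toC w) * toC z))
        (1 - cabs (toC z) ^+ 2)%R (1 - cabs (toC w) ^+ 2)%R => X A Z N M hXA X0 A0 Z0 N0 M0.
      rewrite (_ : 4 * M * (N / (X ^+ 2 * Z ^+ 2)) = (X / 2) ^- 2 * (N * M / Z ^+ 2))%R; last first.
        by field; rewrite !gt_eqF.
      rewrite ler_pM2r; last by rewrite divr_gt0 ?mulr_gt0 ?exprn_gt0.
      rewrite lef_pV2 ?posrE ?exprn_gt0 ?divr_gt0//.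
      by apply: lerXn2r; rewrite ?nnegrE ?divr_ge0 ?(ltW X0) ?(ltW A0)//; lra.
    rewrite (_ : (8 * (1 - cabs (toC w) ^+ 2))%R = (4 * (1 - cabs (toC w) ^+ 2) * 2)%R); last by ring.
    rewrite [in leRHS]EFinM -muleA; apply: lee_wpmul2l => //.
    by rewrite lee_fin mulr_ge0 ?ler0n// ltW.
apply: (@le_trans _ _ ((1536 / pi)%:E * jint l)).
  have N0 w : D w -> (0 <= (1 - cabs (toC w) ^+ 2) / cabs (1 - l * toC w))%R.
    by move=> Dw; rewrite divr_ge0 ?cabs_ge0// ltW// one_sub_sqr_ge0.
  have c0 : (0 < 192 / pi * 8 :> R)%R by apply: mulr_gt0; [apply: divr_gt0; [rewrite ltr0n|]|rewrite ltr0n].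
  rewrite (_ : 1536 / pi = 192 / pi * 8)%R; last by ring.
  apply: integral_le_scale; first exact: c0.
    by move=> w Dw; rewrite le lee_fin; apply: mulr_ge0; [exact: ltW|exact: N0].
  by move=> w Dw; rewrite le -EFinM lexx.
rewrite [leRHS]EFinM; apply: lee_wpmul2l; last exact: hB.
by rewrite lee_fin divr_ge0 ?ler0n// ltW.
Qed.

End Carleson.

(** * Passage between the conditions and the Carleson-type bound *)

Section Conditions.
Local Open Scope ereal_scope.
Context {R : realType} (mu : {measure set (plane R) -> \bar R}).
Hypothesis hmu : \int[mu]_(w in @discP R) (1 - cabs (toC w) ^+ 2)%:E < +oo.

Let D := @discP R.

Lemma jint_le_of_V : exists2 C : R, (0 <= C)%R & forall (a : Cx R) (B : R), (cabs a <= 1)%R ->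
  \int[@dA R]_(z in @discP R) (V mu (toC z) * ((cabs (1 - a * toC z)%R ^+ 2)^-1)%:E) <= B%:E ->
  jint mu a <= (C * B)%:E.
Proof.
have [k k0 hk] := integral_V_lower hmu; exists k^-1%R; first by rewrite invr_ge0 ltW.
by move=> a B a1 /(le_trans (hk a a1)); rewrite -lee_pdivlMl.
Qed.

Lemma jbounded_circle :
  ereal_sup [set \int[@dA R]_(z in @discP R) (V mu (toC z) * ((cabs (1 - l * toC z)%R ^+ 2)^-1)%:E)
    | l in @circle R] < +oo -> jbounded mu.
Proof.
have [C C0 hC] := jint_le_of_V.
move=> /ereal_sup_ltyP[B B0 hB]; exists (C * B)%R; first exact: mulr_ge0.
by move=> l l1; apply: hC; [rewrite l1|apply: hB; exists l].
Qed.

Lemma jbounded_disc :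
  ereal_sup [set \int[@dA R]_(z in @discP R) (V mu (toC z) * ((cabs (1 - a * toC z)%R ^+ 2)^-1)%:E)
    | a in @disc R] < +oo -> jbounded mu.
Proof.
have [C C0 hC] := jint_le_of_V.
move=> /ereal_sup_ltyP[B B0 hB]; exists (C * B)%R; first exact: mulr_ge0.
move=> l l1.
pose r (n : nat) : R := (1 - n.+1%:R^-1)%R.
have r01 n : (0 <= r n < 1)%R.
  by rewrite subr_ge0 invf_le1// ler1n gtrBl invr_gt0 ltr0n.
pose a n : Cx R := (RC (r n) * l)%R.
have a1 n : (cabs (a n) < 1)%R.
  by have /andP[h0 h1] := r01 n; rewrite cabsM cabs_RC l1 mulr1 ger0_norm.
pose g n (w : plane R) : \bar R := ((1 - cabs (toC w) ^+ 2) / cabs (1 - a n * toC w))%:E.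
have hg n : \int[mu]_(w in D) g n w <= (C * B)%:E.
  by apply: hC; [exact: ltW|apply: hB; exists (a n) => //; exact: a1].
have cvg_g w : D w -> g n w @[n --> \oo] --> ((1 - cabs (toC w) ^+ 2) / cabs (1 - l * toC w))%:E.
  move=> Dw; have lw : (0 < cabs (1 - l * toC w))%R by apply: cabs_1subM_gt0; rewrite ?l1.
  apply: cvg_EFin; first exact: nearW.
  apply: cvgM; first exact: cvg_cst.
  apply: cvgV; first by rewrite gt_eqF.
  apply/cvgrPdist_le => eps eps0; near=> n.
  have dist : (`|cabs (1 - l * toC w) - cabs (1 - a n * toC w)| <= n.+1%:R^-1)%R.
    have E : cabs ((1 - l * toC w) - (1 - a n * toC w)) = (n.+1%:R^-1 * cabs (toC w))%R.
      rewrite (_ : _ - _ = - (RC (1 - r n) * l * toC w))%R; last by rewrite (RCB 1 (r n)) RC1 /a; ring.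
      rewrite cabsN !cabsM cabs_RC l1 mulr1 /r opprB addrC subrK ger0_norm// invr_ge0.
    have hle : (n.+1%:R^-1 * cabs (toC w) <= n.+1%:R^-1)%R by rewrite ler_piMr ?invr_ge0// ltW.
    have := cabs_ge_sub (1 - l * toC w) (1 - a n * toC w).
    have := cabs_ge_sub (1 - a n * toC w) (1 - l * toC w).
    rewrite [cabs (_ - (1 - l * _))]cabsBC E ler_norml; move: hle.
    by move: (n.+1%:R^-1)%R (cabs (1 - a n * toC w)) => x y hle h1 h2; apply/andP; split; lra.
  apply: (le_trans dist); apply: ltW; near: n; exact: (near_infty_natSinv_lt (PosNum eps0)).
have mg n : measurable_fun D (g n).
  by apply/measurable_EFinP; apply: measurable_funTS; exact: measurable_jint.
have g0 n w : D w -> 0 <= g n w.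
  by move=> Dw; rewrite lee_fin divr_ge0 ?cabs_ge0// ltW// one_sub_sqr_ge0.
have fat := fatou mu measurable_discP mg g0.
rewrite /jint (eq_integral (fun w => limn_einf (g^~ w))); last first.
  by move=> w /set_mem Dw; rewrite (cvg_limn_einf_sup (cvg_g w Dw)).1.
apply: (le_trans fat); rewrite limn_einf_lim; apply: lime_le; first exact: is_cvg_einfs.
apply: nearW => n; apply: le_trans (hg n).
by apply: ereal_inf_lbound; exists n => /=.
Unshelve. all: by end_near.
Qed.

Lemma V_sup_of_jbounded (S : set (Cx R)) : S `<=` [set a | (cabs a <= 1)%R] -> jbounded mu ->
  ereal_sup [set \int[@dA R]_(z in @discP R) (V mu (toC z) * ((cabs (1 - a * toC z)%R ^+ 2)^-1)%:E)
    | a in S] < +oo.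
Proof.
move=> hS [B B0 hB]; apply: (@le_lt_trans _ _ (1536 / pi * B)%:E); last exact: ltry.
by apply: ge_ereal_sup => _ [a Sa <-]; apply: integral_V_upper => //; exact: hS.
Qed.

Lemma Aut_rotation (l : Cx R) : cabs l = 1%R -> Aut (fun z => cconj l * z)%R.
Proof.
move=> l1; have l'1 : cabs (cconj l) = 1%R by rewrite cabs_cconj.
have ll : (cconj l * l = 1)%R by rewrite mulrC mul_cconj l1 expr1n RC1.
have l0 : (cconj l != 0)%R by rewrite -cabs_eq0 l'1 oner_eq0.
split.
  move=> z _; apply: cderiv_derivable; exact: (cderivZ (cconj l) (cderiv_id z)).
split.
- by move=> z; rewrite /disc /= cabsM l'1 mul1r.
- by move=> x y _ _ /(mulfI l0).
- move=> z z1; exists (l * z)%R; last by rewrite mulrA ll mul1r.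
  by rewrite /disc /= cabsM l1 mul1r.
Qed.

(** Rotations by [cconj l] are the automorphisms tested. [U] is bounded below by [V], whose rotated
    form is the inner integral of [tonelli_lower]; there [a = 1], because the singularity of the
    derivative stays at 1. *)
Lemma jbounded_of_MD (f : Cx R -> Cx R) (k : R) : (0 < k)%R ->
  (forall z, cabs z < 1 -> k / cabs (1 - z) <= cabs (f^`()%classic z))%R ->
  MD mu f -> jbounded mu.
Proof.
move=> k0 hk [hf hn].
have [s s0 hs] : exists2 B : R, (0 <= B)%R & forall x, [set (\int[@dA R]_(w in @discP R)
    ((cabs (f^`()%classic (toC w)) ^+ 2)%:E * U mu (phi (toC w)))) `^ 2^-1 | phi in @Aut R] x -> x <= B%:E.
  apply: ereal_sup_ltyP; apply: le_lt_trans hn; apply: leeDr; rewrite lee_fin; exact: cabs_ge0.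
have q0 : (0 < k ^+ 2)%R by rewrite exprn_gt0.
have [c c0 hc] := tonelli_lower hmu.
exists (c^-1 * (s `^ 2 / k ^+ 2))%R.
  by rewrite mulr_ge0 ?invr_ge0 ?(ltW c0)// divr_ge0 ?powR_ge0// ltW.
move=> l l1; have l1' : cabs (cconj l) = 1%R by rewrite cabs_cconj.
set I := \int[@dA R]_(w in @discP R) ((cabs (f^`()%classic (toC w)) ^+ 2)%:E * U mu (cconj l * toC w)%R).
have rot1 (z : plane R) : D z -> (cabs (cconj l * toC z) < 1)%R by move=> Dz; rewrite cabsM l1' mul1r.
have I0 : 0 <= I.
  apply: integral_ge0 => z Dz; apply: mule_ge0; first by rewrite lee_fin exprn_ge0// cabs_ge0.
  by apply: U_ge0; exact: rot1.
have Is : I <= (s `^ 2)%:E.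
  have -> : I = (I `^ 2^-1) `^ 2 by rewrite -poweRrM mulVf// poweRe1.
  rewrite -poweR_EFin; apply: gt0_ler_poweR; rewrite ?in_itv/= ?leey ?andbT ?poweR_ge0 ?lee_fin//.
  by apply: hs; exists (fun z => cconj l * z)%R; first exact: Aut_rotation.
have h : (k ^+ 2)%:E * (c%:E * jint mu l) <= I.
  apply: (@le_trans _ _ ((k ^+ 2)%:E * \int[dA R]_(z in D) ((\int[mu]_(w in D) ((1 - cabs (toC z) ^+ 2) *
     (1 - cabs (toC w) ^+ 2) / cabs (1 - cconj (l * toC w) * toC z)%R ^+ 2)%:E) * ((cabs (1 - 1 * toC z)%R ^+ 2)^-1)%:E))).
    apply: lee_wpmul2l; first by rewrite lee_fin ltW.
    have := hc 1%R l _ l1; rewrite cabs1 lexx => /(_ isT); rewrite /jint.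
    by under eq_integral do rewrite mul1r.
  have VE (z : plane R) : D z -> \int[mu]_(w in D) ((1 - cabs (toC z) ^+ 2) *
     (1 - cabs (toC w) ^+ 2) / cabs (1 - cconj (l * toC w) * toC z)%R ^+ 2)%:E = V mu (cconj l * toC z)%R.
    move=> Dz; apply: eq_integral => w /set_mem Dw; rewrite one_sub_sigma//; last exact: rot1.
    rewrite cabs_1subC cabsM l1' mul1r; congr (_ / cabs (1 - _) ^+ 2)%:E.
    by rewrite cconjM cconjK; ring.
  apply: scale_integral_le => // z Dz; rewrite VE//.
    by apply: mule_ge0; [exact/V_ge0/rot1|rewrite lee_fin invr_ge0 exprn_ge0// cabs_ge0].
  rewrite mul1r muleC -muleA [leRHS]muleC; apply: lee_pmul.
  - exact/V_ge0/rot1.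
  - by rewrite -EFinM lee_fin mulr_ge0 ?invr_ge0 ?exprn_ge0 ?cabs_ge0// ltW.
  - exact/V_le_U/rot1.
  rewrite -EFinM lee_fin mulrC -exprVn -exprMn; apply: lerXn2r; rewrite ?nnegrE ?mulr_ge0 ?invr_ge0 ?cabs_ge0 ?(ltW k0)//.
  exact: hk.
move: (le_trans h Is); rewrite -lee_pdivlMl// -lee_pdivlMl// => /le_trans; apply.
by rewrite -!EFinM lee_fin [(_^-1 * s `^ 2)%R]mulrC.
Qed.

End Conditions.

(** * Membership from the Carleson-type bound *)

Section Membership.
Local Open Scope ereal_scope.
Context {R : realType} (mu : {measure set (plane R) -> \bar R}).
Hypothesis hmu : \int[mu]_(w in @discP R) (1 - cabs (toC w) ^+ 2)%:E < +oo.

Let D := @discP R.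

(** Invariance removes the automorphism from the Green function and leaves the pole [b]. The 4 is 2
    from [green_le] times 2 from [kernel_Skern]. *)
Lemma green_Skern (beta c z b : Cx R) : (cabs beta < 1)%R -> cabs c = 1%R -> (cabs z < 1)%R -> (cabs b < 1)%R ->
  (((cabs (1 - z) ^+ 2)^-1)%:E * green (c * mob beta z) (c * mob beta b) <=
   (4 * (1 - cabs b ^+ 2))%:E * (Skern 1 (cabs (1 - b) / 2) z + Skern b (cabs (1 - b) / 2) z))%E.
Proof.
move=> b1 c1 z1 bb1.
have Nb := one_sub_sqr_ge0 bb1; have Nz := one_sub_sqr_ge0 z1.
have kern := @kernel_Skern _ 1%R b z _ z1 cabs1 bb1.
set S := Skern 1 _ z + _ in kern *.
have M0 : (0 < 4 * (1 - cabs b ^+ 2))%R by apply: mulr_gt0 => //; rewrite ltr0n.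
(* On the diagonal both sides are [+oo]: there [kern] puts [2%:E * S] above every nonnegative
   real. *)
have [zb|zb] := eqVneq z b.
  suff -> : S = +oo by rewrite gt0_muley ?leey// lte_fin.
  apply/eqyP => A A0; rewrite -(@lee_pmul2l _ 2%:E) ?lte_fin ?ltr0n//.
  rewrite -EFinM; apply: kern; first by rewrite mulr_ge0 ?ler0n// ltW.
  by rewrite zb eqxx.
have X0 : (0 < cabs (1 - z))%R by have := @cabs_1subM_gt0 R 1%R z; rewrite mul1r cabs1; apply.
have Z0 : (0 < cabs (1 - cconj b * z))%R by apply: cabs_1subM_gt0; rewrite ?cabs_cconj// ltW.
have Y0 : (0 < cabs (z - b))%R by rewrite cabs_gt0 subr_eq0.
have ZY : (cabs (1 - cconj b * z) ^+ 2 - cabs (z - b) ^+ 2 = (1 - cabs b ^+ 2) * (1 - cabs z ^+ 2))%R.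
  exact: moebius_norm.
have YZ : (cabs (z - b) <= cabs (1 - cconj b * z))%R.
  by rewrite -(@ler_pXn2r _ 2) ?nnegrE ?cabs_ge0// -subr_ge0 ZY mulr_ge0// ltW.
have beta0 := one_sub_sqr_ge0 b1.
have bz0 : (0 < cabs (1 - cconj beta * z))%R by apply: cabs_1subM_gt0; rewrite ?cabs_cconj// ltW.
have bw0 : (0 < cabs (1 - cconj beta * b))%R by apply: cabs_1subM_gt0; rewrite ?cabs_cconj// ltW.
have dm : cabs (c * mob beta z - c * mob beta b) =
  (cabs (z - b) * (1 - cabs beta ^+ 2) / (cabs (1 - cconj beta * z) * cabs (1 - cconj beta * b)))%R.
  by rewrite -mulrBr cabsM c1 mul1r mob_sub.
have ne : (c * mob beta z != c * mob beta b)%R.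
  by rewrite -subr_eq0 -cabs_gt0 dm divr_gt0 ?mulr_gt0.
have ratio : (cabs (1 - cconj (c * mob beta b) * (c * mob beta z)) / cabs (c * mob beta z - c * mob beta b)
   = cabs (1 - cconj b * z) / cabs (z - b))%R.
  rewrite dm (_ : cconj (c * mob beta b) * (c * mob beta z) = cconj (mob beta b) * mob beta z)%R.
    by rewrite mob_1sub//; field; rewrite !gt_eqF.
  rewrite cconjM (_ : _ * _ = (c * cconj c) * (cconj (mob beta b) * mob beta z))%R; last by ring.
  by rewrite mul_cconj c1 expr1n RC1 mul1r.
have X20 : (0 <= (cabs (1 - z) ^+ 2)^-1)%R by rewrite invr_ge0 exprn_ge0// ltW.
apply: (le_trans (lee_wpmul2l _ (green_le Y0 YZ ne ratio))); first by rewrite lee_fin.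
pose y := ((1 - cabs z ^+ 2) / (cabs (1 - z) ^+ 2 * cabs (1 - cconj b * z) * cabs (z - b)))%R.
rewrite ZY -EFinM [X in X%:E](_ : _ = (2 * (1 - cabs b ^+ 2) * y))%R; last first.
  by rewrite /y; field; rewrite !gt_eqF.
rewrite EFinM (_ : (4 * (1 - cabs b ^+ 2))%R = (2 * (1 - cabs b ^+ 2) * 2)%R); last by ring.
rewrite [in leRHS]EFinM -muleA; apply: lee_wpmul2l; first by rewrite lee_fin mulr_ge0 ?ler0n// ltW.
apply: kern => [|_]; first by rewrite divr_ge0 ?mulr_ge0 ?exprn_ge0 ?(ltW Nz) ?(ltW X0) ?(ltW Y0) ?(ltW Z0).
by rewrite (cabsBC z 1).
Qed.

(** Origin of the constant: 192 from [tonelli_poles], 4 from [green_Skern], 4 from [inverse_bound],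
    and 3 from the final bound [2 * B + B]. *)
Lemma dirichlet_bound (g : Cx R -> Cx R) (phi : Cx R -> Cx R) (K B : R) : (0 < K)%R ->
  (forall z, cabs z < 1 -> cabs (g z) <= K / cabs (1 - z))%R ->
  (forall l : Cx R, cabs l = 1%R -> jint mu l <= B%:E) -> autom phi ->
  \int[@dA R]_(w in @discP R) ((cabs (g (toC w)) ^+ 2)%:E * U mu (phi (toC w)))
    <= (9216 * K ^+ 2 / pi * B)%:E.
Proof.
move=> K0 gK hB aphi.
have [_ phi1 _ _] := aphi.
have [beta [c [beta1 c1 phiE]]] := autom_moebius aphi.
have betaN1 : (cabs (- beta) < 1)%R by rewrite cabsN.
have pi0 : (0 < pi :> R)%R by exact: pi_gt0.
pose b (w : plane R) : Cx R := mob (- beta) (cconj c * toC w).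
have cw1 (w : plane R) : (cabs (toC w) < 1 -> cabs (cconj c * toC w) < 1)%R.
  by rewrite cabsM cabs_cconj c1 mul1r.
have b1 (w : plane R) : (cabs (toC w) < 1 -> cabs (b w) < 1)%R by move=> w1; apply: mob_disc => //; exact: cw1.
have bK (w : plane R) : (cabs (toC w) < 1 -> c * mob beta (b w) = toC w)%R.
  move=> w1; have := @mobK _ (- beta)%R (cconj c * toC w)%R betaN1 (cw1 w w1); rewrite opprK => ->.
  by rewrite mulrA mul_cconj c1 expr1n RC1 mul1r.
have mb : cmeas b.
  apply: cmeas_div; last first.
    apply: cmeasB; first exact: cmeas_cst.
    by apply: cmeasM; [exact: cmeas_cst|apply: cmeasM; [exact: cmeas_cst|exact: cmeas_toC]].
  apply: cmeasB; last exact: cmeas_cst.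
  by apply: cmeasM; [exact: cmeas_cst|exact: cmeas_toC].
have K20 : (0 < K ^+ 2)%R by rewrite exprn_gt0.
apply: (@le_trans _ _ (\int[mu]_(w in D) (192 / pi * (4 * K ^+ 2) * ((1 - cabs (b w) ^+ 2) / cabs (1 - b w)))%:E)).
  apply: (@tonelli_poles _ mu hmu _ (4 * K ^+ 2)%R 1%R b) => //.
  - by apply: mulr_ge0; [exact: ler0n|exact: ltW].
  - exact: cabs1.
  - by move=> z Dz; apply: mule_ge0; [rewrite lee_fin exprn_ge0// cabs_ge0|apply: U_ge0; exact: phi1].
  - move=> z Dz; have X0 : (0 < cabs (1 - toC z))%R.
      by have := @cabs_1subM_gt0 R 1%R (toC z); rewrite mul1r cabs1; apply.
    apply: (@le_trans _ _ ((K ^+ 2 * (cabs (1 - toC z) ^+ 2)^-1)%:E * U mu (phi (toC z)))).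
      apply: lee_wpmul2r; first by apply: U_ge0; exact: phi1.
      rewrite lee_fin -exprVn -exprMn; apply: lerXn2r; rewrite ?nnegrE ?cabs_ge0 ?divr_ge0 ?cabs_ge0 ?(ltW K0)//.
      exact: gK.
    apply: scale_integral_le; first by rewrite mulr_gt0// invr_gt0 exprn_gt0.
      by move=> w Dw; apply: green_ge0 => //; exact: phi1.
    move=> w Dw; have Dw' : (cabs (toC w) < 1)%R by [].
    rewrite phiE// -[in X in green _ X](bK w Dw').
    rewrite (_ : 4 * K ^+ 2 * (1 - cabs (b w) ^+ 2) = K ^+ 2 * (4 * (1 - cabs (b w) ^+ 2)))%R; last by ring.
    rewrite !(EFinM (K ^+ 2)) -!muleA; apply: lee_wpmul2l; first by rewrite lee_fin ltW.
    by apply: green_Skern => //; exact: b1.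
have c0 : (0 <= 192 / pi * (4 * K ^+ 2))%R.
  by apply: mulr_ge0; [apply: divr_ge0; [exact: ler0n|exact: ltW]|apply: mulr_ge0; [exact: ler0n|exact: ltW]].
have [a [eta [a1 eta1 hinv]]] := inverse_bound beta1 c1.
(* The point [a] of [inverse_bound] is interior while the assumption concerns the circle, so [a] is
   replaced by its radial projection at the cost of a factor 2. *)
have [l l1 hl] := jint_radial (ltW a1).
pose j (x : Cx R) (w : plane R) : R := ((1 - cabs (toC w) ^+ 2) / cabs (1 - x * toC w))%R.
have j0 (x : Cx R) w : D w -> 0 <= (j x w)%:E.
  by move=> Dw; rewrite lee_fin divr_ge0 ?cabs_ge0// ltW// one_sub_sqr_ge0.
have mj (x : Cx R) : measurable_fun D (EFin \o j x).
  by apply/measurable_EFinP; apply: measurable_funTS; exact: measurable_jint.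
apply: (@le_trans _ _ ((3072 * K ^+ 2 / pi)%:E * \int[mu]_(w in D) (2%:E * (j l w)%:E + (j eta w)%:E))).
  apply: integral_le_scale => [|w Dw|w Dw].
  - by apply: divr_gt0; [apply: mulr_gt0; [rewrite ltr0n|exact: K20]|exact: pi0].
  - rewrite lee_fin; apply: mulr_ge0; first exact: c0.
    by rewrite divr_ge0 ?cabs_ge0// ltW// one_sub_sqr_ge0// b1.
  have Dw' : (cabs (toC w) < 1)%R by [].
  rewrite -EFinM lee_fin.
  have N0 := one_sub_sqr_ge0 Dw'.
  have A0 : (0 < cabs (1 - a * toC w))%R by apply: cabs_1subM_gt0 => //; exact: ltW.
  have L0 : (0 < cabs (1 - l * toC w))%R by apply: cabs_1subM_gt0 => //; rewrite l1.
  have lA : ((cabs (1 - a * toC w))^-1 <= 2 * (cabs (1 - l * toC w))^-1)%R.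
    rewrite -[leRHS]invrK invfM invrK lef_pV2 ?posrE ?mulr_gt0 ?invr_gt0//.
    by rewrite [leLHS]mulrC ler_pdivrMr// [leRHS]mulrC; exact: hl.
  have hi := hinv _ Dw'; rewrite -/(b w) in hi.
  rewrite /j.
  apply: (@le_trans _ _ (192 / pi * (4 * K ^+ 2) * (4 * (1 - cabs (toC w) ^+ 2) *
      (2 * (cabs (1 - l * toC w))^-1 + (cabs (1 - eta * toC w))^-1)))%R).
    apply: ler_wpM2l; first exact: c0.
    apply: (le_trans hi); apply: ler_wpM2l; last by rewrite lerD2r.
    by apply: mulr_ge0; [exact: ler0n|exact: ltW].
  by apply: le_of_eq; ring.
rewrite ge0_integralD//; first last.
- exact: mj.
- by move=> w; exact: j0.
- by apply: measurable_funeM; exact: mj.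
- by move=> w Dw; apply: mule_ge0; [rewrite lee_fin ler0n|exact: j0].
- exact: measurable_discP.
rewrite ge0_integralZl_EFin//; first last.
- exact: mj.
- by move=> w; exact: j0.
- exact: measurable_discP.
rewrite (_ : 9216 * K ^+ 2 / pi * B = 3072 * K ^+ 2 / pi * (2 * B + B))%R; last by ring.
rewrite [leRHS]EFinM; apply: lee_wpmul2l.
  by rewrite lee_fin; apply: divr_ge0; [apply: mulr_ge0; [exact: ler0n|exact: ltW]|exact: ltW].
rewrite (EFinD (2 * B)) (EFinM 2 B); apply: leeD; last exact: hB.
by apply: lee_wpmul2l; [rewrite lee_fin ler0n|exact: hB].
Qed.

Lemma autom_Aut (phi : Cx R -> Cx R) : Aut phi -> autom phi.
Proof.
move=> [hphi [hm hi hs]]; split.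
- by move=> z z1; exists (phi^`()%classic z); apply/derivable_cderiv/hphi.
- by move=> z; exact: hm.
- by move=> z w z1 w1; apply: hi; exact/mem_set.
- by move=> w w1; have [z z1 <-] := hs w w1; exists z.
Qed.

Lemma MD_of_jbounded (f : Cx R -> Cx R) (K : R) : jbounded mu -> (0 < K)%R ->
  (forall z, (cabs z < 1)%R -> exists2 d, cderiv f z d & (cabs d <= K / cabs (1 - z))%R) -> MD mu f.
Proof.
move=> [B B0 hB] K0 hK.
have hf' z : (cabs z < 1)%R -> (cabs (f^`()%classic z) <= K / cabs (1 - z))%R.
  by move=> /hK[d /cderiv_derive1 ->].
split; first by move=> z /hK[d hd _]; exact: cderiv_derivable hd.
have B1 : 0 <= (9216 * K ^+ 2 / pi * B)%:E.
  rewrite lee_fin; apply: mulr_ge0; last exact: B0.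
  apply: divr_ge0; last exact: pi_ge0.
  by apply: mulr_ge0; [exact: ler0n|exact/exprn_ge0/ltW].
apply: (@le_lt_trans _ _ ((cabs (f 0))%:E + ((9216 * K ^+ 2 / pi * B)%:E `^ 2^-1))); last first.
  by rewrite poweR_EFin -EFinD ltry.
apply: leeD; first exact: lexx.
apply: ge_ereal_sup => _ [phi /autom_Aut aphi <-].
have [_ phi1 _ _] := aphi.
apply: gt0_ler_poweR.
- by rewrite invr_ge0 ler0n.
- rewrite in_itv/= leey andbT; apply: integral_ge0 => z Dz.
  by apply: mule_ge0; [rewrite lee_fin exprn_ge0// cabs_ge0|apply: U_ge0; exact: phi1].
- by rewrite in_itv /= leey B1.
- exact: (@dirichlet_bound (fun z => f^`()%classic z) phi K B).
Qed.

End Membership.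

(** * Equivalence of the four conditions *)

Section Equivalences.
Context {R : realType} (mu : {measure set (plane R) -> \bar R}).
Hypothesis hmu : (\int[mu]_(w in @discP R) (1 - cabs (toC w) ^+ 2)%:E < +oo)%E.

Lemma jbounded_of_hilbert :
  (forall f : Cx R -> Cx R, Hinf f -> MD mu (hilbert f)) -> jbounded mu.
Proof.
move=> /(_ _ (Hinf_cst 1)); apply: (@jbounded_of_MD R mu hmu _ 4^-1).
  by rewrite invr_gt0 ltr0n.
by move=> z /hilbert_cst1[d /cderiv_derive1 ->].
Qed.

Lemma hilbert_of_jbounded :
  jbounded mu -> forall f : Cx R -> Cx R, Hinf f -> MD mu (hilbert f).
Proof.
move=> J f /hilbert_Hinf[K hK].
apply: (@MD_of_jbounded R mu hmu _ (Num.max K 1) J); first by rewrite lt_max ltr01 orbT.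
move=> z /hK[d hd dK]; exists d => //; apply: le_trans dK _.
by rewrite ler_wpM2r ?invr_ge0 ?cabs_ge0// le_max lexx.
Qed.

Lemma jbounded_of_Log : MD mu (fun z => Log (1 - z)) -> jbounded mu.
Proof.
apply: (@jbounded_of_MD R mu hmu _ 1) => // z z1.
by rewrite (cderiv_derive1 (cderiv_Log1B z1)) cabsN cabsV div1r.
Qed.

Lemma Log_of_jbounded : jbounded mu -> MD mu (fun z => Log (1 - z)).
Proof.
move=> J; apply: (@MD_of_jbounded R mu hmu _ 1 J) => // z z1.
by exists (- (1 - z)^-1); [exact: cderiv_Log1B|rewrite cabsN cabsV div1r].
Qed.

End Equivalences.

Theorem theorem1p2 (R : realType) (mu : {measure set (plane R) -> \bar R})
    (hmu : (\int[mu]_(w in @discP R)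
              (1 - cabs (toC w) ^+ 2)%:E < +oo)%E) :
  [<-> (forall f : Cx R -> Cx R, Hinf f -> MD mu (hilbert f));
       MD mu (fun z => Log (1 - z));
       (ereal_sup [set \int[@dA R]_(z in @discP R)
                         (V mu (toC z) *
                          ((cabs (1 - l * toC z)%R ^+ 2)^-1)%:E)
                  | l in @circle R] < +oo)%E;
       (ereal_sup [set \int[@dA R]_(z in @discP R)
                         (V mu (toC z) *
                          ((cabs (1 - a * toC z)%R ^+ 2)^-1)%:E)
                  | a in @disc R] < +oo)%E ].
Proof.
tfae.
- by move=> /(jbounded_of_hilbert hmu)/(Log_of_jbounded hmu).
- move=> /(jbounded_of_Log hmu)/(V_sup_of_jbounded hmu); apply => l /= ->; exact: lexx.
- move=> /(jbounded_circle hmu)/(V_sup_of_jbounded hmu); apply => a; exact: ltW.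
- by move=> /(jbounded_disc hmu)/(hilbert_of_jbounded hmu).
Qed.
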